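(* Let $n,m\ge 1$. Regard the braided exterior algebra $\bigwedge_q(V^{(nm)})$ as a $U_q(\mathfrak{gl}_n)\otimes U_q(\mathfrak{gl}_m)$-module, where $U_q(\mathfrak{gl}_n)$ acts through the algebra homomorphism $\lambda_q\colon U_q(\mathfrak{gl}_n)\to Cl_q(nm)$ and $U_q(\mathfrak{gl}_m)$ acts through the algebra homomorphism $\rho_q\colon U_q(\mathfrak{gl}_m)\to Cl_q(nm)$, both followed by the action of $Cl_q(nm)$ on $\bigwedge_q(V^{(nm)})$. As a $U_q(\mathfrak{gl}_n)\otimes U_q(\mathfrak{gl}_m)$-module, $$\bigwedge\nolimits_q(V^{(nm)})\;\cong\;\bigoplus_\mu V^{(n)}_\mu\otimes V^{(m)}_{\mu'},$$ where the sum ranges over all partitions $\mu$ whose Young diagram fits in an $n\times m$ rectangle (at most $n$ rows, each of length at most $m$), and $\mu'$ is the conjugate partition of $\mu$. In particular, $\bigwedge_q(V^{(nm)})$ is multiplicity-free as a $U_q(\mathfrak{gl}_n)\otimes U_q(\mathfrak{gl}_m)$-module. Consequently, the subalgebras of $\mathrm{End}\big(\bigwedge_q(V^{(nm)})\big)$ generated by $U_q(\mathfrak{gl}_n)$ via $\lambda_q$ and by $U_q(\mathfrak{gl}_m)$ via $\rho_q$ are mutual commutants, i.e. each is the full commutant of the other.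
   Context: Let $q$ be an indeterminate; all algebras and modules are over $\mathbb{C}(q)$. Quantum group. For $p\ge1$, $U_q(\mathfrak{gl}_p)$ is the unital associative algebra generated by $E_i,F_i$ ($1\le i\le p-1$) and pairwise commuting invertible $L_i^{\pm1}$ ($1\le i\le p$), with $K_i=L_iL_{i+1}^{-1}$, subject to $L_iE_jL_i^{-1}=q^{\delta_{ij}-\delta_{i,j+1}}E_j$, $L_iF_jL_i^{-1}=q^{-\delta_{ij}+\delta_{i,j+1}}F_j$, $E_iF_j-F_jE_i=\delta_{ij}\frac{K_i-K_i^{-1}}{q-q^{-1}}$, and the $q$-Serre relations $X_iX_j=X_jX_i$ if $|i-j|>1$, $X_i^2X_j-(q+q^{-1})X_iX_jX_i+X_jX_i^2=0$ if $|i-j|=1$, for $X=E$ and $X=F$. A superscript $(p)$ on a generator indicates that it belongs to $U_q(\mathfrak{gl}_p)$. For a partition $\mu=(\mu_1\ge\dots\ge\mu_p\ge0)$, $V^{(p)}_\mu$ is the finite-dimensional irreducible $U_q(\mathfrak{gl}_p)$-module with highest weight $\mu$, i.e. generated by a vector $v$ with $E_iv=0$ and $L_iv=q^{\mu_i}v$ for all $i$. Quantum Clifford algebra. $Cl_q(N)$ is the unital associative algebra generated by $\psi_i,\psi_i^\dagger,\omega_i^{\pm1}$ ($1\le i\le N$) with relations: the $\omega_i^{\pm1}$ commute and $\omega_i\omega_i^{-1}=1$; $\omega_i\psi_j\omega_i^{-1}=q^{\delta_{ij}}\psi_j$; $\omega_i\psi_j^\dagger\omega_i^{-1}=q^{-\delta_{ij}}\psi_j^\dagger$;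 $\psi_i\psi_j+\psi_j\psi_i=0=\psi_i^\dagger\psi_j^\dagger+\psi_j^\dagger\psi_i^\dagger$ for all $i,j$; $\psi_i\psi_j^\dagger+\psi_j^\dagger\psi_i=0$ for $i\ne j$; $\psi_i\psi_i^\dagger+q\psi_i^\dagger\psi_i=\omega_i^{-1}$; $\psi_i\psi_i^\dagger+q^{-1}\psi_i^\dagger\psi_i=\omega_i$. Braided exterior algebra. $\bigwedge_q(V^{(N)})$, where $V^{(N)}$ is the natural $U_q(\mathfrak{gl}_N)$-module with basis $v_1,\dots,v_N$, is the unital associative algebra generated by $v_1,\dots,v_N$ with relations $v_i^2=0$ and $v_iv_j=-q\,v_jv_i$ for $i<j$. It has basis $v(\ell)=v_1^{\ell_1}\cdots v_N^{\ell_N}$, $\ell\in\{0,1\}^N$; set $v(\ell)=0$ if $\ell\in\mathbb{Z}^N\setminus\{0,1\}^N$. The algebra $Cl_q(N)$ acts on it by $\psi_jv(\ell)=(-1)^{\ell_1+\cdots+\ell_{j-1}}v(\ell-e_j)$, $\psi_j^\dagger v(\ell)=(-1)^{\ell_1+\cdots+\ell_{j-1}}v(\ell+e_j)$, $\omega_jv(\ell)=q^{-\ell_j}v(\ell)$, where $e_j$ is the $j$th standard basis vector. The map $\lambda_q$. With $\kappa_{i,<j}=\prod_{p<j}\omega_{i+(p-1)n}^{-1}\omega_{i+1+(p-1)n}$ and $\kappa_{i,>j}=\prod_{p>j}\omega_{i+(p-1)n}^{-1}\omega_{i+1+(p-1)n}$ (where $1\le p\le m$), $\lambda_q$ is given by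 $E_i^{(n)}\mapsto q^{-1}\sum_{j=1}^m\omega_{i+(j-1)n}^{-1}\psi_{i+(j-1)n}^\dagger\psi_{i+1+(j-1)n}\kappa_{i,>j}$, $F_i^{(n)}\mapsto\sum_{j=1}^m\omega_{i+(j-1)n}\kappa_{i,<j}^{-1}\psi_{i+1+(j-1)n}^\dagger\psi_{i+(j-1)n}$, $L_i^{(n)}\mapsto\prod_{j=1}^m\omega_{i+(j-1)n}^{-1}$. The map $\rho_q$. With $\kappa_{<i,j}=\prod_{p<i}\omega_{p+(j-1)n}^{-1}\omega_{p+jn}$ and $\kappa_{>i,j}=\prod_{p>i}\omega_{p+(j-1)n}^{-1}\omega_{p+jn}$ (where $1\le p\le n$), $\rho_q$ is given by $E_j^{(m)}\mapsto\sum_{i=1}^n\kappa_{<i,j}\psi_{i+(j-1)n}^\dagger\psi_{i+jn}$, $F_j^{(m)}\mapsto\sum_{i=1}^n\psi_{i+jn}^\dagger\psi_{i+(j-1)n}\kappa_{>i,j}^{-1}$, $L_j^{(m)}\mapsto\prod_{i=1}^n\omega_{i+(j-1)n}^{-1}$. These are algebra homomorphisms and the two induced actions on $\bigwedge_q(V^{(nm)})$ commute. *)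

(* Defs.v *)
From HB Require Import structures.
From mathcomp Require Import all_boot all_order all_algebra.
From mathcomp Require Import fraction generic_quotient.
From mathcomp Require Import complex.
From mathcomp Require Import all_classical all_reals.

Set Implicit Arguments.
Unset Strict Implicit.
Unset Printing Implicit Defensive.

Import GRing.Theory.
Local Open Scope ring_scope.
Local Open Scope classical_set_scope.
Local Open Scope quotient_scope.

Declare Scope term_scope.
Delimit Scope term_scope with T.

Inductive term (K X : Type) : Type :=
| Gen of X
| Cst of K
| Add of term K X & term K X
| Mul of term K X & term K X.

Arguments Gen {K X}.
Arguments Cst {K X}.
Arguments Add {K X}.
Arguments Mul {K X}.
Bind Scope term_scope with term.

Notation "x + y" := (Add x y) : term_scope.
Notation "x * y" := (Mul x y) : term_scope.
Notation "c *: x" := (Mul (Cst c%R) x) : term_scope.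
Notation "x - y" := (Add x (Mul (Cst (-1)%R) y)) : term_scope.
Notation "0" := (Cst 0%R) : term_scope.
Notation "1" := (Cst 1%R) : term_scope.

HB.instance Definition _ (K X : Type) := gen_eqMixin (term K X).
HB.instance Definition _ (K X : Type) := gen_choiceMixin (term K X).

Section Presentation.
Variables (K : fieldType) (X : Type) (rel : term K X -> term K X -> Prop).

(* The least congruence that contains [rel] and makes the quotient a unital
   associative K-algebra. *)
Inductive congr : term K X -> term K X -> Prop :=
| congr_rel x y : rel x y -> congr x y
| congr_refl x : congr x x
| congr_sym x y : congr x y -> congr y x
| congr_trans y x z : congr x y -> congr y z -> congr x z
| congr_add x x' y y' : congr x x' -> congr y y' -> congr (x + y)%T (x' + y')%T
| congr_mul x x' y y' : congr x x' -> congr y y' -> congr (x * y)%T (x' * y')%T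
| congr_addA x y z : congr (x + (y + z))%T (x + y + z)%T
| congr_addC x y : congr (x + y)%T (y + x)%T
| congr_add0 x : congr (0 + x)%T x
| congr_addN x : congr (x - x)%T 0%T
| congr_mulA x y z : congr (x * (y * z))%T (x * y * z)%T
| congr_mul1l x : congr (1 * x)%T x
| congr_mul1r x : congr (x * 1)%T x
| congr_mulDl x y z : congr ((x + y) * z)%T (x * z + y * z)%T
| congr_mulDr x y z : congr (x * (y + z))%T (x * y + x * z)%T
| congr_cstD a b : congr (Cst (a + b)) (Cst a + Cst b)%T
| congr_cstM a b : congr (Cst (a * b)) (Cst a * Cst b)%T
| congr_cstC a x : congr (Cst a * x)%T (x * Cst a)%T.

Definition congrb (x y : term K X) : bool := `[< congr x y >].

Lemma congrb_refl : reflexive congrb.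
Proof. by move=> x; apply/asboolP; exact: congr_refl. Qed.

Lemma congrb_sym : symmetric congrb.
Proof. by move=> x y; apply: asbool_equiv_eq; split; exact: congr_sym. Qed.

Lemma congrb_trans : transitive congrb.
Proof.
move=> y x z /asboolP xy /asboolP yz; apply/asboolP; exact: congr_trans xy yz.
Qed.

Canonical congr_equiv := EquivRel congrb congrb_refl congrb_sym congrb_trans.

Definition palg := {eq_quot congr_equiv}.

HB.instance Definition _ := Choice.on palg.
HB.instance Definition _ := Quotient.on palg.

Definition cls (x : term K X) : palg := \pi_palg x.

Lemma cls_eq x y : congr x y -> cls x = cls y.
Proof. by move=> xy; apply/eqmodP/asboolP. Qed.

Lemma eq_cls x y : cls x = cls y -> congr x y.
Proof. by move=> /eqmodP/asboolP. Qed.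

Lemma clsP (P : palg -> Prop) : (forall x, P (cls x)) -> forall u, P u.
Proof. by move=> Px u; rewrite -[u]reprK; exact: Px. Qed.

Lemma congr_repr x : congr (repr (cls x)) x.
Proof. by apply: eq_cls; rewrite /cls reprK. Qed.

Definition palg_add (u v : palg) := cls (repr u + repr v)%T.
Definition palg_mul (u v : palg) := cls (repr u * repr v)%T.
Definition palg_scale (a : K) (u : palg) := cls (a *: repr u)%T.
Definition palg_opp (u : palg) := palg_scale (-1) u.

Lemma cls_add x y : palg_add (cls x) (cls y) = cls (x + y)%T.
Proof. by apply: cls_eq; apply: congr_add; exact: congr_repr. Qed.

Lemma cls_mul x y : palg_mul (cls x) (cls y) = cls (x * y)%T.
Proof. by apply: cls_eq; apply: congr_mul; exact: congr_repr. Qed.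

Lemma cls_scale a x : palg_scale a (cls x) = cls (a *: x)%T.
Proof.
by apply: cls_eq; apply: congr_mul; [exact: congr_refl | exact: congr_repr].
Qed.

Lemma palg_addA : associative palg_add.
Proof.
elim/clsP=> x; elim/clsP=> y; elim/clsP=> z; rewrite !cls_add.
by apply: cls_eq; exact: congr_addA.
Qed.

Lemma palg_addC : commutative palg_add.
Proof.
elim/clsP=> x; elim/clsP=> y; rewrite !cls_add.
by apply: cls_eq; exact: congr_addC.
Qed.

Lemma palg_add0 : left_id (cls 0%T) palg_add.
Proof.
by elim/clsP=> x; rewrite cls_add; apply: cls_eq; exact: congr_add0.
Qed.

Lemma palg_addN : left_inverse (cls 0%T) palg_opp palg_add.
Proof.
elim/clsP=> x; rewrite palg_addC /palg_opp cls_scale cls_add.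
by apply: cls_eq; exact: congr_addN.
Qed.

HB.instance Definition _ :=
  GRing.isZmodule.Build palg palg_addA palg_addC palg_add0 palg_addN.

Lemma palg_mulA : associative palg_mul.
Proof.
elim/clsP=> x; elim/clsP=> y; elim/clsP=> z; rewrite !cls_mul.
by apply: cls_eq; exact: congr_mulA.
Qed.

Lemma palg_mul1l : left_id (cls 1%T) palg_mul.
Proof.
by elim/clsP=> x; rewrite cls_mul; apply: cls_eq; exact: congr_mul1l.
Qed.

Lemma palg_mul1r : right_id (cls 1%T) palg_mul.
Proof.
by elim/clsP=> x; rewrite cls_mul; apply: cls_eq; exact: congr_mul1r.
Qed.

Lemma palg_mulDl : left_distributive palg_mul +%R.
Proof.
elim/clsP=> x; elim/clsP=> y; elim/clsP=> z.
rewrite /GRing.add /= !(cls_mul, cls_add).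
by apply: cls_eq; exact: congr_mulDl.
Qed.

Lemma palg_mulDr : right_distributive palg_mul +%R.
Proof.
elim/clsP=> x; elim/clsP=> y; elim/clsP=> z.
rewrite /GRing.add /= !(cls_mul, cls_add).
by apply: cls_eq; exact: congr_mulDr.
Qed.

HB.instance Definition _ := GRing.Zmodule_isPzRing.Build palg
  palg_mulA palg_mul1l palg_mul1r palg_mulDl palg_mulDr.

Lemma palg_scaleA a b u :
  palg_scale a (palg_scale b u) = palg_scale (a * b) u.
Proof.
elim/clsP: u => x; rewrite !cls_scale; apply: cls_eq.
apply: congr_trans (congr_mulA _ _ _) _; apply: congr_mul (congr_refl _).
exact: congr_sym (congr_cstM _ _).
Qed.

Lemma palg_scale1 : left_id 1 palg_scale.
Proof.
by elim/clsP=> x; rewrite cls_scale; apply: cls_eq; exact: congr_mul1l.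
Qed.

Lemma palg_scaleDr : right_distributive palg_scale +%R.
Proof.
move=> a; elim/clsP=> x; elim/clsP=> y.
rewrite /GRing.add /= !(cls_scale, cls_add).
by apply: cls_eq; exact: congr_mulDr.
Qed.

Lemma palg_scaleDl u : {morph palg_scale^~ u : a b / a + b >-> a + b}.
Proof.
move=> a b; elim/clsP: u => x; rewrite [RHS]/GRing.add /= !(cls_scale, cls_add).
apply: cls_eq; apply: congr_trans (congr_mulDl _ _ _).
by apply: congr_mul (congr_refl _); exact: congr_cstD.
Qed.

HB.instance Definition _ := GRing.Zmodule_isLmodule.Build K palg
  palg_scaleA palg_scale1 palg_scaleDr palg_scaleDl.

Lemma palg_scaleAl a (u v : palg) : a *: (u * v) = (a *: u) * v.
Proof.
elim/clsP: u => x; elim/clsP: v => y.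
rewrite /GRing.mul /GRing.scale /= !(cls_scale, cls_mul, cls_scale).
by apply: cls_eq; exact: congr_mulA.
Qed.

Lemma palg_scaleAr a (u v : palg) : a *: (u * v) = u * (a *: v).
Proof.
elim/clsP: u => x; elim/clsP: v => y.
rewrite /GRing.mul /GRing.scale /= !(cls_scale, cls_mul, cls_scale).
apply: cls_eq; apply: congr_trans (congr_mulA _ _ _) _.
apply: congr_trans (congr_sym (congr_mulA _ _ _)).
by apply: congr_mul (congr_refl _); exact: congr_cstC.
Qed.

Definition gen (x : X) : palg := cls (Gen x).

End Presentation.

(* [palg rel] is not an [algType], as a presented algebra may be zero; an
   algebra morphism is a linear map preserving products and 1. *)
Definition is_alg_morphism (K : fieldType) (X Y : Type)
    (rel : term K X -> term K X -> Prop) (rel' : term K Y -> term K Y -> Prop)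
    (f : palg rel -> palg rel') : Prop :=
  [/\ linear f, f 1 = 1 & forall a b, f (a * b) = f a * f b].

Section Modules.
Variable K : fieldType.

Definition is_rep (X : Type) (rel : term K X -> term K X -> Prop)
    (V : lmodType K) (r : palg rel -> V -> V) : Prop :=
  [/\ forall a, linear (r a),
      forall v, linear (r^~ v),
      forall v, r 1 v = v
    & forall a b v, r (a * b) v = r a (r b v)].

Variables (I : Type) (V : lmodType K) (op : I -> V -> V).

(* Submodules of V, and maps between them, for an action given by the family
   of operators [op]: I is an algebra A, or A + B for an (A (x) B)-module (see
   [biact]). *)
Definition submodule (S : set V) : Prop :=
  [/\ S 0, forall u v, S u -> S v -> S (u + v),
      forall (c : K) v, S v -> S (c *: v)
    & forall a v, S v -> S (op a v)].

Definition simple (S : set V) : Prop :=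
  [/\ submodule S, S <> [set 0]
    & forall T, submodule T -> T `<=` S -> T = [set 0] \/ T = S].

Definition isomorphic (S T : set V) : Prop :=
  exists f : V -> V,
    [/\ set_bij S T f,
        forall u v, S u -> S v -> f (u + v) = f u + f v,
        forall (c : K) v, S v -> f (c *: v) = c *: f v
      & forall a v, S v -> f (op a v) = op a (f v)].

Definition direct_sum (k : nat) (S : 'I_k -> set V) : Prop :=
  forall v, exists! x : {ffun 'I_k -> V},
    (forall i, S i (x i)) /\ v = \sum_i x i.

Definition multiplicity_free : Prop :=
  exists k (S : 'I_k -> set V),
    [/\ forall i, simple (S i), direct_sum S
      & forall i j, i != j -> ~ isomorphic (S i) (S j)].

Definition op_image : set (V -> V) := [set f | exists a, f = op a].

Definition commutant (A : set (V -> V)) : set (V -> V) :=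
  [set f | linear f /\ forall g, A g -> f \o g = g \o f].

End Modules.

(* An (A (x) B)-module is a space with commuting actions of A and B, a (x) b
   acting as the composite; it has the submodules and morphisms of the joint
   family of operators. *)
Definition biact (A B V : Type) (rA : A -> V -> V) (rB : B -> V -> V)
    (x : A + B) : V -> V :=
  match x with inl a => rA a | inr b => rB b end.

(* The indices 1, ..., p of the generators L_i are
   encoded as 0, ..., p - 1, and similarly for the other generators. *)

(* i and i + 1 as indices of L, for i an index of E and F *)
Definition lo p (i : 'I_p.-1) : 'I_p := widen_ord (leq_pred p) i.

Lemma hi_subproof p (i : 'I_p.-1) : (i.+1 < p)%N.
Proof. by rewrite -ltn_predRL. Qed.

Definition hi p (i : 'I_p.-1) : 'I_p := Ordinal (hi_subproof i).

Definition delta (i j : nat) : int := (i == j : nat).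

Section QuantumGroup.
Variables (K : fieldType) (q : K) (p : nat).

Inductive Uq_gen : Type :=
| gE of 'I_p.-1 | gF of 'I_p.-1 | gL of 'I_p | gLinv of 'I_p.

Local Notation tE i := (Gen (gE i)).
Local Notation tF i := (Gen (gF i)).
Local Notation tL i := (Gen (gL i)).
Local Notation tLinv i := (Gen (gLinv i)).
Local Notation tK i := (tL (lo i) * tLinv (hi i))%T.
Local Notation tKinv i := (tLinv (lo i) * tL (hi i))%T.

Inductive Uq_rel : term K Uq_gen -> term K Uq_gen -> Prop :=
| Uq_LL i j : Uq_rel (tL i * tL j) (tL j * tL i)
| Uq_LLinv i : Uq_rel (tL i * tLinv i) 1
| Uq_LinvL i : Uq_rel (tLinv i * tL i) 1
| Uq_LE (i : 'I_p) (j : 'I_p.-1) : Uq_rel (tL i * tE j * tLinv i)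
    (q ^ (delta i j - delta i j.+1) *: tE j)
| Uq_LF (i : 'I_p) (j : 'I_p.-1) : Uq_rel (tL i * tF j * tLinv i)
    (q ^ (- delta i j + delta i j.+1) *: tF j)
| Uq_EF (i j : 'I_p.-1) : Uq_rel (tE i * tF j - tF j * tE i)
    ((delta i j)%:~R / (q - q^-1) *: (tK i - tKinv i))
| Uq_EE_far (i j : 'I_p.-1) : (1 < `|i%:Z - j%:Z|)%N ->
    Uq_rel (tE i * tE j) (tE j * tE i)
| Uq_FF_far (i j : 'I_p.-1) : (1 < `|i%:Z - j%:Z|)%N ->
    Uq_rel (tF i * tF j) (tF j * tF i)
| Uq_E_serre (i j : 'I_p.-1) : `|i%:Z - j%:Z|%N = 1%N ->
    Uq_rel (tE i * tE i * tE j - (q + q^-1) *: (tE i * tE j * tE i)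
            + tE j * tE i * tE i) 0
| Uq_F_serre (i j : 'I_p.-1) : `|i%:Z - j%:Z|%N = 1%N ->
    Uq_rel (tF i * tF i * tF j - (q + q^-1) *: (tF i * tF j * tF i)
            + tF j * tF i * tF i) 0.

Definition Uq := palg Uq_rel.

HB.instance Definition _ := GRing.PzRing.on Uq.
HB.instance Definition _ := GRing.Lmodule.on Uq.

Definition UE (i : 'I_p.-1) : Uq := gen Uq_rel (gE i).
Definition UF (i : 'I_p.-1) : Uq := gen Uq_rel (gF i).
Definition UL (i : 'I_p) : Uq := gen Uq_rel (gL i).

(* The matrices r a, acting on column vectors, form a finite-dimensional
   irreducible representation with highest weight mu. *)
Definition is_irr_hw (mu : 'I_p -> nat) (d : nat) (r : Uq -> 'M[K]_d) : Prop :=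
  let act := fun (a : Uq) (v : 'cV[K]_d) => r a *m v in
  [/\ is_rep act, simple act setT
    & exists v : 'cV[K]_d,
      [/\ forall i, act (UE i) v = 0,
          forall i, act (UL i) v = q ^+ mu i *: v
        & forall w, exists a, w = act a v]].

End QuantumGroup.

Section Clifford.
Variables (K : fieldType) (q : K) (N : nat).

Inductive Clq_gen : Type :=
| gpsi of 'I_N | gpsid of 'I_N | gomega of 'I_N | gomegainv of 'I_N.

Local Notation tp i := (Gen (gpsi i)).
Local Notation td i := (Gen (gpsid i)).
Local Notation tw i := (Gen (gomega i)).
Local Notation twinv i := (Gen (gomegainv i)).

Inductive Clq_rel : term K Clq_gen -> term K Clq_gen -> Prop :=
| Clq_ww i j : Clq_rel (tw i * tw j) (tw j * tw i)
| Clq_wwinv i : Clq_rel (tw i * twinv i) 1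
| Clq_winvw i : Clq_rel (twinv i * tw i) 1
| Clq_wp (i j : 'I_N) : Clq_rel (tw i * tp j * twinv i) (q ^ delta i j *: tp j)
| Clq_wd (i j : 'I_N) : Clq_rel (tw i * td j * twinv i) (q ^ (- delta i j) *: td j)
| Clq_pp i j : Clq_rel (tp i * tp j + tp j * tp i) 0
| Clq_dd i j : Clq_rel (td i * td j + td j * td i) 0
| Clq_pd i j : i != j -> Clq_rel (tp i * td j + td j * tp i) 0
| Clq_pdq i : Clq_rel (tp i * td i + q *: (td i * tp i)) (twinv i)
| Clq_pdqinv i : Clq_rel (tp i * td i + q^-1 *: (td i * tp i)) (tw i).

Definition Clq := palg Clq_rel.

HB.instance Definition _ := GRing.PzRing.on Clq.
HB.instance Definition _ := GRing.Lmodule.on Clq.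

Definition psi (i : 'I_N) : Clq := gen Clq_rel (gpsi i).
Definition psid (i : 'I_N) : Clq := gen Clq_rel (gpsid i).
Definition omega (i : 'I_N) : Clq := gen Clq_rel (gomega i).
Definition omegainv (i : 'I_N) : Clq := gen Clq_rel (gomegainv i).

Inductive Ext_rel : term K 'I_N -> term K 'I_N -> Prop :=
| Ext_sq i : Ext_rel (Gen i * Gen i) 0
| Ext_swap (i j : 'I_N) : (i < j)%N ->
    Ext_rel (Gen i * Gen j) (- q *: (Gen j * Gen i)).

Definition Ext := palg Ext_rel.

HB.instance Definition _ := GRing.PzRing.on Ext.
HB.instance Definition _ := GRing.Lmodule.on Ext.

Definition in_cube (l : 'I_N -> int) : bool := [forall i, (l i == 0) || (l i == 1)].

Definition vmon (l : 'I_N -> int) : Ext :=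
  if in_cube l then \prod_(i < N) gen Ext_rel i ^+ `|l i|%N else 0.

Definition sgn (l : 'I_N -> int) (j : 'I_N) : K :=
  (-1) ^ (\sum_(k < N | (k < j)%N) l k).

Definition is_fock_action (act : Clq -> Ext -> Ext) : Prop :=
  is_rep act /\
  forall l, in_cube l -> forall j : 'I_N,
    [/\ act (psi j) (vmon l) =
          sgn l j *: vmon (fun k => l k - delta k j),
        act (psid j) (vmon l) =
          sgn l j *: vmon (fun k => l k + delta k j)
      & act (omega j) (vmon l) = q ^ (- l j) *: vmon l].

End Clifford.

Section Howe.
Variables (K : fieldType) (q : K) (n m : nat).

(* i + (j - 1) n in the 1-based numbering *)
Lemma ix_subproof (i : 'I_n) (j : 'I_m) : (i + j * n < n * m)%N.
Proof.
apply: (@leq_trans (n + j * n)); first by rewrite ltn_add2r.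
by rewrite -mulSn mulnC leq_mul2l ltn_ord orbT.
Qed.

Definition ix (i : 'I_n) (j : 'I_m) : 'I_(n * m) := Ordinal (ix_subproof i j).

Local Notation psi i j := (psi q (ix i j)).
Local Notation psid i j := (psid q (ix i j)).
Local Notation omega i j := (omega q (ix i j)).
Local Notation omegainv i j := (omegainv q (ix i j)).

Definition kappa_gt (i : 'I_n.-1) (j : 'I_m) : Clq q (n * m) :=
  \prod_(p < m | (j < p)%N) (omegainv (lo i) p * omega (hi i) p).

(* The inverse of kappa_{i,<j}; the omega's commute *)
Definition kappa_lt_inv (i : 'I_n.-1) (j : 'I_m) : Clq q (n * m) :=
  \prod_(p < m | (p < j)%N) (omega (lo i) p * omegainv (hi i) p).

Definition is_lambda (lam : Uq q n -> Clq q (n * m)) : Prop :=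
  [/\ is_alg_morphism lam,
      forall i, lam (UE q i) = q^-1 *: \sum_(j < m)
        (omegainv (lo i) j * psid (lo i) j * psi (hi i) j * kappa_gt i j),
      forall i, lam (UF q i) = \sum_(j < m)
        (omega (lo i) j * kappa_lt_inv i j * psid (hi i) j * psi (lo i) j)
    & forall i, lam (UL q i) = \prod_(j < m) omegainv i j].

Definition kappa_lt' (i : 'I_n) (j : 'I_m.-1) : Clq q (n * m) :=
  \prod_(p < n | (p < i)%N) (omegainv p (lo j) * omega p (hi j)).

(* The inverse of kappa_{>i,j} *)
Definition kappa_gt_inv' (i : 'I_n) (j : 'I_m.-1) : Clq q (n * m) :=
  \prod_(p < n | (i < p)%N) (omega p (lo j) * omegainv p (hi j)).

Definition is_rho (rho : Uq q m -> Clq q (n * m)) : Prop :=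
  [/\ is_alg_morphism rho,
      forall j, rho (UE q j) = \sum_(i < n)
        (kappa_lt' i j * psid i (lo j) * psi i (hi j)),
      forall j, rho (UF q j) = \sum_(i < n)
        (psid i (hi j) * psi i (lo j) * kappa_gt_inv' i j)
    & forall j, rho (UL q j) = \prod_(i < n) omegainv i j].

(* Row lengths of the Young diagrams contained in the n x m rectangle *)
Definition rect :=
  {mu : {ffun 'I_n -> 'I_m.+1} |
     [forall i : 'I_n, forall j : 'I_n, (i <= j)%N ==> (mu j <= mu i)%N]}.

Definition part (mu : rect) (i : 'I_n) : nat := val mu i.

Definition conj_part (mu : rect) (j : 'I_m) : nat :=
  #|[set i : 'I_n | (j < part mu i)%N]%SET|.

(* V is isomorphic to the direct sum over mu of the tensor products of K^(d mu)
   and K^(d' mu), on which the algebras A and B act by the matrices rA mu and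
   rB mu. The tensor product of K^c and K^d is the space of c x d matrices, with
   v (x) w the matrix v *m w^T; A and B then act by x |-> a *m x and
   x |-> x *m b^T. A linear map out of the direct sum is a family of linear maps
   phi mu out of its summands. *)
Definition tensor_decomposition (A B : Type) (V : lmodType K)
    (actA : A -> V -> V) (actB : B -> V -> V)
    (d d' : rect -> nat)
    (rA : forall mu, A -> 'M[K]_(d mu)) (rB : forall mu, B -> 'M[K]_(d' mu)) :=
  exists phi : forall mu, 'M[K]_(d mu, d' mu) -> V,
    [/\ forall mu, linear (phi mu),
        bijective (fun x : {dffun forall mu : rect, 'M[K]_(d mu, d' mu)} =>
                     \sum_mu phi mu (x mu)),
        forall mu a x, phi mu (rA mu a *m x) = actA a (phi mu x)
      & forall mu b x, phi mu (x *m (rB mu b)^T) = actB b (phi mu x)].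

End Howe.

(* Every [realType] is a model of the real numbers, so R[i] is the field of
   complex numbers. *)
Definition Cq (R : realType) : fieldType := {fraction {poly R[i]}}.

Definition qvar (R : realType) : Cq R := tofrac ('X : {poly R[i]}).

(* Main.v *)
From HB Require Import structures.
From mathcomp Require Import all_boot all_order all_algebra.
From mathcomp Require Import fraction generic_quotient complex.
From mathcomp Require Import all_classical all_reals.
From mathcomp Require Import zify ring.
Require Import Defs.

Set Implicit Arguments.
Unset Strict Implicit.
Unset Printing Implicit Defensive.

Import Order.TTheory GRing.Theory Num.Theory.
Local Open Scope ring_scope.

(** The space has a basis indexed by the sets of cells of the n x m rectangle.
The transpose with respect to this basis exchanges psi_j and psi_j^dagger, and
both lambda and rho send F to the transpose of E up to a power of q and a
monomial in the omega's. Hence both images are closed under transposition.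
The raising operators move a cell one step towards the corner of the
rectangle, so they are jointly nilpotent, and the basis vector of a Young
diagram mu is killed by all of them and has the weights mu and mu'.

The crux is that there are no further joint highest weight vectors
([joint_hw_young]). The coordinates of such a vector x can be rescaled to
polynomials in q that do not all vanish at q = 0. As in the theory of crystal
bases, the equations E x = 0 then force a ballot condition, for each pair of
adjacent rows and for each pair of adjacent columns, on every set of cells
whose coordinate survives at q = 0 ([unbalanced_vanish], [ballot]); a set that
satisfies all these conditions is a Young diagram ([ballot_young]). Once the
Young diagram components are subtracted from x, no coordinate can survive, and
the difference is zero.

The remainder is formal and is carried out for an abstract [dual_pair] of
commuting matrix algebras with orthonormal joint highest weight vectors v mu,
the vacua. By nilpotency, a nonzero subspace stable under all raising operators
contains a nonzero joint highest weight vector. Together with transposition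
this yields complete reducibility: the module generated by v mu is simple, and
the space is the direct sum of these modules ([joint_mod_simple],
[joint_mod_total], [joint_mod_direct]). Under one algebra alone, v mu generates
an irreducible module; as two irreducible modules with the same highest weight
have highest weight vectors with the same annihilator ([hw_annihilator]), the
tensor product of any two given irreducible modules with highest weights mu
and mu' maps isomorphically to the joint module of v mu ([tensor_embedding]).
Different components are not isomorphic since their highest weights differ.

For the commutants, let p be the projector to the highest weight vectors of
one algebra A along the images of its lowering operators, and let A' be the
other algebra. The pairing tr (p f b) of the f in the commutant of A with the b
in A' is nondegenerate in f ([commutant_trace_nondeg]), so the dimension of the
commutant of A is at most that of A', which it contains ([pair_commutant]). *)

(** * Presented algebras and their representations *)

Section PresentedAlgebra.
Variables (K : fieldType) (X : Type) (rel : term K X -> term K X -> Prop).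

Lemma clsD x y : cls rel (x + y)%T = cls rel x + cls rel y.
Proof. by rewrite [RHS]/GRing.add /= cls_add. Qed.

Lemma clsM x y : cls rel (x * y)%T = cls rel x * cls rel y.
Proof. by rewrite [RHS]/GRing.mul /= cls_mul. Qed.

Lemma cls1 : cls rel 1%T = 1.
Proof. by []. Qed.

Lemma cls0 : cls rel 0%T = 0.
Proof. by []. Qed.

Lemma clsZ c x : cls rel (Cst c * x)%T = c *: cls rel x.
Proof. by rewrite [RHS]/GRing.scale /= cls_scale. Qed.

Lemma clsC c : cls rel (Cst c) = c *: (1 : palg rel).
Proof.
by rewrite -cls1 -clsZ; apply: cls_eq; apply: congr_sym; exact: congr_mul1r.
Qed.

Lemma clsB x y : cls rel (x - y)%T = cls rel x - cls rel y.
Proof. by rewrite clsD clsZ scaleN1r. Qed.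

Definition clsE := (clsD, clsZ, clsM, cls1, cls0).

Lemma cls_rel x y : rel x y -> cls rel x = cls rel y.
Proof. by move=> xy; apply: cls_eq; exact: congr_rel. Qed.

(** A presented algebra is spanned by the products of its generators. *)
Lemma palg_ind (P : palg rel -> Prop) :
    (forall x, P (gen rel x)) -> P 1 ->
    (forall c a, P a -> P (c *: a)) ->
    (forall a b, P a -> P b -> P (a + b)) ->
    (forall a b, P a -> P b -> P (a * b)) ->
  forall a, P a.
Proof.
move=> Pgen P1 PZ PD PM; elim/clsP; elim=> [x|c|x Px y Py|x Px y Py].
- exact: Pgen.
- by rewrite clsC; exact: PZ.
- by rewrite clsD; exact: PD.
- by rewrite clsM; exact: PM.
Qed.

Section Rep.
Variables (V : lmodType K) (r : palg rel -> V -> V).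
Hypothesis rP : is_rep r.

Lemma repZD a c u v : r a (c *: u + v) = c *: r a u + r a v.
Proof. by case: rP => + _ _ _; exact. Qed.
Lemma repDv a u v : r a (u + v) = r a u + r a v.
Proof. by rewrite -[u]scale1r repZD !scale1r. Qed.
Lemma rep0v a : r a 0 = 0.
Proof. by apply: (addrI (r a 0)); rewrite -repDv !addr0. Qed.
Lemma repZv a c u : r a (c *: u) = c *: r a u.
Proof. by rewrite -[c *: u]addr0 repZD rep0v addr0. Qed.
Lemma rep_sumv a I (s : seq I) (P : pred I) (f : I -> V) :
  r a (\sum_(i <- s | P i) f i) = \sum_(i <- s | P i) r a (f i).
Proof.
by apply: (big_morph (r a) (id1 := 0)); [exact: repDv|exact: rep0v].
Qed.
Lemma repDl a b v : r (a + b) v = r a v + r b v.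
Proof.
by case: rP => _ h _ _; have := h v 1 a b; rewrite !scale1r.
Qed.
Lemma rep0l v : r 0 v = 0.
Proof. by apply: (addrI (r 0 v)); rewrite -repDl !addr0. Qed.
Lemma repZl c a v : r (c *: a) v = c *: r a v.
Proof.
by case: rP => _ h _ _; have := h v c a 0; rewrite !addr0 rep0l addr0.
Qed.
Lemma repNl a v : r (- a) v = - r a v.
Proof. by rewrite -scaleN1r repZl scaleN1r. Qed.
Lemma repBl a b v : r (a - b) v = r a v - r b v.
Proof. by rewrite repDl repNl. Qed.
Lemma rep_suml I (s : seq I) (P : pred I) (f : I -> palg rel) v :
  r (\sum_(i <- s | P i) f i) v = \sum_(i <- s | P i) r (f i) v.
Proof.
by apply: (big_morph (r^~ v) (id1 := 0)) => [a b|]; [exact: repDl|exact: rep0l].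
Qed.
Lemma rep1 v : r 1 v = v.
Proof. by case: rP. Qed.
Lemma repM a b v : r (a * b) v = r a (r b v).
Proof. by case: rP. Qed.

Lemma rep_stable (S : V -> Prop) :
    (forall u v, S u -> S v -> S (u + v)) -> (forall c v, S v -> S (c *: v)) ->
    (forall x v, S v -> S (r (gen rel x) v)) ->
  forall a v, S v -> S (r a v).
Proof.
move=> SD SZ Sgen; elim/palg_ind=> [|v|c a Sa v|a b Sa Sb v|a b Sa Sb v] Sv.
- exact: Sgen.
- by rewrite rep1.
- by rewrite repZl; apply: SZ; exact: Sa.
- by rewrite repDl; apply: SD; [exact: Sa|exact: Sb].
- by rewrite repM; apply: Sa; exact: Sb.
Qed.

End Rep.
End PresentedAlgebra.

Section Morphism.
Variables (K : fieldType) (X Y : Type).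
Variables (rel : term K X -> term K X -> Prop).
Variables (rel' : term K Y -> term K Y -> Prop).
Variables (f : palg rel -> palg rel').
Hypothesis fP : is_alg_morphism f.

Lemma alg_morphD a b : f (a + b) = f a + f b.
Proof. by case: fP => flin _ _; rewrite -[a]scale1r flin !scale1r. Qed.

Lemma alg_morphZ c a : f (c *: a) = c *: f a.
Proof.
have f0 : f 0 = 0 by apply: (addrI (f 0)); rewrite -alg_morphD !addr0.
by case: fP => flin _ _; rewrite -[c *: a]addr0 flin f0 addr0.
Qed.

Lemma alg_morph1 : f 1 = 1.
Proof. by case: fP. Qed.

Lemma alg_morphM a b : f (a * b) = f a * f b.
Proof. by case: fP. Qed.

End Morphism.

(** * Fractions and the specialization at q = 0 *)

Section Fractions.
Variable F : fieldType.

Lemma tofrac_inj : injective (@tofrac {poly F}).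
Proof. by move=> x y /eqP; rewrite tofrac_eq => /eqP. Qed.

Lemma fraction_quotient (x : {fraction {poly F}}) :
  exists a b : {poly F}, b != 0 /\ x * tofrac b = tofrac a.
Proof.
elim/quotW: x => x.
exists (\n_x), (\d_x); split; first exact: denom_ratioP.
unlock FracField.tofrac.
rewrite -[LHS]FracField.pi_mul.
apply/eqmodP => /=.
rewrite FracField.equivfE /FracField.mulf.
by rewrite !numden_Ratio ?oner_neq0 ?mulf_neq0 ?mulr1 ?mul1r ?denom_ratioP
  ?oner_neq0 // mulrC.
Qed.

End Fractions.

Section Crystal.
Variables (F K : fieldType) (iota : {rmorphism {poly F} -> K}).
Hypothesis iota_inj : injective iota.
Hypothesis iota_frac :
  forall x : K, exists a b : {poly F}, b != 0 /\ x * iota b = iota a.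
Local Notation q := (iota 'X).

Lemma iota_neq0 a : a != 0 -> iota a != 0.
Proof. by move=> a0; rewrite -(rmorph0 iota) (inj_eq iota_inj). Qed.

Lemma iotaX_neq0 : q != 0.
Proof. by rewrite iota_neq0 ?polyX_eq0. Qed.

(** Clear the denominators, then divide by q as long as all the polynomials
vanish at 0. *)
Lemma exists_local_scaling (I : finType) (c : I -> K) (i0 : I) : c i0 != 0 ->
  exists (s : K) (p : I -> {poly F}),
    [/\ s != 0, forall i, s * c i = iota (p i) & exists i, (p i).[0] != 0].
Proof.
move=> ci0.
have [s [p [s0 sp]]] : exists (s : K) (p : I -> {poly F}),
    s != 0 /\ forall i, s * c i = iota (p i).
  have /choice [ab abP] : forall i, exists ab : {poly F} * {poly F},
      ab.2 != 0 /\ c i * iota ab.2 = iota ab.1.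
    by move=> i; have [a [b [b0 e]]] := iota_frac (c i); exists (a, b).
  exists (\prod_i iota (ab i).2), (fun i => (ab i).1 * \prod_(j | j != i) (ab j).2).
  split.
    by apply/prodf_neq0 => i _; apply: iota_neq0; case: (abP i).
  move=> i; rewrite (bigD1 i) //= rmorphM /= rmorph_prod mulrAC.
  by case: (abP i) => _ <-; rewrite [iota _ * c i]mulrC.
have : p i0 != 0.
  by rewrite -(inj_eq iota_inj) -sp rmorph0 mulf_neq0.
have [n] := ubnP (size (p i0)); elim: n => // n IHn in s p s0 sp *.
move=> szp pi0.
have [/existsP[i pi]|/existsPn p0] := boolP [exists i, (p i).[0] != 0].
  by exists s, p; split=> //; exists i.
have /choice [p' p'P] : forall i, exists p' : {poly F}, p i = p' * 'X.
  move=> i; have /negPn/eqP := p0 i.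
  by move=> /eqP/factor_theorem[p' ->]; exists p'; rewrite subr0.
have p'i0 : p' i0 != 0.
  by apply: contraNneq pi0; rewrite p'P => ->; rewrite mul0r.
have s'0 : s * q^-1 != 0 by rewrite mulf_neq0 ?invr_eq0 ?iotaX_neq0.
have sp' i : s * q^-1 * c i = iota (p' i).
  by rewrite mulrAC sp p'P rmorphM /= mulfK ?iotaX_neq0.
apply: (IHn _ _ s'0 sp' _ p'i0).
by move: szp; rewrite p'P size_mulX.
Qed.

Variables (k : nat) (C : Type) (wt : C -> 'I_k -> int).
Variables (mv : C -> 'I_k -> 'I_k -> C) (eps : C -> 'I_k -> 'I_k -> bool).
Variable p : C -> {poly F}.

(** The configurations s carry at each position a weight -1, 0 or 1; mv s j j' raises
the weight at j from -1 to 1 and lowers that at j' from 1 to -1. The hypothesis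
[raising] is the equation E x = 0 for a vector x with coordinates p, read at
the configuration s raised at j: it is reached from mv s j j' by raising at j',
which contributes the weights to the right of j' as a power of q. *)
Definition tail_weight s (x : nat) : int := \sum_(i < k | (x <= i)%N) wt s i.

Hypothesis wtP : forall s j, [|| wt s j == -1, wt s j == 0 | wt s j == 1].
Hypothesis mv_id : forall s j, mv s j j = s.
Hypothesis wt_mv : forall s j j', wt s j = -1 -> wt s j' = 1 ->
  forall i, wt (mv s j j') i = wt s i + 2 * (i == j)%:Z - 2 * (i == j')%:Z.
Hypothesis raising : forall s j, wt s j = -1 ->
  \sum_(j' | (j' == j) || (wt s j' == 1))
     (-1) ^+ eps s j j' *
     q ^ (\sum_(i < k | (j' < i)%N) (wt s i + 2 * (i == j)%:Z)) *
     iota (p (mv s j j')) = 0.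

Lemma tail_weightS s (j : 'I_k) :
  tail_weight s j = wt s j + tail_weight s j.+1.
Proof.
rewrite /tail_weight (bigD1 j) //=; congr (_ + _).
by apply: eq_bigl => i; rewrite andbC ltn_neqAle eq_sym.
Qed.

Lemma tail_weight_end s x : (k <= x)%N -> tail_weight s x = 0.
Proof.
move=> kx; rewrite /tail_weight big1 // => i; rewrite leqNgt => /negP[].
exact: leq_trans (ltn_ord i) kx.
Qed.

(** In the raising equation at the last position j where the tail weight of s is
minimal, the coordinate of s comes with the least power of q. A term with the
same power belongs to a position j' to the right of j, and its configuration
has a negative tail weight too but a smaller first moment. By induction on the
moment these terms vanish at q = 0, and so does the coordinate of s. *)
Lemma unbalanced_vanish s x : tail_weight s x < 0 -> (p s).[0] = 0.
Proof.
pose M s : int := \sum_(i < k) i%:Z * (wt s i + 1).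
have [n] := ubnP `|M s|%N; elim: n => // n IHn in s x *.
have wt_ge i s' : 0 <= wt s' i + 1.
  by case/or3P: (wtP s' i) => /eqP ->.
have M_ge0 s' : 0 <= M s'.
  by apply: sumr_ge0 => i _; rewrite mulr_ge0.
move=> Ms tx.
(* the last position with minimal tail weight; there s has weight -1 *)
have [j [wj hmin hlt]] : exists j : 'I_k, [/\ wt s j = -1,
    (forall y, tail_weight s j <= tail_weight s y)
  & (forall y, (j < y <= k)%N -> tail_weight s j < tail_weight s y)].
  have xk : (x <= k)%N.
    rewrite leqNgt; apply/negP=> /ltnW/(tail_weight_end s) e.
    by rewrite e ltxx in tx.
  pose x0 : 'I_k.+1 := inord x.
  have [y1 _ y1P] := @Order.TotalTheory.arg_minP _ int _ x0 xpredT
    (fun y : 'I_k.+1 => tail_weight s y) isT.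
  have [y2 /eqP y2E y2P] := @arg_maxnP _ y1
    (fun y : 'I_k.+1 => tail_weight s y == tail_weight s y1)
    (fun y => nat_of_ord y) (eqxx _).
  have h y : (y <= k)%N -> tail_weight s y2 <= tail_weight s y.
    move=> yk; rewrite y2E; have := y1P (inord y) isT.
    by rewrite /= inordK.
  have t2 : tail_weight s y2 < 0 by exact: le_lt_trans (h x xk) tx.
  have h' y : (y2 < y <= k)%N -> tail_weight s y2 < tail_weight s y.
    move=> /andP[y2y yk]; rewrite lt_neqAle h // andbT.
    apply/eqP=> e; have := y2P (inord y); rewrite /= inordK //.
    by rewrite -e y2E eqxx => /(_ isT); rewrite leqNgt y2y.
  have y2k : (y2 < k)%N.
    have := ltn_ord y2; rewrite ltnS leq_eqVlt => /orP[/eqP e|//].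
    by move: t2; rewrite e tail_weight_end ?ltxx.
  exists (Ordinal y2k); split=> //=; last first.
    move=> y; case: (leqP y k) => [/h//|/ltnW/(tail_weight_end s) ->].
    exact: ltW.
  have := h' y2.+1; rewrite ltnSn y2k => /(_ isT).
  have := tail_weightS s (Ordinal y2k); rewrite /= => ->.
  case/or3P: (wtP s (Ordinal y2k)) => /eqP -> //; lia.
pose h := tail_weight s j.
have h0 : h < 0 by apply: le_lt_trans tx; exact: hmin.
have h1 : tail_weight s j.+1 = h + 1 by rewrite /h tail_weightS wj; lia.
(* the exponent of q in the term of j' *)
pose e (j' : 'I_k) : int := \sum_(i < k | (j' < i)%N) (wt s i + 2 * (i == j)%:Z).
have eE j' : e j' = tail_weight s j'.+1 + 2 * (j' < j)%N%:Z.
  rewrite /e big_split /=; congr (_ + _).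
  have [j'j|jj'] := boolP (j' < j)%N.
    by rewrite (bigD1 j) //= eqxx big1 ?addr0 // => i /andP[_ /negPf ->].
  rewrite big1 ?mulr0 // => i j'i; case: eqP => [ij|]; last by rewrite mulr0.
  by move: jj'; rewrite -ij j'i.
have ej : e j = h + 1 by rewrite eE ltnn mulr0 addr0.
have e_ge j' : h + 1 <= e j'.
  rewrite eE; case: (ltngtP j' j) => jj'.
  - by have := hmin j'.+1; rewrite -/h /=; lia.
  - have := hlt j'.+1; rewrite ltn_ord ltnS (ltnW jj') => /(_ isT).
    by rewrite -/h /=; lia.
  - by rewrite (val_inj jj') h1 /=; lia.
(* the terms of least exponent, apart from that of s itself *)
have tie j' : j' != j -> wt s j' = 1 -> e j' = h + 1 -> (p (mv s j j')).[0] = 0.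
  move=> j'j wj'; rewrite eE; case: ltngtP => jj'; last first.
  - by rewrite (val_inj jj') eqxx in j'j.
  - rewrite mulr0 addr0 => tj'.
    have sumE (f : 'I_k -> int) (A : pred 'I_k) (i0 : 'I_k) : A i0 ->
        \sum_(i | A i) f i * (i == i0)%:Z = f i0.
      move=> Ai0; rewrite (bigD1 i0) //= eqxx mulr1 big1 ?addr0 //.
      by move=> i /andP[_ /negPf ->]; rewrite mulr0.
    apply: (IHn _ j').
      suff : M (mv s j j') < M s by have := M_ge0 s; have := M_ge0 (mv s j j'); lia.
      rewrite /M (eq_bigr (fun i : 'I_k => i%:Z * (wt s i + 1) +
         (2 * i%:Z) * (i == j)%:Z - (2 * i%:Z) * (i == j')%:Z)); last first.
        by move=> i _; rewrite wt_mv //; ring.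
      rewrite sumrB big_split /= !sumE // -/(M s). move: jj'; clear; set z := M s. lia.
    rewrite /tail_weight (eq_bigr (fun i : 'I_k => wt s i +
       2 * (i == j)%:Z - 2 * (i == j')%:Z)); last first.
      by move=> i _; rewrite wt_mv.
    rewrite sumrB big_split /= (sumE (fun=> 2) _ j') // [X in _ + X - _]big1 => [|i j'i].
      rewrite -/(tail_weight s j') tail_weightS wj' tj'.
      by move: h0; clear; lia.
    case: eqP => // ij; move: j'i; rewrite ij => /(leq_trans jj').
    by rewrite ltnn.
  - have := hmin j'.+1; rewrite -/h /=; lia.
(* divide the equation by q ^ (h + 1) and evaluate at q = 0 *)
have := raising wj; move/(congr1 (fun z => q ^ (- (h + 1)) * z)).
rewrite mulr0 mulr_sumr (eq_bigr (fun j' => iota ((-1) ^+ eps s j j' *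
    'X^((absz (e j' - (h + 1))%R)) * p (mv s j j')))); last first.
  move=> j' _; rewrite !rmorphM /= !rmorphXn /= rmorphN rmorph1.
  have -> : q ^+ absz (e j' - (h + 1))%R = q ^ (- (h + 1)) * q ^ e j'.
    rewrite -expfzDr ?iotaX_neq0 //.
    rewrite -[LHS]/(q ^ (Posz (absz (e j' - (h + 1))%R))).
    by congr (_ ^ _); have := e_ge j'; clear; lia.
  by rewrite !mulrA [q ^ _ * (-1) ^+ _]mulrC.
rewrite -rmorph_sum /= => /eqP; rewrite -(rmorph0 iota) (inj_eq iota_inj) => /eqP.
move=> /(congr1 (fun z : {poly F} => z.[0])); rewrite horner_sum horner0.
rewrite (bigD1 j) ?eqxx //= big1 => [|j' /andP[/orP[->//|/eqP wj'] j'j]].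
  rewrite addr0 -/(h) mv_id ej subrr expr0 mulr1 hornerM.
  case: (eps s j j); rewrite ?expr1 ?expr0 ?hornerN hornerC ?mul1r //.
  by rewrite mulN1r => /eqP; rewrite oppr_eq0 => /eqP.
rewrite !hornerM hornerXn.
have [e0|] := eqVneq (e j') (h + 1); first by rewrite tie ?mulr0.
move=> ne; rewrite [0 ^+ _]expr0n.
have -> : ((absz (e j' - (h + 1))%R) == 0)%N = false by lia.
by rewrite mulr0 mul0r.
Qed.

End Crystal.

(** * Subspaces, the dot product and maximal vectors *)

Section Subspaces.
Variable K : fieldType.

Definition subspace_of (V : lmodType K) (S : V -> Prop) : Prop :=
  [/\ S 0, forall u v, S u -> S v -> S (u + v) & forall c v, S v -> S (c *: v)].

Lemma subspace_sum (V : lmodType K) (S : V -> Prop) (I : Type) (r : seq I)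
    (P : pred I) (f : I -> V) :
  subspace_of S -> (forall i, P i -> S (f i)) -> S (\sum_(i <- r | P i) f i).
Proof. by move=> [S0 SD _] Sf; elim/big_ind: _. Qed.

(** A matrix of maximal rank among those whose row space lies in S has row space
S. *)
Lemma subspace_row n (S : 'rV[K]_n -> Prop) : subspace_of S ->
  exists B : 'M[K]_n, forall x, S x <-> (x <= B)%MS.
Proof.
move=> [S0 SD SZ].
pose good r := `[< exists B : 'M[K]_n,
  \rank B = r /\ forall x : 'rV_n, (x <= B)%MS -> S x >].
have good0 : exists r, good r.
  exists 0%N; apply/asboolP; exists 0; rewrite mxrank0; split=> // x.
  by rewrite submx0 => /eqP ->.
have goodB r : good r -> (r <= n)%N.
  by move=> /asboolP[B [<- _]]; exact: rank_leq_row.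
case: (ex_maxnP good0 goodB) => r /asboolP[B [rB SB]] rmax.
exists B => x; split; last exact: SB.
move=> Sx; apply: contraT => xB.
have /rmax : good (\rank (B + x)%MS).
  apply/asboolP; exists (B + x)%MS; split=> // y /sub_addsmxP[[u w] /= ->].
  apply: SD; first by apply: SB; exact: submxMl.
  by rewrite [w]mx11_scalar mul_scalar_mx; exact: SZ.
rewrite -rB leqNgt => /negP[]; apply: rank_ltmx.
by rewrite ltmxE addsmxSl /= addsmx_sub submx_refl.
Qed.

(** The basis vectors are orthonormal for this form. It may have
isotropic vectors, so that orthogonal complements need not be complements;
only nondegeneracy and [dot_adj] are available. *)
Definition dot n (u w : 'cV[K]_n) : K := (u^T *m w) 0 0.

Section Dot.
Variable n : nat.
Implicit Types u w : 'cV[K]_n.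

Lemma dotC u w : dot u w = dot w u.
Proof. by rewrite /dot -[u^T *m w]trmxK trmx_mul trmxK mxE. Qed.
Lemma dotDr u w w' : dot u (w + w') = dot u w + dot u w'.
Proof. by rewrite /dot mulmxDr mxE. Qed.
Lemma dotZr u c w : dot u (c *: w) = c * dot u w.
Proof. by rewrite /dot -scalemxAr mxE. Qed.
Lemma dot0r u : dot u 0 = 0.
Proof. by rewrite /dot mulmx0 mxE. Qed.
Lemma dot_sumr u (I : Type) (r : seq I) (P : pred I) (f : I -> 'cV_n) :
  dot u (\sum_(i <- r | P i) f i) = \sum_(i <- r | P i) dot u (f i).
Proof. by rewrite (big_morph (dot u) (id1 := 0) (@dotDr u) (dot0r u)). Qed.
Lemma dot_adj u (a : 'M[K]_n) w : dot u (a *m w) = dot (a^T *m u) w.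
Proof. by rewrite /dot trmx_mul trmxK mulmxA. Qed.

Lemma dot_nondeg u : (forall w, dot u w = 0) -> u = 0.
Proof.
move=> u0; apply/matrixP=> i j; rewrite ord1 mxE.
have := u0 (delta_mx i 0); rewrite dotC /dot trmx_delta -rowE.
by rewrite !mxE.
Qed.

(** A column of the cokernel of a matrix with row space S. *)
Lemma separating_vector (S : 'cV[K]_n -> Prop) x : subspace_of S -> ~ S x ->
  exists y, dot y x != 0 /\ forall z, S z -> dot y z = 0.
Proof.
move=> [S0 SD SZ] Sx.
have [|B SB] := @subspace_row _ (fun z => S z^T).
  split=> [|u w|c w]; first by rewrite trmx0.
    by rewrite linearD; exact: SD.
  by rewrite linearZ; exact: SZ.
have : ~~ (x^T <= B)%MS by apply/negP=> /SB; rewrite trmxK.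
rewrite submxE => /eqP xB.
have [j xj] : exists j, (x^T *m cokermx B) 0 j != 0.
  apply/existsP; apply: contra_notT xB => /existsPn xB; apply/matrixP=> i j.
  by rewrite ord1 [RHS]mxE; apply/eqP/negPn/xB.
have colE z : dot (col j (cokermx B)) z = (z^T *m cokermx B) 0 j.
  by rewrite dotC /dot !mxE; apply: eq_bigr => i _; rewrite !mxE.
exists (col j (cokermx B)); split; first by rewrite colE.
move=> z Sz; rewrite colE.
have : (z^T <= B)%MS by apply/SB; rewrite trmxK.
by rewrite submxE => /eqP ->; rewrite mxE.
Qed.

End Dot.

(** Engel's argument: apply elements of N to x as long as the result is nonzero;
nilpotency bounds the number of steps. The matrices y have k columns so that
the lemma applies to spaces of linear maps as well. *)
Lemma maximal_vector n k (N : 'M[K]_n -> Prop) (S : 'M[K]_(n, k) -> Prop) x :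
    (exists B, forall s : seq 'M[K]_n, (forall a, a \in s -> N a) ->
       (B < size s)%N -> foldr mulmx 1%:M s = 0) ->
    (forall a y, N a -> S y -> S (a *m y)) -> S x -> x != 0 ->
  exists y, [/\ S y, y != 0 & forall a, N a -> a *m y = 0].
Proof.
move=> [B nilB] SN Sx x0; apply: contrapT => nomax.
have ext y : S y -> y != 0 -> exists a, N a /\ a *m y != 0.
  move=> Sy y0; apply: contrapT => noa; apply: nomax; exists y; split=> // a Na.
  by apply/eqP; apply: contrapT => ay; apply: noa; exists a; split=> //; apply/negP.
have [s [sN [szs [_ /eqP]]]] : exists s : seq 'M[K]_n, (forall a, a \in s -> N a) /\
    (size s = B.+1 /\ S (foldr mulmx 1%:M s *m x) /\ foldr mulmx 1%:M s *m x != 0).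
  elim: B.+1 => [|m [s [sN [szs [Ss s0]]]]].
    by exists [::]; rewrite /= mul1mx.
  have [a [Na as0]] := ext _ Ss s0.
  exists (a :: s); split; first by move=> b; rewrite inE => /orP[/eqP->|/sN].
  by rewrite /= -mulmxA szs; split=> //; split=> //; exact: SN.
by rewrite nilB ?szs // mul0mx.
Qed.

End Subspaces.

(** * Pairs of commuting matrix algebras with highest weight vectors *)

Section DualPair.
Variables (K : fieldType) (D : nat) (M : finType) (v : M -> 'cV[K]_D).

(** One of the two algebras: A is the image of a quantum group, E, F and L are
the images of its generators, and chi mu j is the eigenvalue of L_j on v mu.
[side_FT] is how the proportionality of E_i and the transpose of F_i, up to an
invertible factor, is used. [side_vac] replaces weight theory: the component
of A (v mu) of weight mu is the line of v mu, and the components of other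
weights are in the images of the F_i. *)
Record side (A : 'M[K]_D -> Prop) (I : finType) (E F : I -> 'M[K]_D)
    (J : Type) (L : J -> 'M[K]_D) (chi : M -> J -> K) : Prop := Side {
  side_1 : A 1%:M;
  side_D : forall a b, A a -> A b -> A (a + b);
  side_Z : forall c a, A a -> A (c *: a);
  side_M : forall a b, A a -> A b -> A (a *m b);
  side_T : forall a, A a -> A a^T;
  side_E : forall i, A (E i);
  side_F : forall i, A (F i);
  side_L : forall j, A (L j);
  side_FT : forall i (x : 'cV_D), E i *m x = 0 <-> (F i)^T *m x = 0;
  side_EL : forall i j, exists c, E i *m L j = c *: (L j *m E i);
  side_LF : forall i j, exists c, L j *m F i = c *: (F i *m L j);
  side_hw : forall mu i, E i *m v mu = 0;
  side_wt : forall mu j, L j *m v mu = chi mu j *: v mu;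
  side_sep : forall mu nu, mu != nu -> exists j, chi mu j != chi nu j;
  side_vac : forall a mu, A a ->
    exists s y, a *m v mu = s *: v mu + \sum_i F i *m y i }.

Section Pair.

(** [pair_nil] asks for the joint nilpotency of the raising operators of both
algebras together with the transposed lowering operators; [pair_joint] says
that the v mu exhaust the joint highest weight vectors. *)
Record dual_pair (A : 'M[K]_D -> Prop) (I : finType) (E F : I -> 'M[K]_D)
    (J : Type) (L : J -> 'M[K]_D) (chi : M -> J -> K)
    (A' : 'M[K]_D -> Prop) (I' : finType) (E' F' : I' -> 'M[K]_D)
    (J' : Type) (L' : J' -> 'M[K]_D) (chi' : M -> J' -> K) : Prop := DualPair {
  pair_l : side A E F L chi;
  pair_r : side A' E' F' L' chi';
  pair_comm : forall a b, A a -> A' b -> a *m b = b *m a;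
  pair_orth : forall mu nu, dot (v mu) (v nu) = (mu == nu)%:R;
  pair_nil : exists B, forall s : seq 'M[K]_D,
    (forall a, a \in s -> [\/ exists i, a = E i \/ a = (F i)^T
                            | exists i, a = E' i \/ a = (F' i)^T]) ->
       (B < size s)%N -> foldr mulmx 1%:M s = 0;
  pair_joint : forall x : 'cV_D, (forall i, E i *m x = 0) ->
    (forall i, E' i *m x = 0) -> exists c : M -> K, x = \sum_mu c mu *: v mu }.

Variables (A : 'M[K]_D -> Prop) (I : finType) (E F : I -> 'M[K]_D).
Variables (J : Type) (L : J -> 'M[K]_D) (chi : M -> J -> K).
Variables (A' : 'M[K]_D -> Prop) (I' : finType) (E' F' : I' -> 'M[K]_D).
Variables (J' : Type) (L' : J' -> 'M[K]_D) (chi' : M -> J' -> K).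

Lemma dual_pair_sym : dual_pair A E F L chi A' E' F' L' chi' ->
  dual_pair A' E' F' L' chi' A E F L chi.
Proof.
case=> l r cm orth [B nilB] joint; split=> //.
- by move=> a b Aa Ab; apply: esym; exact: cm.
- by exists B => s sN; apply: nilB => a /sN[]; [right|left].
- by move=> x Ex E'x; exact: joint E'x Ex.
Qed.

Hypothesis AA' : dual_pair A E F L chi A' E' F' L' chi'.
Let sA := pair_l AA'.
Let sA' := pair_r AA'.
Let comm := pair_comm AA'.

Definition hw (x : 'cV[K]_D) := forall i, E i *m x = 0.

Lemma side_0 : A 0.
Proof. by rewrite -[0](scale0r 1%:M); apply: (side_Z sA); exact: side_1 sA. Qed.

(** [maximal_vector] for the raising operators of both algebras. *)
Lemma pair_nil_l k (S : 'M[K]_(D, k) -> Prop) x :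
    (forall i y, S y -> S (E i *m y)) -> (forall i y, S y -> S (E' i *m y)) ->
    S x -> x != 0 ->
  exists y, [/\ S y, y != 0 & (forall i, E i *m y = 0) /\ (forall i, E' i *m y = 0)].
Proof.
move=> SE SE' Sx x0.
have [||y [Sy y0 yN]] := @maximal_vector _ _ _
  (fun a => (exists i, a = E i) \/ (exists i, a = E' i)) S x _ _ Sx x0.
- have [B nilB] := pair_nil AA'; exists B => s sN; apply: nilB => a /sN.
  by case=> -[i ->]; [left|right]; exists i; left.
- by move=> a y [[i ->]|[i ->]] Sy; [exact: SE|exact: SE'].
exists y; split=> //; split=> i; apply: yN; [left|right]; by exists i.
Qed.

Lemma joint_coord x : hw x -> (forall i, E' i *m x = 0) ->
  x = \sum_mu dot (v mu) x *: v mu.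
Proof.
move=> Ex E'x; have [c xE] := pair_joint AA' Ex E'x.
rewrite {1}xE; apply: eq_bigr => mu _; congr (_ *: _).
rewrite xE dot_sumr (bigD1 mu) //= dotZr (pair_orth AA') eqxx mulr1.
rewrite big1 ?addr0 // => nu /negPf nemu.
by rewrite dotZr (pair_orth AA') eq_sym nemu mulr0.
Qed.

(** By [side_FT], the transpose of F_i kills v mu as E_i does. *)
Lemma dot_vF mu i y : dot (v mu) (F i *m y) = 0.
Proof.
rewrite dot_adj; have -> : (F i)^T *m v mu = 0.
  by apply/(side_FT sA); exact: side_hw sA _ _.
by rewrite dotC dot0r.
Qed.

Lemma vacuum_offdiag a mu nu : A a -> mu != nu -> dot (v nu) (a *m v mu) = 0.
Proof.
move=> Aa ne; have [s [y ->]] := side_vac sA mu Aa.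
rewrite dotDr dotZr (pair_orth AA') eq_sym (negPf ne) mulr0 add0r.
by rewrite dot_sumr big1 // => i _; exact: dot_vF.
Qed.

(** A highest weight vector in A (v mu) is also killed by all E', which commute
with A; so it is a combination of vacua, and the other vacua are orthogonal
to A (v mu). *)
Lemma hw_vacuum a mu : A a -> hw (a *m v mu) ->
  a *m v mu = dot (v mu) (a *m v mu) *: v mu.
Proof.
move=> Aa hwa; rewrite {1}(joint_coord hwa) => [|i].
  rewrite (bigD1 mu) //= big1 ?addr0 // => nu ne.
  by rewrite vacuum_offdiag ?scale0r // eq_sym.
by rewrite mulmxA -(comm Aa (side_E sA' i)) -mulmxA (side_hw sA') mulmx0.
Qed.

(** The submodule generated by a (v mu) contains a nonzero highest weight vector,
which is a multiple of v mu. *)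
Lemma cyclic_simple a mu : A a -> a *m v mu != 0 ->
  exists b, A b /\ b *m (a *m v mu) = v mu.
Proof.
move=> Aa av.
pose S x := exists b, A b /\ x = b *m (a *m v mu).
have [|||//|y [[b [Ab yE]] y0 [Ey _]]] := @pair_nil_l _ S (a *m v mu).
- move=> i y [b [Ab ->]]; exists (E i *m b); rewrite mulmxA; split=> //.
  by apply: (side_M sA) => //; apply: (side_E sA).
- move=> i y [b [Ab ->]]; exists 0; split; first exact: side_0.
  rewrite mul0mx mulmxA -(comm Ab (side_E sA' i)) -mulmxA [E' i *m _]mulmxA.
  by rewrite -(comm Aa (side_E sA' i)) -mulmxA (side_hw sA') !mulmx0.
- by exists 1%:M; rewrite mul1mx; split=> //; exact: side_1 sA.
have Aba : A (b *m a) by apply: (side_M sA).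
have hwba : hw (b *m a *m v mu) by move=> i; rewrite -mulmxA -yE.
have := hw_vacuum Aba hwba; rewrite -mulmxA -yE; set s := dot _ _ => ys.
have s0 : s != 0 by apply: contraNneq y0 => s0; rewrite ys s0 scale0r.
exists (s^-1 *: b); split; first exact: (side_Z sA).
by rewrite -scalemxAl -yE ys scalerA mulVf // scale1r.
Qed.

(** As A and A' commute, these sums are the module generated by v mu. *)
Inductive joint_mod mu : 'cV[K]_D -> Prop :=
| JointMod0 : joint_mod mu 0
| JointModS a b x : A a -> A' b -> joint_mod mu x ->
    joint_mod mu (a *m b *m v mu + x).

Lemma joint_modD mu x y : joint_mod mu x -> joint_mod mu y -> joint_mod mu (x + y).
Proof.
by elim=> [|a b z Aa A'b _ IH]; rewrite ?add0r // -addrA => /IH; exact: JointModS.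
Qed.

Lemma joint_mod_l mu a x : A a -> joint_mod mu x -> joint_mod mu (a *m x).
Proof.
move=> Aa; elim=> [|c b z Ac A'b _ IH]; first by rewrite mulmx0; exact: JointMod0.
by rewrite mulmxDr !mulmxA; apply: JointModS => //; exact: side_M sA _ _ Aa Ac.
Qed.

Lemma joint_mod_r mu a x : A' a -> joint_mod mu x -> joint_mod mu (a *m x).
Proof.
move=> A'a; elim=> [|c b z Ac A'b _ IH]; first by rewrite mulmx0; exact: JointMod0.
rewrite mulmxDr !mulmxA -(comm Ac A'a) -(mulmxA c); apply: JointModS => //.
exact: side_M sA' _ _ A'a A'b.
Qed.

Lemma joint_modZ mu c x : joint_mod mu x -> joint_mod mu (c *: x).
Proof.
move=> mx; rewrite -mul_scalar_mx; apply: joint_mod_l => //.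
by rewrite -scalemx1; apply: (side_Z sA); exact: side_1 sA.
Qed.

Lemma joint_mod_sub mu : subspace_of (joint_mod mu).
Proof.
by split; [exact: JointMod0|exact: joint_modD|move=> c x; exact: joint_modZ].
Qed.

Lemma joint_mod_v mu : joint_mod mu (v mu).
Proof.
have := JointModS (side_1 sA) (side_1 sA') (JointMod0 mu).
by rewrite !mul1mx addr0.
Qed.
End Pair.
End DualPair.

(** * Complete reducibility *)

Section JointModules.
Variables (K : fieldType) (D : nat) (M : finType) (v : M -> 'cV[K]_D).
Variables (A : 'M[K]_D -> Prop) (I : finType) (E F : I -> 'M[K]_D).
Variables (J : Type) (L : J -> 'M[K]_D) (chi : M -> J -> K).
Variables (A' : 'M[K]_D -> Prop) (I' : finType) (E' F' : I' -> 'M[K]_D).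
Variables (J' : Type) (L' : J' -> 'M[K]_D) (chi' : M -> J' -> K).
Hypothesis AA' : dual_pair v A E F L chi A' E' F' L' chi'.
Let sA := pair_l AA'.
Let sA' := pair_r AA'.
Let comm := pair_comm AA'.
Let A'A := dual_pair_sym AA'.
Local Notation joint_mod := (joint_mod v A A').

Lemma dot_joint_mod mu nu x : joint_mod mu x -> mu != nu -> dot (v nu) x = 0.
Proof.
move=> + ne; elim=> [|a b y Aa A'b _ IH]; first exact: dot0r.
rewrite dotDr IH addr0 -mulmxA.
have [s [z ->]] := side_vac sA' mu A'b.
rewrite mulmxDr -scalemxAr dotDr dotZr (vacuum_offdiag AA' Aa ne) mulr0 add0r.
rewrite mulmx_sumr dot_sumr big1 // => i _.
by rewrite mulmxA (comm Aa (side_F sA' i)) -mulmxA (dot_vF A'A).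
Qed.

Lemma joint_mod_hw mu x : joint_mod mu x -> hw E x -> hw E' x ->
  x = dot (v mu) x *: v mu.
Proof.
move=> mx Ex E'x; rewrite {1}(joint_coord AA' Ex E'x) (bigD1 mu) //=.
by rewrite big1 ?addr0 // => nu ne; rewrite (dot_joint_mod mx) ?scale0r // eq_sym.
Qed.

(** A nonzero submodule of the module of v mu contains a joint highest weight
vector, which is a multiple of v mu by [joint_mod_hw]. *)
Lemma joint_mod_simple mu (S : 'cV[K]_D -> Prop) x :
    subspace_of S -> (forall a y, A a -> S y -> S (a *m y)) ->
    (forall a y, A' a -> S y -> S (a *m y)) ->
    S x -> joint_mod mu x -> x != 0 ->
  S (v mu).
Proof.
move=> [S0 SD SZ] SA SA' Sx mx x0.
have [||//|y [[Sy my] y0 [Ey E'y]]] :=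
    pair_nil_l AA' (S := fun y => S y /\ joint_mod mu y) _ _ (conj Sx mx).
- move=> i y [Sy my]; have Ei := side_E sA i.
  by split; [exact: SA|exact: (joint_mod_l AA')].
- move=> i y [Sy my]; have Ei := side_E sA' i.
  by split; [exact: SA'|exact: (joint_mod_r AA')].
have yE := joint_mod_hw my Ey E'y; set s := dot _ _ in yE.
have s0 : s != 0 by apply: contraNneq y0 => s0; rewrite yE s0 scale0r.
by rewrite -(scale1r (v mu)) -(mulVf s0) -scalerA -yE; exact: SZ.
Qed.

(** The vectors orthogonal to all the modules form a submodule, because the
algebras are closed under transposition. If it were nonzero, it would contain a
joint highest weight vector, hence a nonzero combination of vacua orthogonal to
the vacua. *)
Lemma joint_mod_total x : exists y : M -> 'cV[K]_D,
  (forall mu, joint_mod mu (y mu)) /\ x = \sum_mu y mu.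
Proof.
pose S x := exists y : M -> 'cV[K]_D,
  (forall mu, joint_mod mu (y mu)) /\ x = \sum_mu y mu.
have Ssub : subspace_of S.
  split.
  - exists (fun=> 0); split; last by rewrite big1.
    by move=> mu; exact: JointMod0.
  - move=> _ _ [y [my ->]] [z [mz ->]]; exists (fun mu => y mu + z mu).
    by rewrite big_split; split=> // mu; exact: (joint_modD (A := A)).
  - move=> c _ [y [my ->]]; exists (fun mu => c *: y mu).
    by rewrite scaler_sumr; split=> // mu; exact: (joint_modZ AA').
have Smod mu y : joint_mod mu y -> S y.
  move=> my; exists (fun nu => if nu == mu then y else 0); split.
    by move=> nu; case: eqP => [->//|_]; exact: JointMod0.
  by rewrite -big_mkcond big_pred1_eq.
apply: contrapT => Sx.
have [y [yx yS]] := separating_vector Ssub Sx.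
have y0 : y != 0 by apply: contraNneq yx => ->; rewrite dotC dot0r.
pose T y := forall mu z, joint_mod mu z -> dot y z = 0.
have Ty : T y by move=> mu z /Smod/yS.
have [||//|z [Tz z0 [Ez E'z]]] := pair_nil_l AA' (S := T) _ _ Ty.
- move=> i z Tz mu w mw; rewrite dotC dot_adj dotC; apply: (Tz mu).
  apply: (joint_mod_l AA') => //; apply: (side_T sA); exact: (side_E sA).
- move=> i z Tz mu w mw; rewrite dotC dot_adj dotC; apply: (Tz mu).
  apply: (joint_mod_r AA') => //; apply: (side_T sA'); exact: (side_E sA').
case/eqP: z0; rewrite (joint_coord AA' Ez E'z) big1 // => mu _.
by rewrite dotC (Tz mu) ?scale0r //; exact: (joint_mod_v AA').
Qed.

(** If y mu were nonzero, it would generate v mu by simplicity; then v mu would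
lie in the sum of the other modules, all of which are orthogonal to v mu. *)
Lemma joint_mod_direct (y : M -> 'cV[K]_D) :
  (forall mu, joint_mod mu (y mu)) -> \sum_mu y mu = 0 -> forall mu, y mu = 0.
Proof.
move=> my sy mu; apply/eqP; apply: contraT => y0.
pose S x := exists z : M -> 'cV[K]_D,
  [/\ forall nu, joint_mod nu (z nu), z mu = 0 & x = \sum_nu z nu].
have Sv : S (v mu).
  apply: (@joint_mod_simple mu S (y mu)) => //.
  - split.
    + exists (fun=> 0); split=> //; last by rewrite big1.
      by move=> nu; exact: JointMod0.
    + move=> _ _ [z [mz z0 ->]] [w [mw w0 ->]]; exists (fun nu => z nu + w nu).
      by rewrite big_split z0 w0 addr0; split=> // nu; exact: (joint_modD (A := A)).
    + move=> c _ [z [mz z0 ->]]; exists (fun nu => c *: z nu).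
      by rewrite scaler_sumr z0 scaler0; split=> // nu; exact: (joint_modZ AA').
  - move=> a _ Aa [z [mz z0 ->]]; exists (fun nu => a *m z nu).
    by rewrite mulmx_sumr z0 mulmx0; split=> // nu; exact: (joint_mod_l AA').
  - move=> a _ Aa [z [mz z0 ->]]; exists (fun nu => a *m z nu).
    by rewrite mulmx_sumr z0 mulmx0; split=> // nu; exact: (joint_mod_r AA').
  - exists (fun nu => if nu == mu then 0 else - y nu); rewrite eqxx; split=> //.
      move=> nu; case: eqP => _; first exact: JointMod0.
      by rewrite -scaleN1r; exact: (joint_modZ AA').
    rewrite (bigD1 mu) //= eqxx add0r.
    rewrite (eq_bigr (fun nu => - y nu)) => [|nu /negPf -> //].
    by rewrite sumrN; move/eqP: sy; rewrite (bigD1 mu) //= addr_eq0 => /eqP.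
case: Sv => z [mz z0 vE].
have := pair_orth AA' mu mu; rewrite eqxx {2}vE dot_sumr (bigD1 mu) //=.
rewrite z0 dot0r add0r big1 => [/eqP|nu ne]; first by rewrite eq_sym oner_eq0.
exact: dot_joint_mod.
Qed.

Definition lowered (x : 'cV[K]_D) := exists y : I -> 'cV[K]_D, x = \sum_i F i *m y i.

Lemma lowered_sub : subspace_of lowered.
Proof.
split.
- by exists (fun=> 0); rewrite big1 // => i _; rewrite mulmx0.
- move=> _ _ [y ->] [z ->]; exists (fun i => y i + z i); rewrite -big_split.
  by apply: eq_bigr => i _; rewrite mulmxDr.
- move=> c _ [y ->]; exists (fun i => c *: y i); rewrite scaler_sumr.
  by apply: eq_bigr => i _; rewrite scalemxAr.
Qed.

Lemma lowered_F i y : lowered (F i *m y).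
Proof.
exists (fun j => if j == i then y else 0).
rewrite (bigD1 i) //= eqxx big1 ?addr0 // => j /negPf ->; exact: mulmx0.
Qed.

Lemma hw_sub : subspace_of (hw E).
Proof.
split=> [i|x y Ex Ey i|c x Ex i]; first exact: mulmx0.
  by rewrite mulmxDr Ex Ey addr0.
by rewrite -scalemxAr Ex scaler0.
Qed.

Lemma hw_comm b x : (forall a, A a -> a *m b = b *m a) -> hw E x -> hw E (b *m x).
Proof. by move=> ab Ex i; rewrite mulmxA (ab _ (side_E sA i)) -mulmxA Ex mulmx0. Qed.

Lemma lowered_comm b x : (forall a, A a -> a *m b = b *m a) ->
  lowered x -> lowered (b *m x).
Proof.
move=> ab [y ->]; exists (fun i => b *m y i); rewrite mulmx_sumr.
by apply: eq_bigr => i _; rewrite !mulmxA (ab _ (side_F sA i)).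
Qed.

(** The intersection is stable under A', so if it is nonzero it contains a joint
highest weight vector, that is a combination of vacua; but the vacua are
orthogonal to the images of the F_i. *)
Lemma hw_lowered x : hw E x -> lowered x -> x = 0.
Proof.
move=> Ex lx; apply/eqP; apply: contraT => x0.
have [||//|y [[Ey [z yE]] y0 [_ E'y]]] :=
  pair_nil_l AA' (S := fun y => hw E y /\ lowered y) _ _ (conj Ex lx).
- move=> i y [Ey ly]; rewrite Ey; split; first by case: hw_sub.
  by case: lowered_sub.
- move=> i y [Ey ly].
  have cE a : A a -> a *m E' i = E' i *m a.
    by move=> Aa; apply: comm => //; exact: (side_E sA').
  by split; [exact: hw_comm|exact: lowered_comm].
case/eqP: y0; rewrite (joint_coord AA' Ey E'y) big1 // => mu _.
rewrite yE dot_sumr big1 ?scale0r // => i _; exact: (dot_vF AA').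
Qed.

(** A vector orthogonal to the sum is killed by all transposed F_i, so it is a
highest weight vector, orthogonal to all highest weight vectors. The space of
these is stable under A', and a joint highest weight vector in it would be
orthogonal to all vacua. *)
Lemma hw_lowered_total x : exists h, hw E h /\ lowered (x - h).
Proof.
have [H0 HD HZ] := hw_sub; have [W0 WD WZ] := lowered_sub.
pose S x := exists h, hw E h /\ lowered (x - h).
have Ssub : subspace_of S.
  split.
  - by exists 0; rewrite subr0.
  - move=> x1 x2 [h1 [E1 l1]] [h2 [E2 l2]]; exists (h1 + h2); split; first exact: HD.
    by rewrite opprD addrACA; exact: WD.
  - move=> c x1 [h [Eh lh]]; exists (c *: h); split; first exact: HZ.
    by rewrite -scalerBr; exact: WZ.
apply: contrapT => Sx.
have [y [yx yS]] := separating_vector Ssub Sx.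
have y0 : y != 0 by apply: contraNneq yx => ->; rewrite dotC dot0r.
pose T y := hw E y /\ forall h, hw E h -> dot y h = 0.
have Ty : T y.
  split=> [i|h Eh]; last first.
    by apply: yS; exists h; rewrite subrr.
  apply/(side_FT sA); apply: dot_nondeg => w; rewrite -dot_adj; apply: yS.
  by exists 0; rewrite subr0; split=> //; exact: lowered_F.
have [||//|z [[_ Tz] z0 [Ez E'z]]] := pair_nil_l AA' (S := T) _ _ Ty.
- move=> i z [Ez Tz]; rewrite Ez; split=> // h _; by rewrite dotC dot0r.
- move=> i z [Ez Tz].
  have A'E := side_E sA' i; split=> [|h Eh].
    by apply: hw_comm => // a Aa; exact: comm.
  rewrite dotC dot_adj dotC; apply: Tz; apply: hw_comm => // a Aa.
  by apply: comm => //; apply: (side_T sA').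
case/eqP: z0; rewrite (joint_coord AA' Ez E'z) big1 // => mu _.
by rewrite dotC Tz ?scale0r //; exact: (side_hw sA).
Qed.

(** Assembled from the decompositions of the basis vectors. *)
Lemma hw_projector : exists p : 'M[K]_D,
  [/\ forall x, hw E (p *m x), forall h, hw E h -> p *m h = h
    & forall x, lowered (x - p *m x)].
Proof.
have [H0 HD HZ] := hw_sub; have [W0 WD WZ] := lowered_sub.
have /choice [h hP] : forall j : 'I_D, exists h,
    hw E h /\ lowered (delta_mx j (0 : 'I_1) - h).
  by move=> j; exact: hw_lowered_total.
pose p : 'M[K]_D := \matrix_(i, j) h j i 0.
have pE x : p *m x = \sum_j x j 0 *: h j.
  apply/matrixP=> i k; rewrite ord1 !mxE summxE; apply: eq_bigr => j _.
  by rewrite !mxE mulrC.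
have hwp x : hw E (p *m x).
  rewrite pE; refine (subspace_sum _ hw_sub _) => j _.
  by apply: HZ; case: (hP j).
have lp x : lowered (x - p *m x).
  have -> : x - p *m x = \sum_j x j 0 *: (delta_mx j 0 - h j).
    under eq_bigr do rewrite scalerBr.
    rewrite sumrB -pE; congr (_ - _); apply/matrixP=> i k.
    rewrite ord1 summxE (bigD1 i) //= !mxE !eqxx mulr1 big1 ?addr0 // => j ne.
    by rewrite !mxE eq_sym (negPf ne) mulr0.
  refine (subspace_sum _ lowered_sub _) => j _.
  by apply: WZ; case: (hP j).
exists p; split=> // x Ex; apply/eqP; rewrite eq_sym -subr_eq0.
apply/eqP/hw_lowered => //; rewrite -scaleN1r; apply: HD => //; exact: HZ.
Qed.

(** A product of Lagrange factors in the L_j, one for each nu other than mu. *)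
Lemma vacuum_separation mu : exists b, A b /\
  forall nu, b *m v nu = (nu == mu)%:R *: v nu.
Proof.
suff [b [Ab b1 b0]] : exists b, [/\ A b, b *m v mu = v mu &
    forall nu, nu \in enum M -> nu != mu -> b *m v nu = 0].
  exists b; split=> // nu; case: eqP => [->|/eqP ne]; first by rewrite scale1r.
  by rewrite scale0r b0 // mem_enum.
have diag : forall (s : seq M), exists b, [/\ A b, b *m v mu = v mu,
    (forall nu, nu \in s -> nu != mu -> b *m v nu = 0)
    & forall nu, exists c, b *m v nu = c *: v nu].
  elim=> [|nu s [b [Ab b1 b0 bd]]].
    exists 1%:M; split=> [|||nu]; rewrite ?mul1mx //; first exact: (side_1 sA).
    by exists 1; rewrite scale1r.
  have [->|ne] := eqVneq nu mu.
    exists b; split=> // ka; rewrite inE => /orP[/eqP ->|]; last exact: b0.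
    by rewrite eqxx.
  have [j cj] := side_sep sA ne.
  pose c := (chi mu j - chi nu j)^-1.
  have c0 : chi mu j - chi nu j != 0 by rewrite subr_eq0 eq_sym.
  have bE ka : (c *: (L j - (chi nu j)%:M)) *m v ka =
      (c * (chi ka j - chi nu j)) *: v ka.
    by rewrite -scalemxAl mulmxBl (side_wt sA) mul_scalar_mx -scalerBl scalerA.
  exists ((c *: (L j - (chi nu j)%:M)) *m b); split.
  - apply: (side_M sA) => //; apply: (side_Z sA); apply: (side_D sA).
      exact: (side_L sA).
    by rewrite -scaleN1r -scalemx1; do 2!apply: (side_Z sA); exact: (side_1 sA).
  - by rewrite -mulmxA b1 bE /c mulVf // scale1r.
  - move=> ka; rewrite inE => /orP[/eqP -> _|ks kne].
      have [d dE] := bd nu; rewrite -mulmxA dE -scalemxAr bE subrr mulr0.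
      by rewrite scale0r scaler0.
    by rewrite -mulmxA b0 // mulmx0.
  - move=> ka; have [d dE] := bd ka; rewrite -mulmxA dE -scalemxAr bE scalerA.
    by eexists.
by have [b [? ? ? _]] := diag (enum M); exists b.
Qed.
End JointModules.

(** * The double commutant property *)

Section Commutant.
Variables (K : fieldType) (D : nat) (M : finType) (v : M -> 'cV[K]_D).
Variables (A : 'M[K]_D -> Prop) (I : finType) (E F : I -> 'M[K]_D).
Variables (J : Type) (L : J -> 'M[K]_D) (chi : M -> J -> K).
Variables (A' : 'M[K]_D -> Prop) (I' : finType) (E' F' : I' -> 'M[K]_D).
Variables (J' : Type) (L' : J' -> 'M[K]_D) (chi' : M -> J' -> K).
Hypothesis AA' : dual_pair v A E F L chi A' E' F' L' chi'.
Let sA := pair_l AA'.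
Let sA' := pair_r AA'.
Let comm := pair_comm AA'.
Let A'A := dual_pair_sym AA'.

Lemma mulmx_ext m n (a b : 'M[K]_(m, n)) :
  (forall x : 'cV_n, a *m x = b *m x) -> a = b.
Proof. by move=> ab; apply/trmx_inj/row_matrixP=> i; rewrite -!tr_col !colE ab. Qed.

Definition commutes_with (f : 'M[K]_D) := forall a, A a -> a *m f = f *m a.

(** The f with vanishing traces form an A'-bimodule X. If X is nonzero, the
nilpotency of the E' and of the transposed F' gives a nonzero f2 in X with
E' f2 = 0 and f2 F' = 0. Then both p f2 and its transpose map into the joint
highest weight vectors, and p f2 commutes with the L_j, whose weights separate
the vacua: p f2 is a combination of the matrices v mu *m (v mu)^T. Its
coefficients are traces tr (p f2 b) for the b in A' that separate the vacua, so
they vanish. Hence f2 kills the highest weight vectors of A, and these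
generate the whole space under A. *)
Lemma commutant_trace_nondeg (p : 'M[K]_D) (f : 'M[K]_D) :
    (forall x, hw E (p *m x)) -> (forall h, hw E h -> p *m h = h) ->
    (forall x, lowered F (x - p *m x)) ->
    commutes_with f -> (forall b, A' b -> \tr (p *m f *m b) = 0) ->
  f = 0.
Proof.
move=> hwp ph lp Cf trf.
have [W0 WD WZ] := lowered_sub F.
(* p commutes with whatever preserves both its image and its kernel *)
have p_low x : lowered F x -> p *m x = 0.
  move=> lx; apply: (hw_lowered AA') => //.
  have -> : p *m x = x - (x - p *m x) by rewrite subKr.
  by apply: WD => //; rewrite -scaleN1r; exact: WZ.
have p_comm b : (forall x, hw E x -> hw E (b *m x)) ->
    (forall x, lowered F x -> lowered F (b *m x)) -> p *m b = b *m p.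
  move=> hb lb; apply: mulmx_ext => x; rewrite -!mulmxA.
  rewrite -{1}[x](subrK (p *m x)) mulmxDr mulmxDr p_low; last by apply: lb.
  by rewrite add0r ph //; exact: hb.
have pA' b : A' b -> p *m b = b *m p.
  move=> A'b; have bc a : A a -> a *m b = b *m a by move=> Aa; exact: comm.
  by apply: p_comm => x; [exact: (hw_comm AA')|exact: (lowered_comm AA')].
have pC g : commutes_with g -> p *m g = g *m p.
  by move=> Cg; apply: p_comm => x; [exact: (hw_comm AA')|exact: (lowered_comm AA')].
have pL j : p *m L j = L j *m p.
  apply: p_comm => [x Ex i|_ [y ->]].
    have [c ELc] := side_EL sA i j.
    by rewrite mulmxA ELc -scalemxAl -mulmxA Ex mulmx0 scaler0.
  have /choice [c cP] := fun i => side_LF sA i j.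
  exists (fun i => c i *: (L j *m y i)); rewrite mulmx_sumr.
  by apply: eq_bigr => i _; rewrite mulmxA cP -scalemxAl -scalemxAr mulmxA.
pose X g := commutes_with g /\ forall b, A' b -> \tr (p *m g *m b) = 0.
have Xl a g : A' a -> X g -> X (a *m g).
  move=> A'a [Cg tg]; split=> [b Ab|b A'b].
    by rewrite mulmxA (comm Ab A'a) -!mulmxA (Cg _ Ab).
  rewrite mulmxA (pA' _ A'a) -!mulmxA mxtrace_mulC -!mulmxA mulmxA.
  by apply: tg; exact: (side_M sA').
have Xr a g : A' a -> X g -> X (g *m a).
  move=> A'a [Cg tg]; split=> [b Ab|b A'b].
    by rewrite mulmxA (Cg _ Ab) -!mulmxA (comm Ab A'a).
  by rewrite mulmxA -mulmxA; apply: tg; exact: (side_M sA').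
apply/eqP; apply: contraT => f0.
have [B nilB] := pair_nil AA'.
have [||g [Xg g0 E'g]] := @maximal_vector _ _ _ (fun a => exists i, a = E' i) X f _ _
    (conj Cf trf) f0.
- exists B => s sN; apply: nilB => a /sN[i ->]; right; exists i; by left.
- by move=> a h [i ->]; apply: Xl; exact: (side_E sA').
have [||||k [[Xk E'k] k0 F'k]] := @maximal_vector _ _ _
    (fun a => exists i, a = (F' i)^T) (fun h => X h^T /\ forall i, E' i *m h^T = 0)
    g^T _ _ _ _.
- exists B => s sN; apply: nilB => a /sN[i ->]; right; exists i; by right.
- move=> a h [i ->] [Xh E'h]; rewrite trmx_mul trmxK; split.
    by apply: Xr => //; exact: (side_F sA').
  by move=> j; rewrite mulmxA E'h mul0mx.
- by rewrite trmxK; split=> // i; apply: E'g; exists i.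
- by rewrite -(inj_eq trmx_inj) trmxK trmx0.
pose f2 := k^T; have Cf2 : commutes_with f2 by case: Xk.
have f20 : f2 != 0 by rewrite -(inj_eq trmx_inj) trmxK trmx0.
have f2F' i : f2 *m F' i = 0.
  by apply: trmx_inj; rewrite trmx_mul trmxK trmx0; apply: F'k; exists i.
have [g2 g2def] : {g2 | g2 = p *m f2} by exists (p *m f2).
have Eg2 x : hw E (g2 *m x) by rewrite g2def -mulmxA; exact: hwp.
have E'g2 x : hw E' (g2 *m x).
  move=> i; rewrite g2def !mulmxA -(pA' _ (side_E sA' i)) -(mulmxA p) E'k.
  by rewrite mulmx0 mul0mx.
have g2F i : g2 *m F i = 0.
  apply: mulmx_ext => x; rewrite mul0mx g2def -(mulmxA p) -Cf2; last exact: (side_F sA).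
  by rewrite -mulmxA p_low // -mulmxA; exact: lowered_F.
have g2F' i : g2 *m F' i = 0 by rewrite g2def -mulmxA f2F' mulmx0.
pose y mu := g2^T *m v mu.
have Ey mu : hw E (y mu).
  by move=> i; apply/(side_FT sA); rewrite mulmxA -trmx_mul g2F trmx0 mul0mx.
have E'y mu : hw E' (y mu).
  by move=> i; apply/(side_FT sA'); rewrite mulmxA -trmx_mul g2F' trmx0 mul0mx.
have g2E : g2 = \sum_mu v mu *m (y mu)^T.
  apply: mulmx_ext => x; rewrite {1}(joint_coord AA' (Eg2 x) (E'g2 x)) mulmx_suml.
  apply: eq_bigr => mu _; rewrite -mulmxA [_^T *m x]mx11_scalar mul_mx_scalar.
  by rewrite dot_adj.
have g2L j : g2 *m L j = L j *m g2.
  by rewrite g2def -mulmxA -Cf2 ?mulmxA ?pL //; exact: (side_L sA).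
have offdiag mu nu : mu != nu -> dot (v mu) (g2 *m v nu) = 0.
  move=> ne; have [j cj] := side_sep sA ne.
  have : dot (v mu) (g2 *m (L j *m v nu)) = dot (v mu) (L j *m (g2 *m v nu)).
    by rewrite !mulmxA g2L.
  rewrite (side_wt sA) -scalemxAr dotZr => /eqP.
  rewrite {2}(joint_coord AA' (Eg2 _) (E'g2 _)) mulmx_sumr dot_sumr (bigD1 mu) //=.
  rewrite -scalemxAr (side_wt sA) !dotZr (pair_orth AA') eqxx mulr1 big1.
    rewrite addr0 mulrC -subr_eq0 -mulrBr mulf_eq0 subr_eq0 => /orP[/eqP //|].
    by rewrite eq_sym (negPf cj).
  move=> ka kne; rewrite -scalemxAr (side_wt sA) !dotZr (pair_orth AA').
  by rewrite eq_sym (negPf kne) !mulr0.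
have diag nu : dot (v nu) (g2 *m v nu) = 0.
  have [b [A'b bv]] := vacuum_separation A'A nu.
  case: Xk => _ /(_ b A'b); rewrite -/f2 -g2def {1}g2E mulmx_suml raddf_sum /=.
  rewrite (bigD1 nu) //= big1 => [|mu ne]; last first.
    rewrite mxtrace_mulC [b *m _]mulmxA bv (negPf ne) scale0r mul0mx.
    exact: mxtrace0.
  rewrite mxtrace_mulC mulmxA bv eqxx scale1r mxtrace_mulC addr0.
  by rewrite trace_mx11 dot_adj.
have y0 mu : y mu = 0.
  rewrite (joint_coord AA' (Ey mu) (E'y mu)) big1 // => nu _.
  rewrite dot_adj trmxK dotC; have [->|ne] := eqVneq nu mu.
    by rewrite diag scale0r.
  by rewrite offdiag ?scale0r // eq_sym.
have g20 : g2 = 0 by rewrite g2E big1 // => mu _; rewrite y0 trmx0 mulmx0.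
case/eqP: f20; apply: mulmx_ext => x; rewrite mul0mx.
have [z [mz ->]] := joint_mod_total AA' x; rewrite mulmx_sumr big1 // => mu _.
elim: (mz mu) => [|a b w Aa A'b _ IH]; first exact: mulmx0.
rewrite mulmxDr IH addr0 !mulmxA -Cf2 // -!mulmxA.
have Eb : hw E (b *m v mu).
  by apply: (hw_comm AA') => [c Ac|]; [exact: comm|exact: (side_hw sA)].
by rewrite -(ph _ (hw_comm AA' Cf2 Eb)) [p *m _]mulmxA -g2def g20 mul0mx mulmx0.
Qed.

(** The commutant is a subspace BC of the matrices and contains A', the subspace
BA. The matrix T of the traces against a basis of A' has trivial kernel on the
commutant, whose dimension is therefore at most that of A'. *)
Theorem pair_commutant f : commutes_with f -> A' f.
Proof.
have [p [hwp ph lp]] := hw_projector AA'.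
pose N := (D * D)%N.
have [|BC BCP] := @subspace_row K N (fun x => commutes_with (vec_mx x)).
  split=> [a Aa|x y Cx Cy a Aa|c x Cx a Aa].
  - by rewrite linear0 mulmx0 mul0mx.
  - by rewrite linearD /= mulmxDl mulmxDr Cx // Cy.
  - by rewrite linearZ /= -scalemxAl -scalemxAr Cx.
have [|BA BAP] := @subspace_row K N (fun x => A' (vec_mx x)).
  split=> [|x y|c x].
  - by rewrite linear0; exact: (side_0 A'A).
  - by rewrite linearD /=; exact: (side_D sA').
  - by rewrite linearZ /=; exact: (side_Z sA').
have sub : (BA <= BC)%MS.
  apply/rV_subP=> x /BAP A'x; apply/BCP => a Aa; exact: comm.
pose k := \rank BA.
pose T : 'M[K]_(N, k) := \matrix_(i, j)
  \tr (p *m vec_mx (delta_mx 0 i) *m vec_mx (row j (row_base BA))).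
have TE (x : 'rV_N) j :
    (x *m T) 0 j = \tr (p *m vec_mx x *m vec_mx (row j (row_base BA))).
  rewrite {2}[x]row_sum_delta linear_sum mulmx_sumr mulmx_suml raddf_sum mxE.
  apply: eq_bigr => i _ /=.
  by rewrite linearZ /= -scalemxAr -scalemxAl mxtraceZ mxE.
have kerT : (BC :&: kermx T)%MS = 0.
  apply/eqP; rewrite -submx0; apply/rV_subP=> x; rewrite sub_capmx.
  move=> /andP[/BCP Cx /sub_kermxP xT]; rewrite submx0.
  rewrite -[x]vec_mxK (commutant_trace_nondeg hwp ph lp Cx) ?linear0 // => b A'b.
  have : (mxvec b <= row_base BA)%MS.
    by rewrite eq_row_base; apply/BAP; rewrite mxvecK.
  move=> /submxP[c bE]; rewrite -[b]mxvecK bE mulmx_sum_row linear_sum mulmx_sumr.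
  rewrite raddf_sum big1 // => j _ /=.
  by rewrite linearZ /= -scalemxAr mxtraceZ -TE xT mxE mulr0.
have rk : (\rank BC <= \rank BA)%N.
  have := mxrank_mul_ker BC T; rewrite kerT mxrank0 addn0 => <-.
  exact: rank_leq_col.
have eqAC : (BC <= BA)%MS by rewrite -(geq_leqif (mxrank_leqif_sup sub)).
move=> Cf; rewrite -[f]mxvecK; apply/BAP; apply: submx_trans eqAC.
by apply/BCP; rewrite mxvecK.
Qed.
End Commutant.

(** * Highest weight modules of the quantum group *)

Section QuantumGroupModules.
Variables (K : fieldType) (q : K) (p : nat).
Hypothesis q_neq0 : q != 0.
Local Notation Uq := (Uq q p).
Local Notation UE := (@UE K q p).
Local Notation UF := (@UF K q p).
Local Notation UL := (@UL K q p).

Definition ULinv (i : 'I_p) : Uq := gen (@Uq_rel K q p) (gLinv i).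

Lemma UL_inv i : UL i * ULinv i = 1.
Proof. by have := cls_rel (Uq_LLinv q i); rewrite !clsE. Qed.

Lemma ULinv_L i : ULinv i * UL i = 1.
Proof. by have := cls_rel (Uq_LinvL q i); rewrite !clsE. Qed.

Lemma UL_F i (j : 'I_p.-1) :
  UL i * UF j = q ^ (- delta i j + delta i j.+1) *: (UF j * UL i).
Proof.
have h : UL i * UF j * ULinv i = q ^ (- delta i j + delta i j.+1) *: UF j.
  by have := cls_rel (Uq_LF q i j); rewrite !clsE.
by rewrite -[LHS]mulr1 -(ULinv_L i) mulrA h -palg_scaleAl.
Qed.

Lemma UE_F i j : UE i * UF j = UF j * UE i + ((delta i j)%:~R / (q - q^-1)) *:
  (UL (lo i) * ULinv (hi i) - ULinv (lo i) * UL (hi i)).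
Proof.
have := cls_rel (Uq_EF q i j); rewrite clsB clsZ clsB !clsM => h.
by rewrite -[LHS](subrK (UF j * UE i)) addrC; congr (_ + _).
Qed.

Section HighestWeight.
Variables (V : lmodType K) (r : Uq -> V -> V).
Hypothesis rP : is_rep r.

Record hw_vector (mu : 'I_p -> nat) (z : V) : Prop := HwVector {
  hw_E : forall i, r (UE i) z = 0;
  hw_L : forall i, r (UL i) z = q ^+ mu i *: z }.

Variables (mu : 'I_p -> nat) (z : V).
Hypothesis zP : hw_vector mu z.

(** For a word w in the indices of the F_i. *)
Definition lowering (w : seq 'I_p.-1) : V := foldr (fun j x => r (UF j) x) z w.

Definition lowering_wt (i : 'I_p) (w : seq 'I_p.-1) : int :=
  (mu i)%:Z + \sum_(j <- w) (- delta i j + delta i j.+1).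

Lemma L_lowering i w : r (UL i) (lowering w) = q ^ lowering_wt i w *: lowering w.
Proof.
elim: w => [|j w IH]; first by rewrite /lowering_wt big_nil addr0 /= (hw_L zP).
rewrite /= -(repM rP) UL_F (repZl rP) (repM rP) IH (repZv rP) scalerA -expfzDr //.
by rewrite /lowering_wt big_cons [in RHS]addrCA.
Qed.

Lemma Linv_lowering i w :
  r (ULinv i) (lowering w) = (q ^ lowering_wt i w)^-1 *: lowering w.
Proof.
have := L_lowering i w => /(congr1 (r (ULinv i))).
rewrite -(repM rP) ULinv_L (rep1 rP) (repZv rP) => {2}->.
by rewrite scalerA mulVf ?scale1r // expfz_neq0.
Qed.

Definition lowering_span (x : V) :=
  exists s : seq (K * seq 'I_p.-1), x = \sum_(cw <- s) cw.1 *: lowering cw.2.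

Lemma lowering_spanD x y :
  lowering_span x -> lowering_span y -> lowering_span (x + y).
Proof. by move=> [s ->] [t ->]; exists (s ++ t); rewrite big_cat. Qed.

Lemma lowering_spanZ c x : lowering_span x -> lowering_span (c *: x).
Proof.
move=> [s ->]; exists [seq (c * cw.1, cw.2) | cw <- s].
by rewrite big_map scaler_sumr; apply: eq_bigr => cw _; rewrite scalerA.
Qed.

Lemma lowering_span_word w : lowering_span (lowering w).
Proof. by exists [:: (1, w)]; rewrite big_seq1 scale1r. Qed.

Lemma lowering_span0 : lowering_span 0.
Proof. by exists [::]; rewrite big_nil. Qed.

Lemma lowering_span_ind (f : V -> V) :
    f 0 = 0 -> (forall c x y, f (c *: x + y) = c *: f x + f y) ->
    (forall w, lowering_span (f (lowering w))) ->
  forall x, lowering_span x -> lowering_span (f x).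
Proof.
move=> f0 fZD fw x [s ->]; elim: s => [|[c w] s IH].
  by rewrite big_nil f0; exact: lowering_span0.
by rewrite big_cons /= fZD; apply: lowering_spanD => //; exact: lowering_spanZ.
Qed.

Lemma lowering_span_F i x : lowering_span x -> lowering_span (r (UF i) x).
Proof.
apply: lowering_span_ind; [exact: (rep0v rP)|by move=> *; exact: (repZD rP)|move=> w].
exact: (lowering_span_word (i :: w)).
Qed.

Lemma lowering_span_E i w : lowering_span (r (UE i) (lowering w)).
Proof.
elim: w => [|j w IH] /=; first by rewrite (hw_E zP); exact: lowering_span0.
rewrite -(repM rP) UE_F (repDl rP) (repM rP); apply: lowering_spanD.
  exact: lowering_span_F.
rewrite (repZl rP) (repBl rP) !(repM rP) !(Linv_lowering, L_lowering).
rewrite !(repZv rP) !(Linv_lowering, L_lowering) !scalerA -scalerBl scalerA.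
by apply: lowering_spanZ; exact: lowering_span_word.
Qed.

(** The lowering words span the module generated by z: their span is stable
under the generators, E_i being moved to the right through the F_j. *)
Lemma hw_lowering a : lowering_span (r a z).
Proof.
apply: (rep_stable rP) (lowering_span_word [::]) => [||x].
- exact: lowering_spanD.
- exact: lowering_spanZ.
apply: lowering_span_ind; first exact: (rep0v rP).
  by move=> *; exact: (repZD rP).
move=> w; case: x => i.
- exact: lowering_span_E.
- exact: (lowering_span_word (i :: w)).
- by rewrite L_lowering; apply: lowering_spanZ; exact: lowering_span_word.
- by rewrite Linv_lowering; apply: lowering_spanZ; exact: lowering_span_word.
Qed.

(** The empty word is the only one that contributes a multiple of z. *)
Lemma hw_vacuum_part a : exists c (s : seq (K * seq 'I_p.-1)),
  all (fun cw => cw.2 != [::]) s /\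
  r a z = c *: z + \sum_(cw <- s) cw.1 *: lowering cw.2.
Proof.
have [s ->] := hw_lowering a.
elim: s => [|[c w] s [d [t [ta tE]]]].
  by exists 0, [::]; rewrite !big_nil scale0r addr0.
case: w => [|i w]; rewrite big_cons tE.
  by exists (c + d), t; rewrite addrA scalerDl.
exists d, ((c, i :: w) :: t); split; first by rewrite /= ta.
by rewrite big_cons addrCA.
Qed.

Lemma hw_vacuum_F a : exists c (y : 'I_p.-1 -> V),
  r a z = c *: z + \sum_i r (UF i) (y i).
Proof.
have [c [s [sa ->]]] := hw_vacuum_part a; exists c.
elim: s sa => [|[d [|i w]] s IH] //=.
  by move=> _; exists (fun=> 0); rewrite big_nil big1 // => i _; exact: (rep0v rP).
move=> /IH[y] /addrI yE.
exists (fun j => (if j == i then d *: lowering w else 0) + y j).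
rewrite big_cons yE /=; congr (_ + _).
under [RHS]eq_bigr do rewrite (repDv rP).
rewrite big_split; congr (_ + _); rewrite (bigD1 i) //= eqxx (repZv rP).
by rewrite big1 ?addr0 // => j /negPf ->; exact: (rep0v rP).
Qed.

Hypothesis q_gen : forall k : int, q ^ k = 1 -> k = 0.

Lemma q_inj (k l : int) : q ^ k = q ^ l -> k = l.
Proof.
move=> kl; apply/eqP; rewrite -subr_eq0; apply/eqP/q_gen.
by rewrite expfzDr // kl -expfzDr // subrr.
Qed.

(** Let j be the least index in w. Then L_j sees each F_j in w and no other
letter of w: an F_k with k.+1 = j does not occur. *)
Lemma lowering_wt_neq w : w != [::] -> exists i, lowering_wt i w != (mu i)%:Z.
Proof.
case: w => // j0 w0 _; set w := j0 :: w0.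
have [j jw jmin] : exists2 j, j \in w & forall k, k \in w -> (j <= k)%N.
  have [j jw jP] := @arg_minnP _ j0 (fun j => j \in w) (fun j => nat_of_ord j) (mem_head _ _).
  by exists j.
exists (lo j); rewrite /lowering_wt -subr_eq0 addrC addKr.
have hk k : k \in w -> - delta (lo j) k + delta (lo j) k.+1 = - (k == j)%:Z :> int.
  move=> /jmin jk; rewrite /delta /=.
  have -> : (nat_of_ord j == k.+1) = false by apply/negbTE; rewrite neq_ltn ltnS jk.
  by rewrite addr0 eq_sym.
rewrite big_seq (eq_bigr _ hk) -big_seq sumrN oppr_eq0 (perm_big _ (perm_to_rem jw)).
by rewrite big_cons eqxx; apply/lt0r_neq0/ltr_pwDl => //; exact: sumr_ge0.
Qed.

(** A vector of weight mu cannot be a combination of vectors of other weights.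
Subtracting from L_i x the multiple of x that cancels the first word leaves a
nonzero multiple of x, written with one word less. *)
Lemma weight_separation (x : V) (s : seq (K * seq 'I_p.-1)) :
    (forall i, r (UL i) x = q ^+ mu i *: x) ->
    all (fun cw => cw.2 != [::]) s -> x = \sum_(cw <- s) cw.1 *: lowering cw.2 ->
  x = 0.
Proof.
have [n] := ubnP (size s); elim: n s x => // n IH [|[c w] s] x sn Lx.
  by rewrite big_nil.
rewrite /= => /andP[w0 sa] xE.
have [i wi] := lowering_wt_neq w0.
set a := q ^ lowering_wt i w; set b := q ^ (mu i).
have ab : b - a != 0.
  by rewrite subr_eq0; apply: contraNneq wi => /q_inj ->.
have : (b - a) *: x = \sum_(cw <- [seq (cw.1 * (q ^ lowering_wt i cw.2 - a), cw.2)
     | cw <- s]) cw.1 *: lowering cw.2.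
  have := Lx i; rewrite {1}xE (rep_sumv rP) big_cons /= (repZv rP) L_lowering.
  rewrite -/a -[q ^+ mu i]/b scalerBl => <-; rewrite xE big_cons scalerDr !scalerA.
  rewrite [a * c]mulrC opprD addrACA subrr add0r big_map scaler_sumr -sumrB.
  apply: eq_bigr => cw _; rewrite (repZv rP) L_lowering !scalerA -scalerBl.
  by congr (_ *: _); rewrite mulrBr [a * _]mulrC.
move/IH => h; have /eqP : (b - a) *: x = 0.
  apply: h; rewrite ?size_map ?all_map //.
  by move=> k; rewrite (repZv rP) Lx !scalerA mulrC.
by rewrite scaler_eq0 (negPf ab) => /eqP.
Qed.

End HighestWeight.

(** Both modules are quotients of the same universal highest weight module. This
is seen in the submodule of V1 x V2 generated by (z1, z2): if a kills z1 but
not z2, some b * a sends (z1, z2) to (0, z2), which has the same weight as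
(z1, z2) without being a multiple of it, against [weight_separation]. *)
Lemma hw_annihilator (V1 V2 : lmodType K) (r1 : Uq -> V1 -> V1)
    (r2 : Uq -> V2 -> V2) (mu : 'I_p -> nat) (z1 : V1) (z2 : V2) (a : Uq) :
    (forall k : int, q ^ k = 1 -> k = 0) ->
    is_rep r1 -> is_rep r2 -> hw_vector r1 mu z1 -> hw_vector r2 mu z2 ->
    z1 != 0 -> z2 != 0 ->
    (r2 a z2 != 0 -> exists b, r2 b (r2 a z2) = z2) ->
  r1 a z1 = 0 -> r2 a z2 = 0.
Proof.
move=> q_gen r1P r2P z1P z2P z10 z20 simp az1.
apply/eqP; apply: contraT => /simp[b baz2].
pose r (c : Uq) (x : V1 * V2) := (r1 c x.1, r2 c x.2).
have rP : is_rep r.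
  split=> [c k x y|x k c d|x|c d x]; rewrite /r.
  - by rewrite (repZD r1P) (repZD r2P).
  - rewrite (repDl r1P) (repDl r2P) (repZl r1P) (repZl r2P); congr (_, _).
  - by rewrite (rep1 r1P) (rep1 r2P); case: x.
  - by rewrite (repM r1P) (repM r2P).
have zP : hw_vector r mu (z1, z2).
  split=> i; rewrite /r /= ?(hw_E z1P) ?(hw_E z2P) //.
  by rewrite (hw_L z1P) (hw_L z2P).
have [c [s [sa cE]]] := hw_vacuum_part rP zP (b * a).
have xE : (- c *: z1, (1 - c) *: z2) =
    \sum_(cw <- s) cw.1 *: lowering r (z1, z2) cw.2.
  have -> : (- c *: z1, (1 - c) *: z2) = r (b * a) (z1, z2) - c *: (z1, z2).
    rewrite /r /= (repM r1P) (repM r2P) az1 (rep0v r1P) baz2.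
    by congr (_, _); rewrite /= ?add0r ?scaleNr // scalerBl scale1r.
  by rewrite cE [c *: _ + _]addrC addrK.
have /(_ _)/pair_equal_spec[|/eqP + /eqP] := weight_separation rP zP q_gen _ sa xE.
  move=> i; rewrite /r /= (repZv r1P) (repZv r2P) (hw_L z1P) (hw_L z2P).
  by congr (_, _); rewrite /= !scalerA mulrC.
rewrite !scaler_eq0 (negPf z10) (negPf z20) !orbF oppr_eq0 => /eqP ->.
by rewrite subr0 oner_eq0.
Qed.

End QuantumGroupModules.

(** * The monomials of the braided exterior algebra *)

Section ExteriorBasis.
Variables (K : fieldType) (q : K) (N : nat).
Hypothesis q_neq0 : q != 0.
Local Notation Ext := (Ext q N).
Local Notation v := (gen (@Ext_rel K q N)).

Lemma ext_sq i : v i * v i = 0 :> Ext.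
Proof. by have := cls_rel (Ext_sq q i); rewrite !clsE. Qed.

Lemma ext_swap (i j : 'I_N) : (i < j)%N -> v j * v i = (- q)^-1 *: (v i * v j) :> Ext.
Proof.
move=> ij; have h : v i * v j = - q *: (v j * v i) :> Ext.
  by have := cls_rel (Ext_swap q ij); rewrite !clsE.
by rewrite h scalerA mulVf ?scale1r // oppr_eq0.
Qed.

Let ltI (i j : 'I_N) := (i < j)%N.

Definition ordered_prod (s : seq 'I_N) : Ext := \prod_(i <- s) v i.

(** Insertion of v_i into an ordered monomial, a repeated factor giving 0. *)
Lemma ext_insert i s : sorted ltI s -> exists c s',
  [/\ sorted ltI s', {subset s' <= i :: s} & v i * ordered_prod s = c *: ordered_prod s'].
Proof.
have trI : transitive ltI by move=> x y z; exact: ltn_trans.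
elim: s => [|k s IH] /=.
  by exists 1, [:: i]; split=> //; rewrite /ordered_prod big_nil big_seq1 mulr1 scale1r.
move=> ks; have ss := path_sorted ks.
have kmin : all (ltI k) s by exact: order_path_min ks.
rewrite /ordered_prod big_cons mulrA; case: (ltngtP i k) => ik.
- exists 1, (i :: k :: s); split=> //=; first by rewrite {1}/ltI ik.
  by rewrite /ordered_prod !big_cons scale1r mulrA.
- have [c [s' [s's s'sub s'E]]] := IH ss.
  exists ((- q)^-1 * c), (k :: s'); split.
  + rewrite /= path_sortedE // s's andbT; apply/allP=> x /s'sub.
    by rewrite inE => /orP[/eqP ->//|/(allP kmin)].
  + move=> x; rewrite !inE => /orP[->|/s'sub]; first by rewrite orbT.
    by rewrite inE => /orP[->//|->]; rewrite !orbT.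
  + rewrite (ext_swap ik) -palg_scaleAl -mulrA -[\prod_(j <- s) v j]/(ordered_prod s).
    by rewrite s'E -palg_scaleAr scalerA /ordered_prod big_cons.
- exists 0, [::]; split=> //; rewrite (val_inj ik) ext_sq mul0r scale0r //.
Qed.

Lemma sorted_enum (S : {set 'I_N}) : sorted ltI (enum S).
Proof.
apply: sorted_filter; first by move=> x y z; exact: ltn_trans.
by have := iota_ltn_sorted 0 N; rewrite -val_enum_ord sorted_map enumT.
Qed.

Definition ind (S : {set 'I_N}) (i : 'I_N) : int := (i \in S : nat)%:Z.

Lemma in_cube_ind S : in_cube (ind S).
Proof. by apply/forallP=> i; rewrite /ind; case: (i \in S). Qed.

Definition ebasis (S : {set 'I_N}) : Ext := vmon q (ind S).

Lemma ebasis_enum S : ebasis S = ordered_prod (enum S).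
Proof.
rewrite /ebasis /vmon in_cube_ind /ordered_prod.
rewrite big_filter [index_enum _]unlock [RHS]big_mkcond /=; apply: eq_bigr => i _.
by rewrite /ind; case: (i \in S).
Qed.

Lemma ebasis0 : ebasis finset.set0 = 1.
Proof. by rewrite ebasis_enum enum_set0 /ordered_prod big_nil. Qed.

Lemma ordered_prod_ebasis s : sorted ltI s -> ordered_prod s = ebasis [set x in s]%SET.
Proof.
move=> ss; rewrite ebasis_enum; congr ordered_prod.
apply: (@irr_sorted_eq _ ltI) => //.
- by move=> x y z; exact: ltn_trans.
- by move=> x; rewrite /ltI ltnn.
- exact: sorted_enum.
- by move=> x; rewrite mem_enum inE.
Qed.

Lemma ext_span x : exists c : {set 'I_N} -> K, x = \sum_S c S *: ebasis S.
Proof.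
pose T x := exists c : {set 'I_N} -> K, x = \sum_S c S *: ebasis S.
have TD y z : T y -> T z -> T (y + z).
  move=> [c ->] [d ->]; exists (fun S => c S + d S); rewrite -big_split.
  by apply: eq_bigr => S _; rewrite scalerDl.
have TZ c y : T y -> T (c *: y).
  move=> [d ->]; exists (fun S => c * d S); rewrite scaler_sumr.
  by apply: eq_bigr => S _; rewrite scalerA.
have T0 : T 0 by exists (fun=> 0); rewrite big1 // => S _; rewrite scale0r.
have Te S : T (ebasis S).
  exists (fun S' => (S' == S)%:R); rewrite (bigD1 S) //= eqxx scale1r big1 ?addr0 //.
  by move=> S' /negPf ->; rewrite scale0r.
have Tv i y : T y -> T (v i * y).
  move=> [c ->]; rewrite mulr_sumr; apply: (big_ind T) => // S _.
  rewrite -palg_scaleAr; apply: (TZ); rewrite ebasis_enum.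
  have [d [s [ss _ ->]]] := ext_insert i (sorted_enum S).
  by apply: TZ; rewrite ordered_prod_ebasis.
suff h : forall y, T y -> T (x * y) by rewrite -[x]mulr1; apply: h; rewrite -ebasis0.
elim/palg_ind: x => [i||c a IH|a b IHa IHb|a b IHa IHb] y Ty.
- exact: Tv.
- by rewrite mul1r.
- by rewrite -palg_scaleAl; apply: TZ; exact: IH.
- by rewrite mulrDl; apply: TD; [exact: IHa|exact: IHb].
- by rewrite -mulrA; apply: IHa; exact: IHb.
Qed.

(** The relations are homogeneous of positive degree, so the constant term of an
expression depends only on its class. This is what shows that the algebra is
not zero. *)
Fixpoint augmentation (t : term K 'I_N) : K :=
  match t with
  | Gen _ => 0 | Cst c => c
  | Add x y => augmentation x + augmentation y
  | Mul x y => augmentation x * augmentation y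
  end.

Lemma augmentation_congr x y :
  congr (@Ext_rel K q N) x y -> augmentation x = augmentation y.
Proof.
elim=> //=; try by move=> *; congruence.
  by move=> ? ? [i|i j _] /=; ring.
all: by move=> *; ring.
Qed.

Lemma ext_1_neq0 : (1 : Ext) != 0.
Proof.
apply/eqP=> h; have : cls (@Ext_rel K q N) (Cst 1) = cls (@Ext_rel K q N) (Cst 0) by [].
by move=> /eq_cls /augmentation_congr /= /eqP; rewrite oner_eq0.
Qed.

End ExteriorBasis.

(** * Fock space in coordinates *)

Section Fock.
Variables (K : fieldType) (q : K) (N : nat).
Hypothesis q_neq0 : q != 0.
Variable act : Clq q N -> Ext q N -> Ext q N.
Hypothesis actP : is_fock_action act.
Let actR : is_rep act. Proof. by case: actP. Qed.
Local Notation e := (@ebasis K q N).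
Local Notation I := {set 'I_N}.
Local Notation D := #|{: {set 'I_N}}|.

Definition below (S : I) (j : 'I_N) : nat := \sum_(k < N | (k < j)%N) (k \in S).

Lemma below_setD1 S j : below (S :\ j) j = below S j.
Proof.
apply: eq_bigr => k kj; rewrite in_setD1; case: eqP => // kE.
by rewrite kE ltnn in kj.
Qed.

Lemma below_setU1 S j : below (j |: S) j = below S j.
Proof.
apply: eq_bigr => k kj; rewrite in_setU1; case: eqP => // kE.
by rewrite kE ltnn in kj.
Qed.

Lemma sgn_ind S j : sgn K (ind S) j = (-1) ^+ below S j.
Proof.
rewrite /sgn -[RHS]/((-1) ^ (below S j)); congr (_ ^ _).
by rewrite /below (big_morph Posz PoszD (erefl _)).
Qed.

Lemma act_psi S j : act (psi q j) (e S) =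
  if j \in S then (-1) ^+ below S j *: e (S :\ j) else 0.
Proof.
case: actP => _ /(_ _ (in_cube_ind S) j)[-> _ _]; rewrite sgn_ind.
case: ifP => jS.
  congr (_ *: vmon q _); apply/funext => k; rewrite /ind /delta in_setD1.
  rewrite -[nat_of_ord k == j]/(k == j).
  by case: eqP => [->|_]; rewrite ?jS ?subrr ?subr0.
rewrite /vmon ifF ?scaler0 //; apply/negbTE/forallPn; exists j.
by rewrite /ind jS /delta eqxx.
Qed.

Lemma act_psid S j : act (psid q j) (e S) =
  if j \in S then 0 else (-1) ^+ below S j *: e (j |: S).
Proof.
case: actP => _ /(_ _ (in_cube_ind S) j)[_ -> _]; rewrite sgn_ind.
case: ifP => jS.
  rewrite /vmon ifF ?scaler0 //; apply/negbTE/forallPn; exists j.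
  by rewrite /ind jS /delta eqxx.
congr (_ *: vmon q _); apply/funext => k; rewrite /ind /delta in_setU1.
rewrite -[nat_of_ord k == j]/(k == j).
by case: eqP => [->|_]; rewrite ?jS ?addr0.
Qed.

Lemma act_omega S j : act (omega q j) (e S) = q ^ (- ind S j) *: e S.
Proof. by case: actP => _ /(_ _ (in_cube_ind S) j)[_ _ ->]. Qed.

Lemma scale_signK (n : nat) (V : lmodType K) (x : V) : (-1) ^+ n *: ((-1) ^+ n *: x) = x.
Proof. by rewrite scalerA -expr2 -exprM mulnC exprM sqrrN expr1n expr1n scale1r. Qed.

(** The two products are complementary projections, to the monomials that contain
v_j and to those that do not; [number T j] selects the one that T satisfies. *)
Definition number (T : I) j : Clq q N :=
  if j \in T then psid q j * psi q j else psi q j * psid q j.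

Lemma act_number T S j :
  act (number T j) (e S) = ((j \in S) == (j \in T))%:R *: e S.
Proof.
rewrite /number; case: ifP => jT; rewrite (repM actR) ?act_psi ?act_psid.
  case: ifP => jS; last by rewrite (rep0v actR) scale0r.
  rewrite (repZv actR) act_psid finset.setD11 below_setD1 scale_signK finset.setD1K //.
  by rewrite scale1r.
case: ifP => jS; first by rewrite (rep0v actR) scale0r.
by rewrite (repZv actR) act_psi finset.setU11 below_setU1 scale_signK finset.setU1K ?jS // scale1r.
Qed.

(** The operators psi_j with j in S lead from e S down to 1. *)
Lemma ebasis_neq0 S : e S != 0.
Proof.
have [n] := ubnP #|S|; elim: n S => // n IHn S.
have [->|/finset.set0Pn[j jS]] := eqVneq S finset.set0.
  by rewrite ebasis0 ext_1_neq0.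
rewrite (cardsD1 j) jS ltnS => /IHn; apply: contraNneq => e0.
have /esym := act_psi S j; rewrite e0 (rep0v actR) jS.
move=> /(congr1 (fun x => (-1) ^+ below S j *: x)).
by rewrite scale_signK scaler0 => ->.
Qed.

(** The product over j of the operators [number T j] is the projection to the
line of e T. *)
Lemma ebasis_free (c : I -> K) : \sum_S c S *: e S = 0 -> forall S, c S = 0.
Proof.
move=> c0 T.
pose r := \prod_(j <- enum 'I_N) number T j.
have rE S : act r (e S) = (S == T)%:R *: e S.
  have -> : (S == T) = all (fun j => (j \in S) == (j \in T)) (enum 'I_N).
    apply/eqP/allP => [-> j _|h]; first exact: eqxx.
    by apply/setP=> j; apply/eqP/h; rewrite mem_enum.
  rewrite /r; elim: (enum 'I_N) => [|j s IH].
    by rewrite big_nil (rep1 actR) scale1r.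
  rewrite big_cons (repM actR) IH (repZv actR) act_number scalerA /=.
  by rewrite -natrM mulnb andbC.
have := congr1 (act r) c0; rewrite (rep_sumv actR) (rep0v actR).
rewrite (bigD1 T) //= big1 => [|S /negPf ST].
  rewrite addr0 (repZv actR) rE eqxx scale1r => /eqP.
  by rewrite scaler_eq0 (negPf (ebasis_neq0 T)) orbF => /eqP.
by rewrite (repZv actR) rE ST scale0r scaler0.
Qed.

(** Coordinate vectors are indexed by the ranks of the subsets of 'I_N. *)
Definition fvec (x : 'cV[K]_D) : Ext q N := \sum_S x (enum_rank S) 0 *: e S.

Lemma fvec_linear : linear fvec.
Proof.
move=> c x y; rewrite /fvec scaler_sumr -big_split.
by apply: eq_bigr => S _; rewrite !mxE scalerDl scalerA.
Qed.

HB.instance Definition _ :=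
  GRing.isLinear.Build K 'cV[K]_D (Ext q N) _ fvec fvec_linear.

Lemma fvec_inj : injective fvec.
Proof.
move=> x y /eqP; rewrite -subr_eq0 -linearB => /eqP/ebasis_free h.
apply/eqP; rewrite -subr_eq0; apply/eqP/matrixP=> i j.
by rewrite ord1 -[ i ]enum_valK h mxE.
Qed.

Lemma fvec_surj y : exists x, fvec x = y.
Proof.
have [c ->] := ext_span q_neq0 y.
exists (\col_i c (enum_val i)); apply: eq_bigr => S _.
by rewrite mxE enum_rankK.
Qed.

Definition bvec (S : I) : 'cV[K]_D := delta_mx (enum_rank S) 0.

Lemma bvecE S T : bvec S (enum_rank T) 0 = (T == S)%:R.
Proof. by rewrite mxE eqxx andbT (inj_eq enum_rank_inj). Qed.

Lemma fvec_bvec S : fvec (bvec S) = e S.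
Proof.
rewrite /fvec (bigD1 S) //= bvecE eqxx scale1r big1 ?addr0 // => T /negPf TS.
by rewrite bvecE TS scale0r.
Qed.

Lemma bvec_expand (x : 'cV[K]_D) : x = \sum_S x (enum_rank S) 0 *: bvec S.
Proof.
apply/matrixP=> i j; rewrite ord1 summxE (bigD1 (enum_val i)) //= enum_valK big1.
  by rewrite addr0 !mxE enum_valK !eqxx mulr1.
move=> S Si; rewrite !mxE eqxx andbT (_ : (i == enum_rank S) = false) ?mulr0 //.
by apply: contraNF Si => /eqP ->; rewrite enum_rankK.
Qed.

Lemma bvec_ext (a b : 'M[K]_D) : (forall S, a *m bvec S = b *m bvec S) -> a = b.
Proof.
move=> ab; apply: mulmx_ext => x; rewrite (bvec_expand x) !mulmx_sumr.
by apply: eq_bigr => S _; rewrite -!scalemxAr ab.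
Qed.

Lemma fvec_op_matrix (f : Ext q N -> Ext q N) : linear f ->
  exists a : 'M[K]_D, forall x, fvec (a *m x) = f (fvec x).
Proof.
move=> flin.
have /choice [g gP] : forall S, exists x, fvec x = f (e S).
  by move=> S; exact: fvec_surj.
have f0 : f 0 = 0.
  apply: (addrI (f 0)); rewrite addr0 -{1}[f 0]scale1r -flin.
  by rewrite scaler0 addr0.
exists (\matrix_(i, j) g (enum_val j) i 0) => x.
rewrite {1}[x]bvec_expand mulmx_sumr linear_sum /fvec.
rewrite (big_morph f (id1 := 0) (op1 := +%R)) //; last first.
  by move=> y z; rewrite -{1}[y]scale1r flin scale1r.
apply: eq_bigr => S _; rewrite -scalemxAr linearZ /=.
have -> : f (x (enum_rank S) 0 *: e S) = x (enum_rank S) 0 *: f (e S).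
  by rewrite -[_ *: e S]addr0 flin f0 addr0.
congr (_ *: _); rewrite -gP; congr fvec; apply/matrixP=> i j.
by rewrite ord1 -colE !mxE enum_rankK.
Qed.

Lemma fock_exists : exists fk : Clq q N -> 'M[K]_D,
  forall a x, fvec (fk a *m x) = act a (fvec x).
Proof.
suff /choice[fk fkP] : forall a, exists m : 'M[K]_D, forall x,
    fvec (m *m x) = act a (fvec x) by exists fk.
by move=> a; apply: fvec_op_matrix; case: actR.
Qed.

Definition fock := projT1 (cid fock_exists).

Lemma fockE a x : fvec (fock a *m x) = act a (fvec x).
Proof. by rewrite /fock; case: cid. Qed.

Lemma fock1 : fock 1 = 1%:M.
Proof.
apply: mulmx_ext => x; apply: fvec_inj.
by rewrite fockE (rep1 actR) mul1mx.
Qed.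

Lemma fockM a b : fock (a * b) = fock a *m fock b.
Proof.
apply: mulmx_ext => x; apply: fvec_inj.
by rewrite fockE (repM actR) -mulmxA !fockE.
Qed.

Lemma fockD a b : fock (a + b) = fock a + fock b.
Proof.
apply: mulmx_ext => x; apply: fvec_inj.
by rewrite fockE (repDl actR) mulmxDl linearD /= !fockE.
Qed.

Lemma fockZ c a : fock (c *: a) = c *: fock a.
Proof.
apply: mulmx_ext => x; apply: fvec_inj.
by rewrite fockE (repZl actR) -scalemxAl linearZ /= !fockE.
Qed.

Lemma fock0 : fock 0 = 0.
Proof. by rewrite -[0 in LHS](scale0r (0 : Clq q N)) fockZ scale0r. Qed.

Lemma fock_sum (J : Type) (r : seq J) (P : pred J) (f : J -> Clq q N) :
  fock (\sum_(i <- r | P i) f i) = \sum_(i <- r | P i) fock (f i).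
Proof. by rewrite (big_morph fock fockD fock0). Qed.

Lemma psi_bvec S j : fock (psi q j) *m bvec S =
  if j \in S then (-1) ^+ below S j *: bvec (S :\ j) else 0.
Proof.
apply: fvec_inj; rewrite fockE fvec_bvec act_psi.
by case: ifP => _; rewrite ?linear0 // linearZ /= fvec_bvec.
Qed.

Lemma psid_bvec S j : fock (psid q j) *m bvec S =
  if j \in S then 0 else (-1) ^+ below S j *: bvec (j |: S).
Proof.
apply: fvec_inj; rewrite fockE fvec_bvec act_psid.
by case: ifP => _; rewrite ?linear0 // linearZ /= fvec_bvec.
Qed.

(** The monomial in the omega's with exponents g; omega_j acts on e S by q^-1 when
j is in S. *)
Definition omega_mx (g : 'I_N -> int) : 'M[K]_D :=
  diag_mx (\row_(k < D) q ^ (- \sum_(x in (enum_val k : I)) g x)).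

Local Notation om := omega_mx.

Lemma om_bvec g S : om g *m bvec S = q ^ (- \sum_(x in S) g x) *: bvec S.
Proof.
rewrite /omega_mx /bvec mul_diag_mx; apply/matrixP=> i j; rewrite !mxE ord1 eqxx andbT.
by case: eqP => [->|_]; rewrite ?enum_rankK // !mulr0.
Qed.

Lemma om0 : om (fun=> 0) = 1%:M.
Proof.
apply: bvec_ext => S; rewrite om_bvec mul1mx big1 // oppr0 expr0z scale1r //.
Qed.

Lemma omD g h : om g *m om h = om (fun x => g x + h x).
Proof.
apply: bvec_ext => S; rewrite -mulmxA !om_bvec -scalemxAr om_bvec scalerA -expfzDr //.
by rewrite -opprD big_split addrC.
Qed.

Lemma om_tr g : (om g)^T = om g.
Proof. exact: tr_diag_mx. Qed.

Lemma eq_om g h : g =1 h -> om g = om h.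
Proof. by move=> gh; congr om; apply/funext. Qed.

Lemma omC g h : om g *m om h = om h *m om g.
Proof. by rewrite !omD; apply: eq_om => x; rewrite addrC. Qed.

Definition dlt (j : 'I_N) (x : 'I_N) : int := (x == j)%:Z.

Lemma sum_dlt (S : I) j : \sum_(x in S) dlt j x = (j \in S)%:Z.
Proof.
have [jS|jS] := boolP (j \in S).
  rewrite (bigD1 j) //= /dlt eqxx big1 // => x /andP[_ /negPf ->] //.
rewrite big1 // => x xS; rewrite /dlt; case: eqP => // xj.
by rewrite -xj xS in jS.
Qed.

Lemma fock_omega j : fock (omega q j) = om (dlt j).
Proof.
apply: bvec_ext => S; apply: fvec_inj.
by rewrite fockE fvec_bvec act_omega om_bvec sum_dlt linearZ /= fvec_bvec.
Qed.

Lemma fock_omegainv j : fock (omegainv q j) = om (fun x => - dlt j x).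
Proof.
have h : omegainv q j * omega q j = 1.
  by have := cls_rel (Clq_winvw q j); rewrite !clsE.
have : fock (omegainv q j) *m om (dlt j) = 1%:M by rewrite -fock_omega -fockM h fock1.
move=> /(congr1 (fun a => a *m om (fun x => - dlt j x))); rewrite -mulmxA omD mul1mx.
rewrite (_ : om _ = 1%:M) ?mulmx1 //; rewrite -om0; apply: eq_om => x.
by rewrite subrr.
Qed.

Lemma om_psi g j : om g *m fock (psi q j) = q ^ g j *: (fock (psi q j) *m om g).
Proof.
apply: bvec_ext => S; rewrite -scalemxAl -!mulmxA om_bvec -scalemxAr psi_bvec.
case: ifP => jS; last by rewrite mulmx0 !scaler0.
rewrite -scalemxAr om_bvec !scalerA -expfzDr // [in RHS](big_setD1 j jS) /=.
by rewrite opprD addrA subrr add0r mulrC.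
Qed.

Lemma om_psid g j :
  om g *m fock (psid q j) = q ^ (- g j) *: (fock (psid q j) *m om g).
Proof.
apply: bvec_ext => S; rewrite -scalemxAl -!mulmxA om_bvec -scalemxAr psid_bvec.
case: ifP => jS; first by rewrite mulmx0 !scaler0.
rewrite -scalemxAr om_bvec !scalerA -expfzDr // big_setU1 ?jS //=.
by rewrite opprD mulrC.
Qed.

(** The image of psi_j is spanned by the monomials without v_j, on which omega_j
acts trivially. *)
Lemma om_psi_local g h j : (forall x, x != j -> g x = h x) ->
  om g *m fock (psi q j) = om h *m fock (psi q j).
Proof.
move=> gh; apply: bvec_ext => S; rewrite -!mulmxA psi_bvec.
case: ifP => jS; rewrite ?mulmx0 // -!scalemxAr !om_bvec.
congr (_ *: (q ^ (- _) *: _)); apply: eq_bigr => x.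
by rewrite in_setD1 => /andP[/gh].
Qed.

Lemma psid_om_local g h j : (forall x, x != j -> g x = h x) ->
  fock (psid q j) *m om g = fock (psid q j) *m om h.
Proof.
move=> gh; apply: bvec_ext => S; rewrite -!mulmxA !om_bvec -!scalemxAr psid_bvec.
case: ifP => jS; rewrite ?scaler0 //.
congr (q ^ (- _) *: _); apply: eq_bigr => x xS.
by apply: gh; apply: contraFN jS => /eqP <-.
Qed.

Lemma psi_psi i j : fock (psi q i) *m fock (psi q j) = - (fock (psi q j) *m fock (psi q i)).
Proof.
have h : psi q i * psi q j + psi q j * psi q i = 0.
  by have := cls_rel (Clq_pp q i j); rewrite !clsE.
by apply/eqP; rewrite -addr_eq0 -!fockM -fockD h fock0.
Qed.

Lemma psid_psid i j : fock (psid q i) *m fock (psid q j) =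
  - (fock (psid q j) *m fock (psid q i)).
Proof.
have h : psid q i * psid q j + psid q j * psid q i = 0.
  by have := cls_rel (Clq_dd q i j); rewrite !clsE.
by apply/eqP; rewrite -addr_eq0 -!fockM -fockD h fock0.
Qed.

Lemma psi_psid_omega j : fock (psi q j) *m fock (psid q j) +
  q *: (fock (psid q j) *m fock (psi q j)) = om (fun x => - dlt j x).
Proof.
have h : psi q j * psid q j + q *: (psid q j * psi q j) = omegainv q j.
  by have := cls_rel (Clq_pdq q j); rewrite !clsE.
by rewrite -fock_omegainv -h fockD fockZ !fockM.
Qed.

Lemma psi_psid_omegainv j : fock (psi q j) *m fock (psid q j) +
  q^-1 *: (fock (psid q j) *m fock (psi q j)) = om (dlt j).
Proof.
have h : psi q j * psid q j + q^-1 *: (psid q j * psi q j) = omega q j.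
  by have := cls_rel (Clq_pdqinv q j); rewrite !clsE.
by rewrite -fock_omega -h fockD fockZ !fockM.
Qed.

Lemma psi_sq j : fock (psi q j) *m fock (psi q j) = 0.
Proof.
apply: bvec_ext => S; rewrite -mulmxA psi_bvec mul0mx; case: ifP => jS.
  by rewrite -scalemxAr psi_bvec finset.setD11 scaler0.
by rewrite mulmx0.
Qed.

Lemma psid_sq j : fock (psid q j) *m fock (psid q j) = 0.
Proof.
apply: bvec_ext => S; rewrite -mulmxA psid_bvec mul0mx; case: ifP => jS.
  by rewrite mulmx0.
by rewrite -scalemxAr psid_bvec finset.setU11 scaler0.
Qed.

Lemma psi_psid i j : fock (psi q i) *m fock (psid q j) =
  (i == j)%:R *: 1%:M - fock (psid q j) *m fock (psi q i).
Proof.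
case: eqP => [->|/eqP ij]; last first.
  have h : psi q i * psid q j + psid q j * psi q i = 0.
    by have := cls_rel (Clq_pd q ij); rewrite !clsE.
  by rewrite scale0r add0r; apply/eqP; rewrite -addr_eq0 -!fockM -fockD h fock0.
apply: bvec_ext => S; rewrite scale1r mulmxBl mul1mx -!mulmxA.
rewrite psi_bvec psid_bvec; case: ifP => jS.
  by rewrite mulmx0 -scalemxAr psid_bvec finset.setD11 below_setD1 scale_signK finset.setD1K ?subrr.
rewrite mulmx0 -scalemxAr psi_bvec finset.setU11 below_setU1 scale_signK.
by rewrite finset.setU1K ?jS ?subr0.
Qed.

(** The signs of the two actions agree: both count the elements of the set below
j, and neither count changes when j is added or removed. *)
Lemma psi_tr j : (fock (psi q j))^T = fock (psid q j).
Proof.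
have mxb (a : 'M[K]_D) S T : a (enum_rank T) (enum_rank S) = (a *m bvec S) (enum_rank T) 0.
  by rewrite -colE mxE.
apply/matrixP=> s t; rewrite -[s]enum_valK -[t]enum_valK mxE.
move: (enum_val s) (enum_val t) => S T; rewrite !mxb psi_bvec psid_bvec.
have [jS|jS] := boolP (j \in S); have [jT|jT] := boolP (j \in T); rewrite !mxE //.
- rewrite eqxx !(inj_eq enum_rank_inj) andbT.
  by case: eqP => [E|_]; [rewrite E finset.setD11 in jT|rewrite mulr0].
- rewrite eqxx !(inj_eq enum_rank_inj) !andbT; have [->|ne] := eqVneq T (S :\ j).
    by rewrite below_setD1 finset.setD1K // eqxx.
  rewrite mulr0; case: eqP => [E|_]; last by rewrite mulr0.
  by rewrite E finset.setU1K ?eqxx // in ne.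
- rewrite !eqxx !(inj_eq enum_rank_inj) !andbT; case: eqP => [E|_]; last by rewrite mulr0.
  by rewrite E finset.setU11 in jS.
Qed.

End Fock.

(** * Quadratic elements of the quantum Clifford algebra *)

Section HopOperators.
Variables (K : fieldType) (q : K) (n m : nat).
Hypothesis q_neq0 : q != 0.
Local Notation N := (n * m)%N.
Variable act : Clq q N -> Ext q N -> Ext q N.
Hypothesis actP : is_fock_action act.
Local Notation D := #|{: {set 'I_N}}|.
Local Notation fk := (fock q_neq0 actP).
Local Notation P x := (fk (psi q x)).
Local Notation Dg x := (fk (psid q x)).
Local Notation om := (@omega_mx K q N).

(** A hop moves a particle from the cell y to the cell x. *)
Definition hop_mx (x y : 'I_N) : 'M[K]_D := Dg x *m P y.

Local Notation hop := hop_mx.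

Lemma hop_tr x y : (hop x y)^T = hop y x.
Proof. by rewrite /hop_mx trmx_mul psi_tr -(psi_tr q_neq0 actP x) trmxK. Qed.

Lemma hop_mul x y z t :
  hop x y *m hop z t = (y == z)%:R *: hop x t - Dg x *m Dg z *m P y *m P t.
Proof.
rewrite /hop_mx mulmxA -(mulmxA _ (P y)) psi_psid mulmxBr mulmxBl.
by rewrite -scalemxAr mulmx1 -scalemxAl !mulmxA.
Qed.

(** On Fock space the hops satisfy the relations of matrix units in gl_N. *)
Lemma hop_comm x y z t : hop x y *m hop z t - hop z t *m hop x y =
  (y == z)%:R *: hop x t - (x == t)%:R *: hop z y.
Proof.
have e : Dg z *m Dg x *m P t *m P y = Dg x *m Dg z *m P y *m P t.
  rewrite (psid_psid q_neq0 actP z x) -mulmxA (psi_psi q_neq0 actP t y).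
  by rewrite mulNmx mulmxN opprK !mulmxA.
by rewrite !hop_mul [t == x]eq_sym e opprB addrA subrK.
Qed.

Lemma hop_same_l x y t : y != x -> hop x y *m hop x t = 0.
Proof. by move=> /negPf yx; rewrite hop_mul yx scale0r psid_sq !mul0mx subr0. Qed.

Lemma hop_same_r x y z : y != z -> hop x y *m hop z y = 0.
Proof.
by move=> /negPf yz; rewrite hop_mul yz scale0r -mulmxA psi_sq mulmx0 subr0.
Qed.

Lemma om_hop g x y : om g *m hop x y = q ^ (g y - g x) *: (hop x y *m om g).
Proof.
rewrite /hop_mx mulmxA om_psid // -scalemxAl -(mulmxA _ (om g)) om_psi // -scalemxAr.
by rewrite scalerA mulmxA -expfzDr // addrC.
Qed.

Lemma om_hopC g x y : g x = g y -> om g *m hop x y = hop x y *m om g.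
Proof. by move=> gxy; rewrite om_hop gxy subrr scale1r. Qed.

(** The monomial acts before the hop, on sets of cells that contain y and not x:
there the exponent at x is irrelevant and that at y amounts to a power of q. *)
Lemma hop_om_local g h x y : (forall z, z != x -> z != y -> g z = h z) ->
  q ^ g y *: (hop x y *m om g) = q ^ h y *: (hop x y *m om h).
Proof.
move=> gh.
have step f : q ^ f y *: (hop x y *m om f) = Dg x *m om f *m P y.
  by rewrite -[in RHS]mulmxA om_psi // -scalemxAr mulmxA.
rewrite !step; pose k z := if z == x then g z else h z.
rewrite -mulmxA (om_psi_local q_neq0 actP (h := k)) => [|z zy].
  rewrite mulmxA; congr (_ *m _); apply: psid_om_local => // z zx.
  by rewrite /k (negPf zx).
by rewrite /k; case: eqP => // /eqP zx; exact: gh.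
Qed.

(** Particles that pass through the cell x: the two orders of hopping require x to
be full and empty respectively, and the q-commutator produces omega_x^-1. *)
Lemma hop_pass_out x y z : x != y -> x != z -> y != z ->
  q *: (hop x y *m hop z x) - hop z x *m hop x y =
  - (hop z y *m om (fun t => - dlt x t)).
Proof.
move=> xy xz yz; have zx : z != x by rewrite eq_sym.
have h1 : hop x y *m hop z x = - (Dg x *m P x) *m hop z y.
  rewrite hop_mul (negPf yz) scale0r sub0r mulNmx; congr (- _).
  rewrite /hop_mx [RHS]mulmxA -[in RHS](mulmxA (Dg x)) psi_psid (negPf xz).
  by rewrite scale0r sub0r mulmxN mulNmx -mulmxA psi_psi mulmxN !mulmxA.
have h2 : hop z x *m hop x y = P x *m Dg x *m hop z y.
  rewrite /hop_mx !mulmxA -(mulmxA (P x)) psid_psid mulmxN mulNmx !mulmxA.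
  rewrite (psi_psid q_neq0 actP x z) (negPf xz) scale0r sub0r !mulNmx opprK.
  by [].
rewrite h1 h2 mulNmx scalerN -opprD scalemxAl -mulmxDl addrC psi_psid_omega.
by rewrite om_hopC // /dlt (negPf zx) eq_sym (negPf xy).
Qed.

Lemma hop_pass_in x y t : x != y -> x != t -> y != t ->
  hop x y *m hop y t - q^-1 *: (hop y t *m hop x y) = hop x t *m om (dlt y).
Proof.
move=> xy xt yt; have yx : y != x by rewrite eq_sym.
have h1 : hop x y *m hop y t = P y *m Dg y *m hop x t.
  rewrite /hop_mx -!mulmxA [Dg y *m (Dg x *m _)]mulmxA psid_psid !mulmxA.
  rewrite mulmxN !mulNmx mulmxA psi_psid (negPf yx) scale0r sub0r.
  by rewrite !mulNmx opprK.
have h2 : hop y t *m hop x y = - (Dg y *m P y *m hop x t).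
  rewrite hop_mul (eq_sym t) (negPf xt) scale0r sub0r; congr (- _).
  rewrite /hop_mx [RHS]mulmxA -[in RHS](mulmxA (Dg y)) psi_psid (negPf yx).
  by rewrite scale0r sub0r mulmxN mulNmx -mulmxA psi_psi mulmxN !mulmxA.
rewrite h1 h2 scalerN opprK scalemxAl -mulmxDl psi_psid_omegainv.
by rewrite om_hopC // /dlt (negPf xy) eq_sym (negPf yt).
Qed.
End HopOperators.

(** * The two families of raising operators commute *)

Section CommutingActions.
Variables (K : fieldType) (q : K) (n m : nat).
Hypothesis q_neq0 : q != 0.
Local Notation N := (n * m)%N.
Variable act : Clq q N -> Ext q N -> Ext q N.
Hypothesis actP : is_fock_action act.
Local Notation D := #|{: {set 'I_N}}|.
Local Notation om := (@omega_mx K q N).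
Local Notation hop := (hop_mx q_neq0 actP).
Local Notation ix := (@ix n m).

Definition row_of (x : 'I_N) : nat := (x %% n)%N.
Definition col_of (x : 'I_N) : nat := (x %/ n)%N.

Lemma row_ix (i : 'I_n) j : row_of (ix i j) = i.
Proof. by rewrite /row_of /= addnC modnMDl modn_small. Qed.

Lemma col_ix (i : 'I_n) j : col_of (ix i j) = j.
Proof.
have n0 : (0 < n)%N by apply: leq_ltn_trans (ltn_ord i).
by rewrite /col_of /= addnC divnMDl // divn_small // addn0.
Qed.

Definition ixE := (row_ix, col_ix).

Lemma eq_ix x i j : (x == ix i j) = (row_of x == i) && (col_of x == j).
Proof.
apply/eqP/andP => [->|[/eqP xi /eqP xj]]; first by rewrite !ixE.
by apply: val_inj; rewrite /= -xi -xj addnC -divn_eq.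
Qed.

Definition row_gap (i : nat) (x : 'I_N) : int := (row_of x == i.+1)%:Z - (row_of x == i)%:Z.
Definition col_gap (j : nat) (x : 'I_N) : int := (col_of x == j.+1)%:Z - (col_of x == j)%:Z.

(** The exponents of the factors kappa_{i,>a} in lambda (E_i) and kappa_{<b,j} in
rho (E_j). *)
Definition row_wt i a x : int := (a < col_of x)%N%:Z * row_gap i x.
Definition col_wt j b x : int := (row_of x < b)%N%:Z * col_gap j x.

(** The operators lambda (E_i) and rho (E_j). In the former the factors
q^-1 omega^-1 and psi^dagger of each term reduce to psi^dagger on Fock
space. *)
Definition lamE (i : 'I_n.-1) : 'M[K]_D :=
  \sum_(a < m) hop (ix (lo i) a) (ix (hi i) a) *m om (row_wt i a).
Definition rhoE (j : 'I_m.-1) : 'M[K]_D :=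
  \sum_(b < n) hop (ix b (lo j)) (ix b (hi j)) *m om (col_wt j b).

Lemma rhoE_tr j :
  (rhoE j)^T = \sum_(b < n) hop (ix b (hi j)) (ix b (lo j)) *m om (col_wt j b).
Proof.
rewrite /rhoE linear_sum; apply: eq_bigr => b _ /=.
rewrite trmx_mul om_tr hop_tr om_hopC // /col_wt !ixE ltnn !mul0r //.
Qed.

Lemma hop_om_comm x y z t g h :
  (hop x y *m om g) *m (hop z t *m om h) - (hop z t *m om h) *m (hop x y *m om g) =
  (q ^ (g t - g z) *: (hop x y *m hop z t) - q ^ (h y - h x) *: (hop z t *m hop x y))
    *m om (fun c => g c + h c).
Proof.
have step x' y' z' t' g' h' : (hop x' y' *m om g') *m (hop z' t' *m om h') =
   q ^ (g' t' - g' z') *: (hop x' y' *m hop z' t') *m om (fun c => g' c + h' c).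
  rewrite -[LHS]mulmxA (mulmxA (om g')) om_hop // -[in LHS]scalemxAl.
  by rewrite -[in LHS](mulmxA (hop z' t')) omD // -[LHS]scalemxAr -[RHS]scalemxAl !mulmxA.
rewrite !step mulmxBl; congr (_ - _ *m _).
by apply: eq_om => c; rewrite addrC.
Qed.

Lemma ltnS_gap (a j : nat) : (a < j.+1)%N%:Z - (a < j)%N%:Z = (a == j)%:Z :> int.
Proof. lia. Qed.

Lemma gap_ltnS (a j : nat) : (j < a)%N%:Z - (j.+1 < a)%N%:Z = (a == j.+1)%:Z :> int.
Proof. lia. Qed.

Lemma row_wt_diff i a b (j : 'I_m.-1) :
  row_wt i a (ix b (hi j)) - row_wt i a (ix b (lo j)) =
  (a == j)%:Z * ((b == i.+1 :> nat)%:Z - (b == i :> nat)%:Z).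
Proof. by rewrite /row_wt /row_gap !ixE /= -mulrBl ltnS_gap. Qed.

Lemma col_wt_diff j a b (i : 'I_n.-1) :
  col_wt j b (ix (lo i) a) - col_wt j b (ix (hi i) a) =
  (b == i.+1)%:Z * ((a == j.+1 :> nat)%:Z - (a == j :> nat)%:Z).
Proof. by rewrite /col_wt /col_gap !ixE /= -mulrBl gap_ltnS. Qed.

(** Apart from two terms the summands commute, and the commutators of those two
cancel. *)
Lemma commute_sums (X : 'I_m -> 'M[K]_D) (Y : 'I_n -> 'M[K]_D) a1 b1 a2 b2 :
    (a1, b1) != (a2, b2) ->
    (forall a b, (a, b) != (a1, b1) -> (a, b) != (a2, b2) ->
       X a *m Y b - Y b *m X a = 0) ->
    (X a1 *m Y b1 - Y b1 *m X a1) + (X a2 *m Y b2 - Y b2 *m X a2) = 0 ->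
  (\sum_a X a) *m (\sum_b Y b) = (\sum_b Y b) *m (\sum_a X a).
Proof.
move=> ne off on; apply/eqP; rewrite -subr_eq0.
have -> : (\sum_a X a) *m (\sum_b Y b) =
    \sum_(ab : 'I_m * 'I_n) X ab.1 *m Y ab.2.
  rewrite -(pair_bigA _ (fun a b => X a *m Y b)) mulmx_suml.
  by apply: eq_bigr => a _; rewrite mulmx_sumr.
have -> : (\sum_b Y b) *m (\sum_a X a) =
    \sum_(ab : 'I_m * 'I_n) Y ab.2 *m X ab.1.
  rewrite -(pair_bigA _ (fun a b => Y b *m X a)) mulmx_sumr.
  by apply: eq_bigr => a _; rewrite mulmx_suml.
rewrite -sumrB (bigD1 (a1, b1)) //= (bigD1 (a2, b2)) /=; last by rewrite eq_sym.
rewrite addrA on add0r big1 // => -[a b] /andP[n1 n2].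
exact: off.
Qed.

Lemma eqSnF k : (k.+1 == k) = false.
Proof. exact: gtn_eqF. Qed.

Lemma eqnSF k : (k == k.+1) = false.
Proof. exact: ltn_eqF. Qed.

Definition succE := (eqSnF, eqnSF).

Lemma pair_neqE (p p' : nat) (a a' : 'I_p) (b b' : 'I_p') :
  (a, b) != (a', b') -> (a == a' :> nat) && (b == b' :> nat) = false.
Proof. by rewrite xpair_eqE => /negbTE. Qed.

(** The vertical and the horizontal hops interact on the 2 x 2 block of cells in
rows i, i.+1 and columns j, j.+1 only. Hops into the same cell, or out of the
same cell, have product zero. The other two pairs of hops compose to the
diagonal hop of the block, along its two sides and with opposite signs; the
monomials by which it is multiplied differ only at its two ends, which
[hop_om_local] takes care of. *)
Lemma lamE_rhoE i j : lamE i *m rhoE j = rhoE j *m lamE i.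
Proof.
apply: (commute_sums (a1 := lo j) (b1 := hi i) (a2 := hi j) (b2 := lo i)).
- by rewrite xpair_eqE negb_and -val_eqE /= neq_ltn ltnSn.
- move=> a b /pair_neqE /= n1 /pair_neqE /= n2.
  rewrite hop_om_comm row_wt_diff -[_ (ix (hi i) a) - _]opprB col_wt_diff.
  have [/andP[/eqP aj /eqP bi]|n3] := boolP ((a == j :> nat) && (b == i :> nat)).
    have -> : b = lo i by exact: val_inj.
    have -> : a = lo j by exact: val_inj.
    rewrite !hop_same_l ?scaler0 ?subrr ?mul0mx // eq_ix !ixE /=.
      by rewrite succE andbF.
    by rewrite succE.
  have [/andP[/eqP aj /eqP bi]|n4] := boolP ((a == j.+1 :> nat) && (b == i.+1 :> nat)).
    have -> : b = hi i by exact: val_inj.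
    have -> : a = hi j by exact: val_inj.
    rewrite !hop_same_r ?scaler0 ?subrr ?mul0mx // eq_ix !ixE /=.
      by rewrite succE.
    by rewrite succE andbF.
  rewrite (_ : _ * _ = 0); last first.
    by move: n1 (negbTE n3); do 3!case: eqP => _.
  rewrite (_ : - (_ * _) = 0); last first.
    by move: n1 (negbTE n4); do 3!case: eqP => _.
  rewrite expr0z !scale1r hop_comm !eq_ix !ixE /=.
  rewrite (eq_sym _ (nat_of_ord b)) (eq_sym (nat_of_ord i)) [_ && _]andbC n1.
  by rewrite [_ && _]andbC n2 !scale0r subrr mul0mx.
- rewrite !hop_om_comm !row_wt_diff -![col_wt _ _ (ix (hi i) _) - _]opprB !col_wt_diff.
  rewrite /= !eqxx !succE.
  rewrite !(mul0r, mulr0, mul1r, subr0, sub0r, opprK, oppr0, expr0z, expr1z, scale1r).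
  rewrite -scalerBr !hop_comm !eq_ix !ixE /= !eqxx.
  rewrite !succE /= !scale0r !scale1r subr0 sub0r.
  rewrite -scalemxAl mulNmx; apply/eqP; rewrite subr_eq0; apply/eqP.
  set g := (fun c => _ + _); set h := (fun c => _ + _).
  have gh z : z != ix (lo i) (lo j) -> z != ix (hi i) (hi j) -> g z = h z.
    rewrite !eq_ix /g /h /row_wt /col_wt /= => /negbTE n1 /negbTE n2.
    apply/eqP; rewrite -subr_eq0 opprD addrACA -!mulrBl gap_ltnS ltnS_gap.
    rewrite /row_gap /col_gap; move: n1 n2.
    by case: (row_of z == i.+1); case: (row_of z == i); case: (col_of z == j.+1);
      case: (col_of z == j).
  have := hop_om_local q_neq0 actP gh.
  rewrite /g /h /row_wt /col_wt /row_gap /col_gap !ixE /= !ltnn ltnSn.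
  rewrite !eqxx !succE ltnNge leqnSn /=.
  by rewrite !(mul0r, mul1r, subr0, addr0, expr0z, expr1z, scale1r).
Qed.

(** Here the horizontal hop is reversed: hops with a common target or a common
source become consecutive and conversely, and the q-commutators of the
consecutive hops are given by [hop_pass_out] and [hop_pass_in]. *)
Lemma lamE_rhoE_tr i j : lamE i *m (rhoE j)^T = (rhoE j)^T *m lamE i.
Proof.
rewrite rhoE_tr.
apply: (commute_sums (a1 := lo j) (b1 := lo i) (a2 := hi j) (b2 := hi i)).
- by rewrite xpair_eqE negb_and -val_eqE /= neq_ltn ltnSn.
- move=> a b /pair_neqE /= n1 /pair_neqE /= n2.
  rewrite hop_om_comm -[_ (ix b (lo j)) - _]opprB row_wt_diff.
  rewrite -[_ (ix (hi i) a) - _]opprB col_wt_diff.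
  have [/andP[/eqP aj /eqP bi]|n3] := boolP ((a == j :> nat) && (b == i.+1 :> nat)).
    have -> : b = hi i by exact: val_inj.
    have -> : a = lo j by exact: val_inj.
    rewrite !hop_same_r ?scaler0 ?subrr ?mul0mx // eq_ix !ixE /=.
      by rewrite succE.
    by rewrite succE andbF.
  rewrite (_ : - (_ * _) = 0); last first.
    by move: n1 (negbTE n3); do 3!case: eqP => _.
  rewrite (_ : - (_ * _) = 0); last first.
    by move: n2 (negbTE n3); do 3!case: eqP => _.
  rewrite expr0z !scale1r hop_comm !eq_ix !ixE /=.
  rewrite (eq_sym _ (nat_of_ord b)) (eq_sym (nat_of_ord i)).
  by rewrite [_ && _]andbC n2 [_ && _]andbC n1 !scale0r subrr mul0mx.
- rewrite !hop_om_comm -![row_wt _ _ (ix _ (lo j)) - _]opprB !row_wt_diff.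
  rewrite -![col_wt _ _ (ix (hi i) _) - _]opprB !col_wt_diff.
  rewrite /= !eqxx !succE.
  rewrite !(mul0r, mulr0, mul1r, subr0, sub0r, opprK, oppr0, expr0z, expr1z, scale1r).
  rewrite -[q ^ _]/(q ^ (- 1)) exprN1 hop_pass_out ?hop_pass_in //; first last.
  1-6: by rewrite eq_ix !ixE /= !succE ?andbF.
  rewrite mulNmx -!(mulmxA (hop _ _)) !omD // addrC; apply/eqP; rewrite subr_eq0; apply/eqP.
  set g := (fun c => _ + _); set h := (fun c => _ + _).
  have gh z : z != ix (lo i) (hi j) -> z != ix (hi i) (lo j) -> g z = h z.
    rewrite !eq_ix /g /h /row_wt /col_wt /dlt !eq_ix /= => /negbTE n1 /negbTE n2.
    have e1 : (j < col_of z)%N%:Z = (j.+1 < col_of z)%N%:Z + (col_of z == j.+1)%:Z :> int.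
      by rewrite -gap_ltnS addrC subrK.
    have e2 : (row_of z < i.+1)%N%:Z = (row_of z < i)%N%:Z + (row_of z == i)%:Z :> int.
      by rewrite -ltnS_gap addrC subrK.
    rewrite e1 e2 /row_gap /col_gap; move: n1 n2.
    case: (row_of z == i.+1); case: (row_of z == i); case: (col_of z == j.+1);
      case: (col_of z == j) => //= _ _; ring.
  have := hop_om_local q_neq0 actP gh.
  rewrite /g /h /row_wt /col_wt /row_gap /col_gap /dlt !eq_ix !ixE /= !ltnn.
  rewrite !eqxx !succE !ltnNge !leqnSn /= ?andbF.
  by rewrite !(mul0r, mul1r, subr0, addr0, oppr0, expr0z, expr1z, scale1r).
Qed.
End CommutingActions.

(** * Representations whose lowering operators are transposed raising operators *)

Section SideFromGenerators.
Variables (K : fieldType) (q : K) (p N : nat).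
Hypothesis q_neq0 : q != 0.
Hypothesis q_gen : forall k : int, q ^ k = 1 -> k = 0.
Local Notation D := #|{: {set 'I_N}}|.
Local Notation om := (@omega_mx K q N).
Variables (r : Uq q p -> 'M[K]_D) (E : 'I_p.-1 -> 'M[K]_D).
Variables (w : 'I_p -> 'I_N -> int) (cc : K).
Hypothesis rD : forall a b, r (a + b) = r a + r b.
Hypothesis rZ : forall c a, r (c *: a) = c *: r a.
Hypothesis r1 : r 1 = 1%:M.
Hypothesis rM : forall a b, r (a * b) = r a *m r b.
Hypothesis cc_neq0 : cc != 0.
Hypothesis rE : forall i, r (UE q i) = E i.
Hypothesis rFT : forall i,
  (r (UF q i))^T = cc *: (om (fun x => w (lo i) x - w (hi i) x) *m E i).
Hypothesis rL : forall i, r (UL q i) = om (fun x => - w i x).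
Hypothesis om_E : forall i k, exists d : int,
  om (w k) *m E i = q ^ d *: (E i *m om (w k)).

Lemma omK g : om g *m om (fun x => - g x) = 1%:M.
Proof. by rewrite omD // -(@om0 K q N); apply: eq_om => x; rewrite subrr. Qed.

Lemma omKV g : om (fun x => - g x) *m om g = 1%:M.
Proof. by rewrite omC // omK. Qed.

Lemma om_unit g : om g \in unitmx.
Proof. by case/mulmx1_unit: (omK g). Qed.

Lemma rLinv i : r (ULinv q i) = om (w i).
Proof.
have : r (UL q i) *m r (ULinv q i) = 1%:M by rewrite -rM UL_inv r1.
by rewrite rL => /(congr1 (mulmx (om (w i)))); rewrite mulmxA omK mul1mx mulmx1.
Qed.

Lemma om_NE i k : exists d : int,
  om (fun x => - w k x) *m E i = q ^ d *: (E i *m om (fun x => - w k x)).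
Proof.
have [d h] := om_E i k; exists (- d); set nw := om (fun x => - w k x).
have e : E i *m nw = q ^ d *: (nw *m E i).
  rewrite -[in LHS](mul1mx (E i)) -(omKV (w k)) -/nw -(mulmxA nw) h.
  by rewrite -scalemxAr -scalemxAl -!mulmxA omK mulmx1.
by rewrite e scalerA -expfzDr // addNr expr0z scale1r.
Qed.

Lemma rF i : r (UF q i) = cc *: ((E i)^T *m om (fun x => w (lo i) x - w (hi i) x)).
Proof. by rewrite -[LHS]trmxK rFT linearZ /= trmx_mul om_tr. Qed.

Lemma rF_om i : r (UF q i) = cc *: ((E i)^T *m (om (w (lo i)) *m om (fun x => - w (hi i) x))).
Proof. by rewrite rF omD. Qed.

(** An operator that commutes with the E_i, their transposes and the L_i commutes
with the whole image, F_i being a product of such operators. *)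
Lemma rep_comm Y : (forall i, E i *m Y = Y *m E i) ->
    (forall i, (E i)^T *m Y = Y *m (E i)^T) ->
    (forall k, om (w k) *m Y = Y *m om (w k)) ->
  forall a, r a *m Y = Y *m r a.
Proof.
move=> EY ETY wY.
have NwY k : om (fun x => - w k x) *m Y = Y *m om (fun x => - w k x).
  rewrite -[LHS]mulmx1 -(omK (w k)) !mulmxA -(mulmxA (om _) Y) -wY mulmxA omKV.
  by rewrite mul1mx.
elim/palg_ind=> [x||c a IH|a b IHa IHb|a b IHa IHb].
- case: x => i.
  + by rewrite -/(UE q i) rE.
  + rewrite -/(UF q i) rF_om -scalemxAl -scalemxAr; congr (_ *: _).
    by rewrite -!mulmxA NwY (mulmxA (om _)) wY !mulmxA ETY.
  + by rewrite -/(UL q i) rL.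
  + by rewrite -/(ULinv q i) rLinv.
- by rewrite r1 mul1mx mulmx1.
- by rewrite rZ -scalemxAl IH scalemxAr.
- by rewrite rD mulmxDl mulmxDr IHa IHb.
- by rewrite rM -mulmxA IHb !mulmxA IHa.
Qed.

Lemma rep_matrix : is_rep (fun a (x : 'cV[K]_D) => r a *m x).
Proof.
split=> [a c x y|x c a b|x|a b x].
- by rewrite mulmxDr scalemxAr.
- by rewrite rD rZ mulmxDl scalemxAl.
- by rewrite r1 mul1mx.
- by rewrite rM mulmxA.
Qed.

(** The transposes of the generators are again in the image: F_i^T is E_i up to a
scalar and a monomial in the L's, and conversely. *)
Lemma rep_side (M : finType) (v : M -> 'cV[K]_D) (mu : M -> 'I_p -> nat) :
    (forall t i, E i *m v t = 0) ->
    (forall t i, r (UL q i) *m v t = q ^+ mu t i *: v t) ->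
    (forall s t, s != t -> exists i, mu s i != mu t i) ->
  side v (fun x => exists a, x = r a) E (fun i => r (UF q i)) (fun i => r (UL q i))
    (fun t i => q ^+ mu t i).
Proof.
move=> Ev Lv mu_inj.
have AM a b : (exists c, a = r c) -> (exists c, b = r c) -> exists c, a *m b = r c.
  by move=> [c ->] [d ->]; exists (c * d); rewrite rM.
have AZ c a : (exists c, a = r c) -> exists d, c *: a = r d.
  by move=> [d ->]; exists (c *: d); rewrite rZ.
have AE i : exists a, E i = r a by exists (UE q i); rewrite rE.
have Aw k : exists a, om (w k) = r a by exists (ULinv q k); rewrite rLinv.
have ANw k : exists a, om (fun x => - w k x) = r a by exists (UL q k); rewrite rL.
have omE i : om (fun x => w (lo i) x - w (hi i) x) =
  om (w (lo i)) *m om (fun x => - w (hi i) x) by rewrite omD.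
split=> //.
- by exists 1.
- by move=> a b [c ->] [d ->]; exists (c + d); rewrite rD.
- move=> _ [a ->]; elim/palg_ind: a => [x||c a IH|a b IHa IHb|a b IHa IHb].
  + case: x => i.
    * rewrite -/(UE q i) rE.
      have -> : (E i)^T = cc^-1 *: (r (UF q i) *m
          (om (w (hi i)) *m om (fun x => - w (lo i) x))).
        rewrite rF -scalemxAl scalerA mulVf // scale1r -mulmxA !omD //.
        rewrite (_ : om _ = 1%:M) ?mulmx1 // -(@om0 K q N); apply: eq_om => x.
        by ring.
      by apply: (AZ); apply: (AM); [exists (UF q i)|apply: (AM)].
    * by rewrite -/(UF q i) rFT omE; apply: (AZ); apply: (AM) => //; apply: (AM).
    * by rewrite -/(UL q i) rL om_tr.
    * by rewrite -/(ULinv q i) rLinv om_tr.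
  + by exists 1; rewrite r1 trmx1.
  + by rewrite rZ linearZ; exact: AZ.
  + by case: IHa IHb => c ca [d db]; exists (c + d); rewrite !rD linearD /= ca db.
  + by rewrite rM trmx_mul; exact: AM.
- by move=> i; exists (UF q i).
- by move=> i; exists (UL q i).
- move=> i x; rewrite rFT -scalemxAl -mulmxA; split=> [->|].
    by rewrite mulmx0 scaler0.
  move=> /eqP; rewrite scaler_eq0 (negPf cc_neq0) /= => /eqP.
  by move=> /(congr1 (mulmx (invmx (om (fun x => w (lo i) x - w (hi i) x)))));
    rewrite mulKmx ?om_unit // mulmx0.
- move=> i j; have [d h] := om_NE i j; exists (q ^ (- d)).
  by rewrite rL h scalerA -expfzDr // addNr expr0z scale1r.
- move=> i j; exists (q ^ (- delta j i + delta j i.+1)).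
  by rewrite -!rM UL_F rZ.
- move=> s t /mu_inj[i si]; exists i; apply: contraNneq si.
  by move=> /(q_inj q_neq0 q_gen (k := mu s i) (l := mu t i)) [->].
- move=> a t [b ->].
  have zP : hw_vector (fun a (x : 'cV[K]_D) => r a *m x) (mu t) (v t).
    by split=> i; rewrite ?rE.
  have [c [y yE]] := hw_vacuum_F q_neq0 rep_matrix zP b.
  by exists c, y.
Qed.

End SideFromGenerators.

(** * The images of the generators under lambda and rho *)

Section HoweOperators.
Variables (K : fieldType) (q : K) (n m : nat).
Hypothesis q_neq0 : q != 0.
Local Notation N := (n * m)%N.
Variable act : Clq q N -> Ext q N -> Ext q N.
Hypothesis actP : is_fock_action act.
Local Notation D := #|{: {set 'I_N}}|.
Local Notation fk := (fock q_neq0 actP).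
Local Notation om := (@omega_mx K q N).
Local Notation hop := (hop_mx q_neq0 actP).
Local Notation ix := (@ix n m).
Local Notation lamE := (lamE q_neq0 actP).
Local Notation rhoE := (rhoE q_neq0 actP).

Lemma ix_surj x : exists i j, x = ix i j.
Proof.
have N0 : (0 < N)%N by apply: leq_ltn_trans (ltn_ord x).
have n0 : (0 < n)%N by move: N0; rewrite muln_gt0 => /andP[].
have ri : (row_of x < n)%N by rewrite ltn_pmod.
have cj : (col_of x < m)%N by rewrite ltn_divLR // [(m * n)%N]mulnC.
exists (Ordinal ri), (Ordinal cj); apply/eqP; rewrite eq_ix /=.
by rewrite !eqxx.
Qed.

Lemma dlt_ix i j x : dlt (ix i j) x = ((row_of x == i) && (col_of x == j))%:Z.
Proof. by rewrite /dlt eq_ix. Qed.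

Lemma sum_dlt_col (Q : pred nat) i x :
  \sum_(p < m | Q p) dlt (ix i p) x = ((row_of x == i) && Q (col_of x))%:Z.
Proof.
have [r [c ->]] := ix_surj x; rewrite !ixE.
under eq_bigr do rewrite dlt_ix !ixE.
case: eqP => _ /=; last by rewrite big1.
have [Qc|Qc] := boolP (Q c); last first.
  by rewrite big1 // => p Qp; case: eqP => // cp; move: Qc; rewrite cp Qp.
rewrite (bigD1 c) //= eqxx big1 ?addr0 // => p /andP[_ pc].
by rewrite eq_sym (negPf (pc : p != c :> nat)).
Qed.

Lemma sum_dlt_row (Q : pred nat) j x :
  \sum_(p < n | Q p) dlt (ix p j) x = (Q (row_of x) && (col_of x == j))%:Z.
Proof.
have [r [c ->]] := ix_surj x; rewrite !ixE.
under eq_bigr do rewrite dlt_ix !ixE.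
case: eqP => _ /=; last by rewrite andbF big1 // => p _; rewrite andbF.
under eq_bigr do rewrite andbT; rewrite andbT.
have [Qr|Qr] := boolP (Q r); last first.
  by rewrite big1 // => p Qp; case: eqP => // rp; move: Qr; rewrite rp Qp.
rewrite (bigD1 r) //= eqxx big1 ?addr0 // => p /andP[_ pr].
by rewrite eq_sym (negPf (pr : p != r :> nat)).
Qed.

Lemma fock_prod_om p (Q : pred 'I_p) (f : 'I_p -> Clq q N) (g : 'I_p -> 'I_N -> int) :
  (forall i, fk (f i) = om (g i)) ->
  fk (\prod_(i < p | Q i) f i) = om (fun x => \sum_(i < p | Q i) g i x).
Proof.
move=> fg; elim: (index_enum _) => [|i s IH].
  rewrite big_nil fock1 -(@om0 K q N); apply: eq_om => x; by rewrite big_nil.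
rewrite big_cons; case: ifP => Qi.
  rewrite fockM fg IH omD //; apply: eq_om => x.
  by rewrite big_cons Qi.
by rewrite IH; apply: eq_om => x; rewrite big_cons Qi.
Qed.

Lemma om_neg_psid x : om (fun y => - dlt x y) *m fk (psid q x) = q *: fk (psid q x).
Proof.
rewrite om_psid // opprK {1}/dlt eqxx expr1z; congr (_ *: _).
rewrite -[RHS]mulmx1 -(@om0 K q N); apply: psid_om_local => // y /negPf yx.
by rewrite /dlt yx oppr0.
Qed.

Lemma om_row_gap g d (i : 'I_n.-1) :
  (forall a, g (ix (hi i) a) - g (ix (lo i) a) = d) ->
  om g *m lamE i = q ^ d *: (lamE i *m om g).
Proof.
move=> gd; rewrite /lamE mulmx_sumr mulmx_suml scaler_sumr; apply: eq_bigr => a _.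
by rewrite mulmxA om_hop // gd -scalemxAl -!(mulmxA (hop _ _)) omC.
Qed.

Lemma om_col_gap g d (j : 'I_m.-1) :
  (forall b, g (ix b (hi j)) - g (ix b (lo j)) = d) ->
  om g *m rhoE j = q ^ d *: (rhoE j *m om g).
Proof.
move=> gd; rewrite /rhoE mulmx_sumr mulmx_suml scaler_sumr; apply: eq_bigr => a _.
by rewrite mulmxA om_hop // gd -scalemxAl -!(mulmxA (hop _ _)) omC.
Qed.

Section Lambda.
Variable lam : Uq q n -> Clq q N.
Hypothesis lamP : is_lambda lam.

Lemma lamE_eq i : fk (lam (UE q i)) = lamE i.
Proof.
case: lamP => _ -> _ _; rewrite fockZ fock_sum /lamE scaler_sumr.
apply: eq_bigr => a _; rewrite !fockM fock_omegainv.
rewrite om_neg_psid -!scalemxAl scalerA mulVf // scale1r; congr (_ *m _).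
rewrite /kappa_gt (@fock_prod_om _ _ _ (fun p x =>
    dlt (ix (hi i) p) x - dlt (ix (lo i) p) x)) => [|p].
  apply: eq_om => x; rewrite sumrB (sum_dlt_col (fun p => a < p)%N).
  rewrite (sum_dlt_col (fun p => a < p)%N) /row_wt /row_gap /=.
  by case: (a < _)%N; rewrite ?mul1r ?mul0r ?andbT ?andbF.
by rewrite fockM fock_omegainv fock_omega omD //; apply: eq_om => x; rewrite addrC.
Qed.

(** The exponents row_wt run over the columns to the right of a, those of the
F-terms over the columns to the left of a; their difference is the sum over
all columns, which is why row_gap appears. *)
Lemma lamF_eq i : fk (lam (UF q i)) =
  q^-1 *: (om (fun x => - row_gap i x) *m (lamE i)^T).
Proof.
case: lamP => _ _ -> _; rewrite fock_sum /lamE linear_sum mulmx_sumr scaler_sumr.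
apply: eq_bigr => a _ /=; rewrite trmx_mul om_tr hop_tr mulmxA omD // !fockM fock_omega.
rewrite /kappa_lt_inv (@fock_prod_om _ _ _ (fun p x =>
    dlt (ix (lo i) p) x - dlt (ix (hi i) p) x)) => [|p]; last first.
  by rewrite fockM fock_omegainv fock_omega omD.
rewrite omD // /hop mulmxA scalemxAl; congr (_ *m _).
pose g x := dlt (ix (lo i) a) x + \sum_(p < m | (p < a)%N)
  (dlt (ix (lo i) p) x - dlt (ix (hi i) p) x).
rewrite -/g.
have -> : om (fun x => - row_gap i x + row_wt i a x) =
    om g *m om (fun x => - dlt (ix (hi i) a) x).
  rewrite omD //; apply: eq_om => x; rewrite /g sumrB.
  rewrite (sum_dlt_col (fun p => p < a)%N) (sum_dlt_col (fun p => p < a)%N).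
  rewrite !dlt_ix /row_wt /row_gap /=.
  by case: (ltngtP (col_of x) a); case: (_ == _); case: (_ == _).
by rewrite -mulmxA om_neg_psid -scalemxAr scalerA mulVf // scale1r.
Qed.

Lemma lamL_eq i : fk (lam (UL q i)) = om (fun x => - (row_of x == i)%:Z).
Proof.
case: lamP => _ _ _ ->; rewrite (@fock_prod_om _ _ _ (fun p x => - dlt (ix i p) x)).
  apply: eq_om => x; rewrite sumrN (sum_dlt_col (fun=> true)).
  by rewrite andbT.
by move=> p; exact: fock_omegainv.
Qed.

End Lambda.

Section Rho.
Variable rho : Uq q m -> Clq q N.
Hypothesis rhoP : is_rho rho.

Lemma rhoE_eq j : fk (rho (UE q j)) = rhoE j.
Proof.
case: rhoP => _ -> _ _; rewrite fock_sum /rhoE.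
apply: eq_bigr => b _; rewrite !fockM -mulmxA -/(hop _ _).
rewrite /kappa_lt' (@fock_prod_om _ _ _ (fun p x =>
    dlt (ix p (hi j)) x - dlt (ix p (lo j)) x)) => [|p].
  rewrite (@eq_om _ _ _ _ (col_wt j b)) => [|x].
    by rewrite om_hopC // /col_wt !ixE ltnn !mul0r.
  rewrite sumrB (sum_dlt_row (fun p => p < b)%N).
  rewrite (sum_dlt_row (fun p => p < b)%N) /col_wt /col_gap /=.
  by case: (_ < b)%N; rewrite ?mul1r ?mul0r.
by rewrite fockM fock_omegainv fock_omega omD //; apply: eq_om => x; rewrite addrC.
Qed.

Lemma rhoF_eq j : fk (rho (UF q j)) =
  q *: ((rhoE j)^T *m om (fun x => - col_gap j x)).
Proof.
case: rhoP => _ _ -> _; rewrite fock_sum rhoE_tr mulmx_suml scaler_sumr.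
apply: eq_bigr => b _ /=; rewrite !fockM -/(hop _ _) -[in RHS](mulmxA (hop _ _)) omD //.
rewrite /kappa_gt_inv' (@fock_prod_om _ _ _ (fun p x =>
    dlt (ix p (lo j)) x - dlt (ix p (hi j)) x)) => [|p]; last first.
  by rewrite fockM fock_omegainv fock_omega omD.
set g := (fun x => \sum_(_ < _ | _) _); set h := (fun x => _ + _).
have gE z : g z + dlt (ix b (lo j)) z - dlt (ix b (hi j)) z = h z.
  rewrite /g /h sumrB !(sum_dlt_row (fun p => b < p)%N) !dlt_ix /col_wt /col_gap /=.
  by case: (ltngtP (row_of z) b); case: (_ == _); case: (_ == _).
have g_lo : g (ix b (lo j)) = 0.
  by rewrite /g sumrB !(sum_dlt_row (fun p => b < p)%N) !ixE ltnn.
have := @hop_om_local K q n m q_neq0 act actP g h (ix b (hi j)) (ix b (lo j)).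
rewrite -gE g_lo /dlt eqxx eq_ix !ixE /= succE andbF.
rewrite !(add0r, subr0, expr0z, expr1z, scale1r); apply.
by move=> z /negPf z1 /negPf z2; rewrite -gE /dlt z1 z2 addr0 subr0.
Qed.

Lemma rhoL_eq j : fk (rho (UL q j)) = om (fun x => - (col_of x == j)%:Z).
Proof.
case: rhoP => _ _ _ ->; rewrite (@fock_prod_om _ _ _ (fun p x => - dlt (ix p j) x)).
  by apply: eq_om => x; rewrite sumrN (sum_dlt_row (fun=> true)).
by move=> p; exact: fock_omegainv.
Qed.

End Rho.
End HoweOperators.

(** * The ballot condition at q = 0 *)

Section Ballot.
Variables (F K : fieldType) (iota : {rmorphism {poly F} -> K}).
Hypothesis iota_inj : injective iota.
Local Notation q := (iota 'X).
Variables (n m : nat).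
Hypothesis q_neq0 : q != 0.
Local Notation N := (n * m)%N.
Variable act : Clq q N -> Ext q N -> Ext q N.
Hypothesis actP : is_fock_action act.
Local Notation D := #|{: {set 'I_N}}|.
Local Notation fk := (fock q_neq0 actP).
Local Notation om := (@omega_mx K q N).
Local Notation hop := (hop_mx q_neq0 actP).

Definition co (x : 'cV[K]_D) (S : {set 'I_N}) : K := x (enum_rank S) 0.

Lemma coE x S : co x S = dot (bvec K S) x.
Proof. by rewrite /co /dot trmx_delta -rowE mxE. Qed.

Lemma co0 S : co 0 S = 0.
Proof. by rewrite /co mxE. Qed.

Lemma co_sum (J : Type) (r : seq J) (P : pred J) (f : J -> 'cV[K]_D) S :
  co (\sum_(i <- r | P i) f i) S = \sum_(i <- r | P i) co (f i) S.
Proof. by rewrite /co summxE. Qed.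

Lemma co_psid j x T : co (fk (psid q j) *m x) T =
  if j \in T then (-1) ^+ below T j * co x (T :\ j) else 0.
Proof.
rewrite !coE dot_adj -psi_tr trmxK psi_bvec.
by case: ifP => _; rewrite dotC ?dot0r // dotZr dotC.
Qed.

Lemma co_psi j x T : co (fk (psi q j) *m x) T =
  if j \in T then 0 else (-1) ^+ below T j * co x (j |: T).
Proof.
rewrite !coE dot_adj psi_tr psid_bvec.
by case: ifP => _; rewrite dotC ?dot0r // dotZr dotC.
Qed.

Lemma co_om g x T : co (om g *m x) T = q ^ (- \sum_(z in T) g z) * co x T.
Proof. by rewrite !coE dot_adj om_tr om_bvec dotC dotZr dotC. Qed.

Lemma co_hop a b x T : a != b -> co (hop a b *m x) T =
  if (a \in T) && (b \notin T) then
    (-1) ^+ odd (below T a + below (T :\ a) b) * co x (b |: (T :\ a))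
  else 0.
Proof.
move=> ab; rewrite /hop_mx -mulmxA co_psid co_psi in_setD1 eq_sym ab /=.
case: (a \in T) => //=; case: (b \in T); rewrite ?mulr0 //=.
by rewrite mulrA signr_odd exprD.
Qed.

Variables (k : nat) (up down : 'I_k -> 'I_N).
Hypotheses (up_inj : injective up) (down_inj : injective down).
Hypothesis up_down : forall a b, up a != down b.

(** The cells up a and down a are neighbours, and E moves a particle from down a
to up a: each pair of cells carries a tensor factor of gl_2. *)
Definition cell_wt (S : {set 'I_N}) (a : 'I_k) : int :=
  (up a \in S)%:Z - (down a \in S)%:Z.

Definition transfer (S : {set 'I_N}) (j a : 'I_k) : {set 'I_N} :=
  if j == a then S else down a |: ((up j |: (S :\ down j)) :\ up a).

Lemma cell_wtP S j : [|| cell_wt S j == -1, cell_wt S j == 0 | cell_wt S j == 1].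
Proof. by rewrite /cell_wt; case: (_ \in _); case: (_ \in _). Qed.

Lemma cell_wtN1 S j : cell_wt S j = -1 -> (up j \in S = false) * (down j \in S = true).
Proof. by rewrite /cell_wt; case: (_ \in _); case: (_ \in _). Qed.

Lemma cell_wt1 S j : (cell_wt S j == 1) = (up j \in S) && (down j \notin S).
Proof. by rewrite /cell_wt; case: (_ \in _); case: (_ \in _). Qed.

Lemma cell_wt_transfer S j a : cell_wt S j = -1 -> cell_wt S a = 1 ->
  forall i, cell_wt (transfer S j a) i =
    cell_wt S i + 2 * (i == j)%:Z - 2 * (i == a)%:Z.
Proof.
move=> wj wa i; rewrite /transfer; case: eqP => [ja|/eqP ja].
  by rewrite ja wa in wj.
have [uj dj] := cell_wtN1 wj.
have /andP[ua da] : (up a \in S) && (down a \notin S) by rewrite -cell_wt1 wa.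
rewrite /cell_wt !(in_setU1, in_setD1) (negPf (up_down i a)) (negPf (up_down i j)).
rewrite !(inj_eq up_inj) !(inj_eq down_inj) [down i == up _]eq_sym (negPf (up_down a i)).
rewrite [down i == up _]eq_sym (negPf (up_down j i)) /=.
have [ij|ij] := eqVneq i j.
  by rewrite ij (negPf ja) uj dj.
have [->|ia] := eqVneq i a; first by rewrite ua (negPf da).
by rewrite !mulr0 addr0 subr0.
Qed.

(** [unbalanced_vanish] for a sum of hops: the coordinate at transfer S j a is
that from which the hop at a leads to S with its particle moved from down j to
up j. *)
Lemma ballot (x : 'cV[K]_D) (g : 'I_k -> 'I_N -> int) (s : K)
    (p : {set 'I_N} -> {poly F}) :
    (forall a z, g a z = \sum_(b < k | (a < b)%N) (dlt (down b) z - dlt (up b) z)) ->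
    (\sum_a hop (up a) (down a) *m om (g a)) *m x = 0 ->
    (forall S, s * co x S = iota (p S)) ->
  forall S z, \sum_(a < k | (z <= a)%N) cell_wt S a < 0 -> (p S).[0] = 0.
Proof.
move=> gE Ex pE.
pose T S j := up j |: (S :\ down j).
pose eps S j a := odd (below (T S j) (up a) + below (T S j :\ up a) (down a)).
have transfer_id S j : transfer S j j = S by rewrite /transfer eqxx.
move=> S z; apply: (unbalanced_vanish iota_inj (mv := transfer) (eps := eps)) => //.
- exact: cell_wtP.
- exact: cell_wt_transfer.
move=> {S z} S j wj; have [uj dj] := cell_wtN1 wj.
have upT a : (up a \in T S j) = (a == j) || (up a \in S).
  by rewrite /T in_setU1 in_setD1 (inj_eq up_inj) (negPf (up_down a j)).
have downT a : (down a \in T S j) = (a != j) && (down a \in S).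
  by rewrite /T in_setU1 in_setD1 (inj_eq down_inj) eq_sym (negPf (up_down j a)).
have transferE a : (a == j) || (cell_wt S a == 1) ->
    down a |: (T S j :\ up a) = transfer S j a.
  rewrite /transfer eq_sym; case: eqP => //= <- _; rewrite /T.
  by rewrite finset.setU1K ?finset.setD1K // in_setD1 uj andbF.
have := congr1 (fun y => s * co y (T S j)) Ex.
rewrite mulmx_suml co0 co_sum mulr0 mulr_sumr => e0; rewrite -[RHS]e0 [LHS]big_mkcond.
apply: eq_bigr => a _; rewrite -mulmxA co_hop // upT downT cell_wt1 negb_and negbK.
rewrite -orb_andr; case: ifP => aS; last by rewrite mulr0.
rewrite transferE ?cell_wt1 // co_om -pE !mulrA [s * _]mulrC -!mulrA; congr (_ * _).
rewrite [s * _]mulrCA; congr (_ * _); congr (_ ^ _).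
have wE (R : {set 'I_N}) : - \sum_(z in R) g a z = \sum_(b < k | (a < b)%N) cell_wt R b.
  under eq_bigr do rewrite gE.
  rewrite exchange_big -sumrN; apply: eq_bigr => b _.
  by rewrite sumrB !sum_dlt opprB.
rewrite wE; apply: eq_bigr => b ab.
have [ja|ja] := eqVneq a j.
  rewrite ja /transfer eqxx (_ : (b == j) = false) ?mulr0 ?addr0 //.
  by apply/negbTE; rewrite -ja; apply: contraTneq ab => ->; rewrite ltnn.
have wa : cell_wt S a = 1 by apply/eqP; move: aS; rewrite cell_wt1 (negPf ja).
rewrite cell_wt_transfer // (_ : (b == a) = false) ?mulr0 ?subr0 //.
by apply/negbTE; apply: contraTneq ab => ->; rewrite ltnn.
Qed.
End Ballot.

(** * Young diagrams in the rectangle *)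

Section YoungDiagrams.
Variables n m : nat.
Local Notation N := (n * m)%N.
Local Notation ix := (@ix n m).
Local Notation rect := (rect n m).

Definition young (mu : rect) : {set 'I_N} :=
  [set x | [exists i : 'I_n, (row_of x == i) && (col_of x < part mu i)%N]]%SET.

Lemma in_young mu i j : (ix i j \in young mu) = (j < part mu i)%N.
Proof.
rewrite inE; apply/existsP/idP => [[k]|jmu].
  by rewrite row_ix col_ix => /andP[/eqP/val_inj ->].
by exists i; rewrite row_ix col_ix eqxx.
Qed.

Lemma part_le (mu : rect) (i j : 'I_n) : (i <= j)%N -> (part mu j <= part mu i)%N.
Proof. by move=> ij; have /forallP/(_ i)/forallP/(_ j)/implyP/(_ ij) := valP mu. Qed.

Lemma part_lem (mu : rect) i : (part mu i <= m)%N.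
Proof. by rewrite /part -ltnS. Qed.

Lemma eq_part (mu nu : rect) : (forall i, part mu i = part nu i) -> mu = nu.
Proof. by move=> mn; apply/val_inj/ffunP=> i; exact/val_inj/mn. Qed.

Lemma eq_below k (a b : nat) : (a <= k)%N -> (b <= k)%N ->
  (forall j : 'I_k, (j < a)%N = (j < b)%N) -> a = b.
Proof.
move=> ak bk h; apply/eqP; rewrite eqn_leq; apply/andP; split; rewrite leqNgt; apply/negP.
- by move=> ba; have := h (Ordinal (leq_trans ba ak)); rewrite /= ba ltnn.
- by move=> ab; have := h (Ordinal (leq_trans ab bk)); rewrite /= ab ltnn.
Qed.

Lemma card_below (k l : nat) : (l <= k)%N -> #|[set a : 'I_k | (a < l)%N]%SET| = l.
Proof.
move=> lk; rewrite -[RHS]card_ord -[RHS]cardsT -(card_imset _ (f := widen_ord lk)).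
  apply: eq_card => a; rewrite inE; apply/idP/imsetP => [al|[b _ ->] //=].
  by exists (Ordinal al); rewrite ?inE //; exact: val_inj.
by move=> a b /(congr1 val) /= /val_inj.
Qed.

Lemma lower_set_card k (A : {set 'I_k}) :
    (forall a b : 'I_k, (a <= b)%N -> b \in A -> a \in A) ->
  forall a, (a \in A) = (a < #|A|)%N.
Proof.
move=> low a; apply/idP/idP => [aA|].
  rewrite -(card_below (ltn_ord a)); apply/subset_leq_card/fintype.subsetP => b.
  by rewrite inE ltnS => ba; exact: low aA.
apply: contraTT => aA; rewrite -leqNgt.
rewrite -[X in (_ <= X)%N](card_below (ltnW (ltn_ord a))).
apply/subset_leq_card/fintype.subsetP => b bA; rewrite inE ltnNge.
by apply: contra aA => ab; exact: low bA.
Qed.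

Lemma ltn_conj_part (mu : rect) (i : 'I_n) (j : 'I_m) : (j < part mu i)%N = (i < conj_part mu j)%N.
Proof.
rewrite /conj_part -(@lower_set_card _ [set i | (j < part mu i)%N]%SET) ?inE //.
by move=> a b ab; rewrite !inE => /leq_trans; apply; exact: part_le.
Qed.

Lemma eq_conj_part (mu nu : rect) :
  (forall j, conj_part mu j = conj_part nu j) -> mu = nu.
Proof.
move=> h; apply: eq_part => i; apply: (@eq_below m); rewrite ?part_lem //.
by move=> j; rewrite !ltn_conj_part h.
Qed.

Lemma part_sep (mu nu : rect) : mu != nu -> exists i, part mu i != part nu i.
Proof.
move=> ne; apply: contrapT => h; case/eqP: ne; apply: eq_part => i.
by apply/eqP/negPn/negP => hi; apply: h; exists i.
Qed.

Lemma conj_part_sep (mu nu : rect) : mu != nu ->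
  exists j, conj_part mu j != conj_part nu j.
Proof.
move=> ne; apply: contrapT => h; case/eqP: ne; apply: eq_conj_part => j.
by apply/eqP/negPn/negP => hi; apply: h; exists j.
Qed.

Lemma young_inj : injective young.
Proof.
move=> mu nu h; apply: eq_part => i; apply: (@eq_below m); rewrite ?part_lem //.
by move=> j; rewrite -!in_young h.
Qed.

Lemma hi_surj p (i : 'I_p) : (0 < i)%N -> exists i0, hi i0 = i.
Proof.
case: i => -[//|i] ip _ /=; have i0 : (i < p.-1)%N by rewrite ltn_predRL.
by exists (Ordinal i0); exact: val_inj.
Qed.

Lemma adjacent_lower p (Q : 'I_p -> bool) : (forall j, Q (hi j) -> Q (lo j)) ->
  forall a b : 'I_p, (a <= b)%N -> Q b -> Q a.
Proof.
move=> Qadj a [b bp]; elim: b bp => [|b IH] bp ab Qb.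
  by rewrite (_ : a = Ordinal bp) //; apply: val_inj; move: ab; rewrite leqn0 => /eqP.
move: ab; rewrite /= leq_eqVlt => /orP[/eqP ab|ab].
  by rewrite (_ : a = Ordinal bp) //; exact: val_inj.
have [i iE] := @hi_surj _ (Ordinal bp) isT.
apply: (IH (ltn_trans (ltnSn b) bp)) => //.
rewrite (_ : Ordinal _ = lo i); first by apply: Qadj; rewrite iE.
by apply: val_inj => /=; have := congr1 val iE => /= -[].
Qed.

(** By induction on the rows. Suppose that the rows above row i form a Young
diagram. If the cell (i, a) is in S but the cell above it is not, then the row
above is empty from column a on, and the suffix of the two rows from a on is
unbalanced. If (i, a.+1) is in S but (i, a) is not, the columns a and a.+1 agree
above row i, both being full there, and are unbalanced from row i up. *)
Lemma ballot_young (S : {set 'I_N}) :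
    (forall (i : 'I_n.-1) (z : nat), ~ \sum_(a < m | (z <= a)%N)
       ((ix (lo i) a \in S)%:Z - (ix (hi i) a \in S)%:Z) < 0) ->
    (forall (j : 'I_m.-1) (z : nat), ~ \sum_(b < n | (z <= b)%N)
       ((ix (rev_ord b) (lo j) \in S)%:Z - (ix (rev_ord b) (hi j) \in S)%:Z) < 0) ->
  exists mu, S = young mu.
Proof.
move=> Hrow Hcol.
have lower k : forall i i' : 'I_n, (i < k)%N -> (i' <= i)%N ->
    forall a a' : 'I_m, (a' <= a)%N -> ix i a \in S -> ix i' a' \in S.
  elim: k => // k IH i i'; rewrite ltnS leq_eqVlt => /orP[/eqP ik|]; last exact: IH.
  have vert (i1 : 'I_n) a : (i1 < i)%N -> ix i a \in S -> ix i1 a \in S.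
    move=> i1i iaS; have [i0 i0E] := hi_surj (leq_ltn_trans (leq0n _) i1i).
    have i0k : (lo i0 < k)%N by rewrite -ik -i0E /= ltnSn.
    have i10 : (i1 <= lo i0)%N by move: i1i; rewrite -i0E /= ltnS.
    apply: (IH (lo i0) i1 i0k i10 a a) => //; apply: contraT => loS.
    case: (Hrow i0 a); rewrite (bigD1 a) //= (negPf loS) i0E iaS.
    suff : \sum_(b < m | (a <= b)%N && (b != a))
        ((ix (lo i0) b \in S)%:Z - (ix i b \in S)%:Z) <= 0 :> int.
      by move=> h; rewrite sub0r addrC -ltrBrDr opprK add0r; exact: le_lt_trans h _.
    apply: sumr_le0 => b /andP[ab _]; suff -> : (ix (lo i0) b \in S) = false.
      by rewrite sub0r oppr_le0.
    by apply: contraNF loS; exact: (IH _ _ i0k (leqnn _)).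
  have left : forall a a' : 'I_m, (a' <= a)%N -> ix i a \in S -> ix i a' \in S.
    move=> a a'; apply: (@adjacent_lower _ (fun a => ix i a \in S)) => j hiS.
    apply: contraT => loS; case: (Hcol j (rev_ord i)).
    rewrite (bigD1 (rev_ord i)) //= rev_ordK hiS (negPf loS) big1 ?addr0 //.
    move=> b /andP[ib bi]; have bi' : (rev_ord b < i)%N.
      rewrite ltn_neqAle; apply/andP; split.
        by apply: contra bi => /eqP/val_inj <-; rewrite rev_ordK.
      by move: ib (ltn_ord b) (ltn_ord i) => /=; lia.
    have hS := vert _ _ bi' hiS; rewrite hS.
    by rewrite (IH (rev_ord b) _ _ _ (hi j)) ?subrr //= -?ik.
  rewrite leq_eqVlt => /orP[/eqP/val_inj ->|i'i]; first exact: left.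
  move=> a a' a'a iaS; have := vert _ _ i'i iaS.
  by apply: (IH i' i') => //; rewrite -ik.
have lam_lt (i : 'I_n) : (#|[set a : 'I_m | ix i a \in S]%SET| < m.+1)%N.
  by rewrite ltnS -[X in (_ <= X)%N]card_ord; exact: max_card.
pose f : {ffun 'I_n -> 'I_m.+1} := [ffun i => Ordinal (lam_lt i)].
have fP : [forall i : 'I_n, forall j : 'I_n, (i <= j)%N ==> (f j <= f i)%N].
  apply/forallP=> i; apply/forallP=> j; apply/implyP=> ij; rewrite !ffunE /=.
  apply/subset_leq_card/fintype.subsetP => a; rewrite !inE.
  exact: (lower n j i).
exists (exist _ f fP); apply/setP => x; have [i [a ->]] := ix_surj x.
rewrite in_young /part /= ffunE /= -lower_set_card ?inE // => a1 b ab.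
by rewrite !inE; exact: (lower n i i).
Qed.

End YoungDiagrams.

(** * The joint highest weight vectors of Fock space *)

Section FockDualPair.
Variables (F K : fieldType) (iota : {rmorphism {poly F} -> K}).
Hypothesis iota_inj : injective iota.
Hypothesis iota_frac :
  forall x : K, exists a b : {poly F}, b != 0 /\ x * iota b = iota a.
Local Notation q := (iota 'X).
Let q_neq0 : q != 0 := iotaX_neq0 iota_inj.

Lemma iotaX_gen (k : int) : q ^ k = 1 -> k = 0.
Proof.
have pos (l : nat) : q ^+ l = 1 -> l = 0%N.
  rewrite -rmorphXn -(rmorph1 iota) => /iota_inj /(congr1 (fun p : {poly F} => size p)).
  by rewrite size_polyXn size_poly1 => -[].
case: k => k; first by move=> /pos ->.
rewrite NegzE -exprnN => /eqP; rewrite invr_eq1 => /eqP /pos //.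
Qed.

Variables n m : nat.
Local Notation N := (n * m)%N.
Variable act : Clq q N -> Ext q N -> Ext q N.
Hypothesis actP : is_fock_action act.
Local Notation D := #|{: {set 'I_N}}|.
Local Notation fk := (fock q_neq0 actP).
Local Notation om := (@omega_mx K q N).
Local Notation ix := (@ix n m).
Local Notation lamE := (@lamE K q n m q_neq0 act actP).
Local Notation rhoE := (@rhoE K q n m q_neq0 act actP).
Local Notation hop := (hop_mx q_neq0 actP).
Variable lam : Uq q n -> Clq q N.
Hypothesis lamP : is_lambda lam.
Variable rho : Uq q m -> Clq q N.
Hypothesis rhoP : is_rho rho.
Let lam_morph : is_alg_morphism lam. Proof. by case: lamP. Qed.
Let rho_morph : is_alg_morphism rho. Proof. by case: rhoP. Qed.

Definition lam_mx a : 'M[K]_D := fk (lam a).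
Definition rho_mx a : 'M[K]_D := fk (rho a).

Definition row_ind (i : 'I_n) (x : 'I_N) : int := (row_of x == i)%:Z.
Definition col_ind (j : 'I_m) (x : 'I_N) : int := (col_of x == j)%:Z.

Lemma lam_mxD a b : lam_mx (a + b) = lam_mx a + lam_mx b.
Proof. by rewrite /lam_mx (alg_morphD lam_morph) fockD. Qed.
Lemma lam_mxZ c a : lam_mx (c *: a) = c *: lam_mx a.
Proof. by rewrite /lam_mx (alg_morphZ lam_morph) fockZ. Qed.
Lemma lam_mx1 : lam_mx 1 = 1%:M.
Proof. by rewrite /lam_mx (alg_morph1 lam_morph) fock1. Qed.
Lemma lam_mxM a b : lam_mx (a * b) = lam_mx a *m lam_mx b.
Proof. by rewrite /lam_mx (alg_morphM lam_morph) fockM. Qed.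
Lemma lam_mxE i : lam_mx (UE q i) = lamE i.
Proof. exact: lamE_eq. Qed.
Lemma lam_mxL i : lam_mx (UL q i) = om (fun x => - row_ind i x).
Proof. exact: lamL_eq. Qed.

Lemma rho_mxD a b : rho_mx (a + b) = rho_mx a + rho_mx b.
Proof. by rewrite /rho_mx (alg_morphD rho_morph) fockD. Qed.
Lemma rho_mxZ c a : rho_mx (c *: a) = c *: rho_mx a.
Proof. by rewrite /rho_mx (alg_morphZ rho_morph) fockZ. Qed.
Lemma rho_mx1 : rho_mx 1 = 1%:M.
Proof. by rewrite /rho_mx (alg_morph1 rho_morph) fock1. Qed.
Lemma rho_mxM a b : rho_mx (a * b) = rho_mx a *m rho_mx b.
Proof. by rewrite /rho_mx (alg_morphM rho_morph) fockM. Qed.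
Lemma rho_mxE j : rho_mx (UE q j) = rhoE j.
Proof. exact: rhoE_eq. Qed.
Lemma rho_mxL j : rho_mx (UL q j) = om (fun x => - col_ind j x).
Proof. exact: rhoL_eq. Qed.

Lemma lam_mxFT i : (lam_mx (UF q i))^T =
  q *: (om (fun x => row_ind (lo i) x - row_ind (hi i) x) *m lamE i).
Proof.
rewrite /lam_mx (lamF_eq q_neq0 actP lamP) linearZ /= trmx_mul trmxK om_tr.
rewrite (@eq_om _ _ _ (fun x => - row_gap i x)
  (fun x => row_ind (lo i) x - row_ind (hi i) x)); last first.
  by move=> x; rewrite /row_gap opprB.
rewrite [om _ *m lamE i](@om_row_gap _ _ _ _ _ _ _ _ (- 2)) => [|a]; last first.
  by rewrite /row_ind !ixE /= !eqxx !succE.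
rewrite scalerA -[q^-1]exprN1; congr (_ *: _).
by rewrite -[X in X * _]expr1z -expfzDr.
Qed.

Lemma rho_mxFT j : (rho_mx (UF q j))^T =
  q *: (om (fun x => col_ind (lo j) x - col_ind (hi j) x) *m rhoE j).
Proof.
rewrite /rho_mx (rhoF_eq q_neq0 actP rhoP) linearZ /= trmx_mul trmxK om_tr.
by congr (_ *: (_ *m _)); apply: eq_om => x; rewrite /col_gap opprB.
Qed.

Lemma om_lamE i k : exists d : int,
  om (row_ind k) *m lamE i = q ^ d *: (lamE i *m om (row_ind k)).
Proof.
eexists; apply: om_row_gap => a.
by rewrite /row_ind !ixE; reflexivity.
Qed.

Lemma om_rhoE j k : exists d : int,
  om (col_ind k) *m rhoE j = q ^ d *: (rhoE j *m om (col_ind k)).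
Proof.
eexists; apply: om_col_gap => a.
by rewrite /col_ind !ixE; reflexivity.
Qed.

Lemma row_rhoE k j : om (row_ind k) *m rhoE j = rhoE j *m om (row_ind k).
Proof.
rewrite (@om_col_gap _ _ _ _ _ _ _ _ 0) ?expr0z ?scale1r // => b.
by rewrite /row_ind !ixE subrr.
Qed.

Lemma col_lamE k i : om (col_ind k) *m lamE i = lamE i *m om (col_ind k).
Proof.
rewrite (@om_row_gap _ _ _ _ _ _ _ _ 0) ?expr0z ?scale1r // => b.
by rewrite /col_ind !ixE subrr.
Qed.

Let lam_comm := rep_comm q_neq0 lam_mxD lam_mxZ lam_mx1 lam_mxM lam_mxE lam_mxFT lam_mxL.
Let rho_comm := rep_comm q_neq0 rho_mxD rho_mxZ rho_mx1 rho_mxM rho_mxE rho_mxFT rho_mxL.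

Lemma comm_tr (a b : 'M[K]_D) : a *m b = b *m a -> a^T *m b^T = b^T *m a^T.
Proof. by move=> ab; rewrite -!trmx_mul ab. Qed.

(** Commutation is checked on generators; the transposes of the relations for the
E's cover those for the F's. *)
Lemma lam_rho_comm a b : lam_mx a *m rho_mx b = rho_mx b *m lam_mx a.
Proof.
apply/esym; move: b; apply: rho_comm => [j|j|k]; apply/esym; move: a; apply: lam_comm.
- by move=> i; exact: lamE_rhoE.
- by move=> i; rewrite -[rhoE j]trmxK; apply: comm_tr; exact: lamE_rhoE_tr.
- by move=> k; exact: row_rhoE.
- by move=> i; exact: lamE_rhoE_tr.
- by move=> i; apply: comm_tr; exact: lamE_rhoE.
- by move=> k; rewrite -[om _]om_tr; apply: comm_tr; exact: row_rhoE.
- by move=> i; rewrite col_lamE.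
- by move=> i; rewrite -[om _]om_tr; apply/comm_tr/esym; exact: col_lamE.
- by move=> k'; exact: omC.
Qed.

Definition yvec (mu : rect n m) : 'cV[K]_D := bvec K (young mu).

Lemma yvec_orth mu nu : dot (yvec mu) (yvec nu) = (mu == nu)%:R.
Proof. by rewrite -coE /co bvecE (inj_eq (@young_inj n m)). Qed.

Lemma om_yvec g mu : om g *m yvec mu = q ^ (- \sum_(x in young mu) g x) *: yvec mu.
Proof. exact: om_bvec. Qed.

Lemma hop_bvec0 x y (S : {set 'I_N}) : x != y -> (y \in S -> x \in S) -> hop x y *m bvec K S = 0.
Proof.
move=> xy h; rewrite /hop_mx -mulmxA psi_bvec; case: ifP => [/h xS|_]; last exact: mulmx0.
by rewrite -scalemxAr psid_bvec in_setD1 xy xS scaler0.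
Qed.

Lemma lamE_yvec mu i : lamE i *m yvec mu = 0.
Proof.
rewrite /lamE mulmx_suml big1 // => a _; rewrite -mulmxA om_yvec -scalemxAr.
rewrite hop_bvec0 ?scaler0 ?eq_ix ?ixE /= ?succE // !in_young => /leq_trans; apply.
exact: part_le.
Qed.

Lemma rhoE_yvec mu j : rhoE j *m yvec mu = 0.
Proof.
rewrite /rhoE mulmx_suml big1 // => b _; rewrite -mulmxA om_yvec -scalemxAr.
rewrite hop_bvec0 ?scaler0 ?eq_ix ?ixE /= ?succE ?andbF // !in_young /=.
exact: ltnW.
Qed.

Lemma sum_row_ind mu i : \sum_(x in young mu) row_ind i x = (part mu i)%:Z.
Proof.
under eq_bigr => x _ do
  rewrite /row_ind -[(row_of x == i)]andbT -(sum_dlt_col (fun=> true)).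
rewrite exchange_big /=; under eq_bigr do rewrite sum_dlt in_young.
rewrite -[in RHS](@card_below m (part mu i)) ?part_lem // -sum1_card.
rewrite (big_morph Posz PoszD (erefl _)) [RHS]big_mkcond /=.
by apply: eq_bigr => a _; rewrite inE; case: (_ < _)%N.
Qed.

Lemma sum_col_ind mu j : \sum_(x in young mu) col_ind j x = (conj_part mu j)%:Z.
Proof.
under eq_bigr => x _ do
  rewrite /col_ind -[(col_of x == j)]andTb -(sum_dlt_row (fun=> true)).
rewrite exchange_big /=; under eq_bigr do rewrite sum_dlt in_young.
rewrite /conj_part -sum1_card.
rewrite (big_morph Posz PoszD (erefl _)) [RHS]big_mkcond /=.
by apply: eq_bigr => a _; rewrite inE; case: (_ < _)%N.
Qed.

Lemma lamL_yvec mu i : lam_mx (UL q i) *m yvec mu = q ^+ part mu i *: yvec mu.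
Proof. by rewrite lam_mxL om_yvec sumrN opprK sum_row_ind. Qed.

Lemma rhoL_yvec mu j : rho_mx (UL q j) *m yvec mu = q ^+ conj_part mu j *: yvec mu.
Proof. by rewrite rho_mxL om_yvec sumrN opprK sum_col_ind. Qed.

(** Every hop in a raising operator moves a particle one step towards the corner,
so that the raising operators lower the degree by 1. *)
Definition degree (S : {set 'I_N}) : nat := \sum_(x in S) (row_of x + col_of x)%N.

Definition lowers (k : nat) (a : 'M[K]_D) : Prop :=
  forall S T, (degree S + k)%N != degree T -> a (enum_rank S) (enum_rank T) = 0.

Lemma lowers_sum k (J : Type) (s : seq J) (f : J -> 'M[K]_D) :
  (forall j, lowers k (f j)) -> lowers k (\sum_(j <- s) f j).
Proof. by move=> fk S T ST; rewrite summxE big1 // => j _; exact: fk. Qed.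

Lemma lowersZ k c a : lowers k a -> lowers k (c *: a).
Proof. by move=> h S T ST; rewrite mxE h ?mulr0. Qed.

Lemma lowersM k l a b : lowers k a -> lowers l b -> lowers (k + l) (a *m b).
Proof.
move=> ha hb S T ST; rewrite mxE big1 // => j _; rewrite -[j]enum_valK.
have [Sj|/ha ->] := eqVneq (degree S + k)%N (degree (enum_val j)); last by rewrite mul0r.
by rewrite (hb (enum_val j)) ?mulr0 // -Sj -addnA.
Qed.

Lemma lowers_om g : lowers 0 (om g).
Proof.
move=> S T; rewrite addn0 => ST; rewrite /omega_mx !mxE (inj_eq enum_rank_inj).
by have [E|_] := eqVneq S T; [rewrite E eqxx in ST|rewrite mulr0n].
Qed.

Lemma lowers_hop x y : x != y ->
  (row_of x + col_of x).+1 = (row_of y + col_of y)%N -> lowers 1 (hop x y).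
Proof.
move=> xy deg S T ST.
have -> : hop x y (enum_rank S) (enum_rank T) = co (hop x y *m bvec K T) S.
  by rewrite /co -colE [RHS]mxE.
rewrite co_hop //; case: ifP => // /andP[xS yS].
rewrite /co bvecE; case: eqP => [E|_]; last by rewrite mulr0.
case/eqP: ST; rewrite -E /degree (big_setD1 x xS) /=.
rewrite big_setU1 ?in_setD1 ?(negPf yS) ?andbF //= -deg.
by rewrite addn1 addSn.
Qed.

Lemma lowers_lamE i : lowers 1 (lamE i).
Proof.
apply: lowers_sum => a; rewrite -[1%N]addn0; apply: lowersM; last exact: lowers_om.
by apply: lowers_hop; rewrite ?eq_ix !ixE /= ?succE.
Qed.

Lemma lowers_rhoE j : lowers 1 (rhoE j).
Proof.
apply: lowers_sum => b; rewrite -[1%N]addn0; apply: lowersM; last exact: lowers_om.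
by apply: lowers_hop; rewrite ?eq_ix !ixE /= ?succE ?andbF ?addnS.
Qed.

Lemma lowers_nilpotent : exists B, forall s : seq 'M[K]_D,
  (forall a, a \in s -> lowers 1 a) -> (B < size s)%N -> foldr mulmx 1%:M s = 0.
Proof.
exists (degree [set: 'I_N]%SET) => s sP sB.
have : lowers (size s) (foldr mulmx 1%:M s).
  elim: s sP {sB} => [|a s IH] sP /=.
    by rewrite -(@om0 K q N); exact: lowers_om.
  rewrite -add1n; apply: lowersM; first by apply: sP; rewrite mem_head.
  by apply: IH => b bs; apply: sP; rewrite inE bs orbT.
move=> h; apply/matrixP=> i j; rewrite -[ i ]enum_valK -[j]enum_valK h ?mxE //.
rewrite eq_sym neq_ltn; apply/orP; left; apply: leq_trans (leq_addl _ _).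
apply: leq_ltn_trans sB; rewrite /degree [X in (_ <= X)%N](big_setID (enum_val j)).
by rewrite /= finset.setTI leq_addr.
Qed.

Lemma lowers_tr w (f : 'M[K]_D) c (a : 'M[K]_D) :
  f^T = c *: (om w *m a) -> lowers 1 a -> lowers 1 f^T.
Proof.
by move=> -> ha; apply: lowersZ; rewrite -[1%N]add0n; apply: lowersM => //; exact: lowers_om.
Qed.

(** At q = 0 a joint highest weight vector is supported on the sets that satisfy
the ballot condition for all rows and columns, that is on Young diagrams. The
factors kappa extend over the later columns in lambda and over the earlier rows
in rho; for the latter the order of the rows is reversed to apply [ballot]. *)
Lemma joint_hw_young x : (forall i, lamE i *m x = 0) -> (forall j, rhoE j *m x = 0) ->
  (forall mu, co x (young mu) = 0) -> x = 0.
Proof.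
move=> lx rx yx; apply/eqP; apply: contraT => x0.
have [S0 xS0] : exists S, co x S != 0.
  apply/existsP; apply: contraNT x0 => /existsPn h; apply/eqP/matrixP=> i k.
  by rewrite ord1 -[ i ]enum_valK [RHS]mxE; apply/eqP/negPn/h.
have [s [p [s0 pE [S pS]]]] := exists_local_scaling iota_inj iota_frac (c := co x) xS0.
have [mu Smu] : exists mu, S = young mu.
  apply: ballot_young => [i z|j z] neg; case/eqP: pS.
  - apply: (@ballot _ _ iota iota_inj n m q_neq0 act actP _ (fun a => ix (lo i) a)
      (fun a => ix (hi i) a) _ _ _ x (row_wt i) s p _ (lx i) pE S z neg).
    + by move=> a b /eqP; rewrite eq_ix !ixE eqxx => /eqP/val_inj.
    + by move=> a b /eqP; rewrite eq_ix !ixE eqxx => /eqP/val_inj.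
    + by move=> a b; rewrite eq_ix !ixE /= succE.
    + move=> a c; rewrite sumrB !(sum_dlt_col (fun b => a < b)%N) /row_wt /row_gap /=.
      by case: (a < _)%N; rewrite ?mul1r ?mul0r ?andbT ?andbF.
  - apply: (@ballot _ _ iota iota_inj n m q_neq0 act actP _ (fun b => ix (rev_ord b) (lo j))
      (fun b => ix (rev_ord b) (hi j)) _ _ _ x (fun b => col_wt j (rev_ord b)) s p _ _ pE S z neg).
    + by move=> a b /eqP; rewrite eq_ix !ixE eqxx andbT => /eqP/val_inj/rev_ord_inj.
    + by move=> a b /eqP; rewrite eq_ix !ixE eqxx andbT => /eqP/val_inj/rev_ord_inj.
    + by move=> a b; rewrite eq_ix !ixE /= succE andbF.
    + move=> a c; rewrite (reindex_inj rev_ord_inj) /=.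
      rewrite (eq_bigl (fun b : 'I_n => (b < rev_ord a)%N)); last first.
        by move=> b /=; move: (ltn_ord a) (ltn_ord b) => /=; lia.
      under eq_bigr do rewrite rev_ordK.
      rewrite sumrB !(sum_dlt_row (fun b => b < rev_ord a)%N) /col_wt /col_gap.
      by case: (_ < _)%N; rewrite ?mul1r ?mul0r.
    + rewrite -[RHS](rx j); congr (_ *m _); rewrite /rhoE [RHS](reindex_inj rev_ord_inj).
      by apply: eq_bigr.
case/eqP: pS; have := pE S; rewrite Smu yx mulr0 => /esym /eqP.
by rewrite -(rmorph0 iota) (inj_eq iota_inj) => /eqP ->; rewrite horner0.
Qed.

Theorem fock_dual_pair : dual_pair yvec
  (fun x => exists a, x = lam_mx a) lamE (fun i => lam_mx (UF q i))
  (fun i => lam_mx (UL q i)) (fun mu i => q ^+ part mu i)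
  (fun x => exists a, x = rho_mx a) rhoE (fun i => rho_mx (UF q i))
  (fun i => rho_mx (UL q i)) (fun mu i => q ^+ conj_part mu i).
Proof.
split.
- apply: (rep_side q_neq0 iotaX_gen lam_mxD lam_mxZ lam_mx1 lam_mxM q_neq0
    lam_mxE lam_mxFT lam_mxL om_lamE lamE_yvec lamL_yvec).
  exact: part_sep.
- apply: (rep_side q_neq0 iotaX_gen rho_mxD rho_mxZ rho_mx1 rho_mxM q_neq0
    rho_mxE rho_mxFT rho_mxL om_rhoE rhoE_yvec rhoL_yvec).
  exact: conj_part_sep.
- by move=> _ _ [a ->] [b ->]; exact: lam_rho_comm.
- exact: yvec_orth.
- have [B nilB] := lowers_nilpotent; exists B => s sN; apply: nilB => a /sN[] [i [->|->]].
  + exact: lowers_lamE.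
  + by apply: lowers_tr (lam_mxFT i) _; exact: lowers_lamE.
  + exact: lowers_rhoE.
  + by apply: lowers_tr (rho_mxFT i) _; exact: lowers_rhoE.
- move=> x lx rx; exists (fun mu => co x (young mu)).
  apply/eqP; rewrite -subr_eq0; apply/eqP; apply: joint_hw_young.
  + move=> i; rewrite mulmxBr lx mulmx_sumr big1 ?subr0 // => mu _.
    by rewrite -scalemxAr lamE_yvec scaler0.
  + move=> i; rewrite mulmxBr rx mulmx_sumr big1 ?subr0 // => mu _.
    by rewrite -scalemxAr rhoE_yvec scaler0.
  + move=> mu; have coB y z S : co (y - z) S = co y S - co z S by rewrite /co !mxE.
    rewrite coB co_sum (bigD1 mu) //= big1 => [|nu /negPf ne].
      by rewrite addr0 /co mxE -/(co (yvec mu) _) coE yvec_orth eqxx mulr1 subrr.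
    by rewrite /co mxE -/(co (yvec nu) _) coE yvec_orth eq_sym ne mulr0.
Qed.

End FockDualPair.

(** * Irreducible highest weight modules as matrix representations *)

Section CyclicModules.
Variables (K : fieldType) (q : K) (p : nat).
Hypothesis q_neq0 : q != 0.
Hypothesis q_gen : forall k : int, q ^ k = 1 -> k = 0.
Local Notation mx_act r := (fun a (x : 'cV_ _) => r a *m x).

(** Equivalently, the submodule generated by z is zero or simple. *)
Definition cyclic_simple_vector D (r : Uq q p -> 'M[K]_D) (z : 'cV[K]_D) :=
  forall a, r a *m z != 0 -> exists b, r b *m (r a *m z) = z.

(** The module generated by z, transported to column vectors by means of a basis R
of it. *)
Lemma irr_of_vector D (r : Uq q p -> 'M[K]_D) mu z : is_rep (mx_act r) ->
    hw_vector (mx_act r) mu z -> z != 0 -> cyclic_simple_vector r z ->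
  exists d (r' : Uq q p -> 'M[K]_d), is_irr_hw mu r'.
Proof.
move=> rP zP z0 simp.
have [|B BP] := @subspace_row K D (fun y => exists a, y^T = r a *m z).
  split=> [|x y [a xE] [b yE]|c x [a xE]].
  - by exists 0; rewrite trmx0 (rep0l rP).
  - by exists (a + b); rewrite linearD /= xE yE (repDl rP).
  - by exists (c *: a); rewrite linearZ /= xE (repZl rP).
have [d [R [Rfree RB]]] : exists d (R : 'M[K]_(d, D)), row_free R /\ (R :=: B)%MS.
  by exists (\rank B), (row_base B); split; [exact: row_base_free|exact: eq_row_base].
pose th (y : 'cV[K]_d) : 'cV[K]_D := R^T *m y.
have thI : injective th.
  move=> x y /(congr1 trmx); rewrite !trmx_mul trmxK.
  by move=> e; apply: trmx_inj; exact: (row_free_inj Rfree e).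
have thP x : (exists y, th y = x) <-> exists a, x = r a *m z.
  split=> [[y <-]|[a xE]].
    suff /BP[a yE] : ((th y)^T <= B)%MS by exists a; rewrite -yE trmxK.
    by rewrite trmx_mul trmxK -RB submxMl.
  have : (x^T <= R)%MS by rewrite RB; apply/BP; exists a; rewrite trmxK.
  by move=> /submxP[y yE]; exists y^T; rewrite /th -trmx_mul -yE trmxK.
pose r' a : 'M[K]_d := (R *m (r a)^T *m pinvmx R)^T.
have thr a y : th (r' a *m y) = r a *m th y.
  rewrite /th !mulmxA -trmx_mul mulmxKpV; first by rewrite trmx_mul trmxK.
  apply/row_subP=> i; rewrite row_mul RB; apply/BP.
  have /thP[b bE] : exists y, th y = (row i R)^T.
    by exists (delta_mx i 0); rewrite /th -colE tr_row.
  by exists (a * b); rewrite trmx_mul trmxK bE (repM rP).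
have thD x y : th (x + y) = th x + th y by rewrite /th mulmxDr.
have thZ c x : th (c *: x) = c *: th x by rewrite /th scalemxAr.
have [u uE] : exists u, th u = z by apply/thP; exists 1; rewrite (rep1 rP).
have r'P : is_rep (mx_act r').
  split=> [a c x y|x c a b|x|a b x]; apply: thI.
  - by rewrite thr !thD !thZ !thr (repDv rP) (repZv rP).
  - by rewrite thr !thD !thZ !thr (repDl rP) (repZl rP).
  - by rewrite thr (rep1 rP).
  - by rewrite !thr (repM rP).
have th0 : th 0 = 0 by exact: mulmx0.
exists d, r'; split=> //.
- split=> //.
  + by move=> h; have : [set: 'cV[K]_d]%classic u by []; rewrite h /= => u0;
      move: z0; rewrite -uE u0 th0 eqxx.
  + move=> T [T0 TD TZ Tr] _.
    have [[y [Ty y0]]|noy] := pselect (exists y, T y /\ y != 0); [right|left].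
      have [a aE] : exists a, th y = r a *m z by apply/thP; exists y.
      have az : r a *m z != 0 by rewrite -aE -th0 (inj_eq thI).
      have [b bE] := simp _ az.
      have Tu : T u.
        rewrite (_ : u = r' b *m y); first exact: (Tr b).
        by apply: thI; rewrite thr aE bE.
      apply/seteqP; split=> // w _.
      have [c cE] : exists c, th w = r c *m z by apply/thP; exists w.
      rewrite (_ : w = r' c *m u); first exact: (Tr c).
      by apply: thI; rewrite thr uE.
    apply/seteqP; split=> y /=; last by move=> ->.
    by move=> Ty; apply/eqP; apply: contrapT => /negP y0; apply: noy; exists y.
- exists u; split=> [i|i|w].
  + by apply: thI; rewrite thr uE th0; exact: (hw_E zP).
  + by apply: thI; rewrite thr thZ uE; exact: (hw_L zP).
  + have [c cE] : exists c, th w = r c *m z by apply/thP; exists w.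
    by exists c; apply: thI; rewrite thr uE.
Qed.

Lemma irr_hw_vector d (r : Uq q p -> 'M[K]_d) mu : is_irr_hw mu r ->
  exists u, [/\ hw_vector (mx_act r) mu u, u != 0, cyclic_simple_vector r u
    & forall w, exists a, w = r a *m u].
Proof.
case=> rP [_ nz simp] [u [Eu Lu cyc]]; exists u; split=> //.
- apply/eqP=> u0; apply: nz; apply/seteqP; split=> w /=; last by [].
  by have [a ->] := cyc w; rewrite u0 mulmx0.
- move=> a au; pose T w := exists b, w = r b *m (r a *m u).
  have [||T0|TT] := simp T.
  + split=> [|_ _ [b ->] [c ->]|c _ [b ->]|b _ [c ->]].
    * by exists 0; rewrite (rep0l rP).
    * by exists (b + c); rewrite (repDl rP).
    * by exists (c *: b); rewrite (repZl rP).
    * by exists (b * c); rewrite (repM rP).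
  + by [].
  + have : T (r a *m u) by exists 1; rewrite (rep1 rP).
    by rewrite T0 /= => /eqP; rewrite (negPf au).
  + have : T u by rewrite TT.
    by case=> b bE; exists b; exact/esym.
Qed.

(** The annihilators of u and z agree, so r' a u |-> r a z is well defined; a basis
of the irreducible module written as elements r' (a j) u gives the columns
r (a j) z of the matrix T of this map. *)
Lemma irr_embedding D (r : Uq q p -> 'M[K]_D) d (r' : Uq q p -> 'M[K]_d) mu z u :
    is_rep (mx_act r) -> hw_vector (mx_act r) mu z -> z != 0 ->
    cyclic_simple_vector r z ->
    is_rep (mx_act r') -> hw_vector (mx_act r') mu u -> u != 0 ->
    cyclic_simple_vector r' u -> (forall w, exists a, w = r' a *m u) ->
  (forall a, r' a *m u = 0 <-> r a *m z = 0) /\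
  exists T : 'M[K]_(D, d), forall a, T *m (r' a *m u) = r a *m z.
Proof.
move=> rP zP z0 zS r'P uP u0 uS cyc.
have ann a : r' a *m u = 0 <-> r a *m z = 0.
  split.
    exact: (hw_annihilator q_neq0 q_gen r'P rP uP zP u0 z0 (zS a)).
  exact: (hw_annihilator q_neq0 q_gen rP r'P zP uP z0 u0 (uS a)).
split=> //.
have /choice [a aP] : forall j : 'I_d, exists a, delta_mx j (0 : 'I_1) = r' a *m u.
  by move=> j; exact: cyc.
exists (\matrix_(i, j) (r (a j) *m z) i 0) => b.
pose y := r' b *m u; pose c := \sum_j y j 0 *: a j.
have yE : r' c *m u = y.
  rewrite (rep_suml r'P) [RHS]matrix_sum_delta; apply: eq_bigr => j _.
  by rewrite (repZl r'P) -aP big_ord1.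
have /ann : r' (b - c) *m u = 0 by rewrite (repBl r'P) yE subrr.
rewrite (repBl rP) => /eqP; rewrite subr_eq0 => /eqP ->.
rewrite (rep_suml rP); apply/matrixP=> i k; rewrite ord1 !mxE summxE.
by apply: eq_bigr => j _; rewrite (repZl rP) !mxE mulrC -/y; congr (_ * _); rewrite !mxE.
Qed.

End CyclicModules.

(** * Tensor products inside a dual pair *)

Section TensorEmbedding.
Variables (K : fieldType) (q : K) (n m D : nat) (M : finType).
Hypothesis q_neq0 : q != 0.
Hypothesis q_gen : forall k : int, q ^ k = 1 -> k = 0.
Variables (v : M -> 'cV[K]_D) (r : Uq q n -> 'M[K]_D) (r' : Uq q m -> 'M[K]_D).
Local Notation mx_act r := (fun a (x : 'cV_ _) => r a *m x).
Hypotheses (rP : is_rep (mx_act r)) (r'P : is_rep (mx_act r')).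
Variables (F : 'I_n.-1 -> 'M[K]_D) (L : 'I_n -> 'M[K]_D) (chi : M -> 'I_n -> K).
Variables (F' : 'I_m.-1 -> 'M[K]_D) (L' : 'I_m -> 'M[K]_D) (chi' : M -> 'I_m -> K).
Let A x := exists a, x = r a.
Let A' x := exists a, x = r' a.
Hypothesis rr' : dual_pair v A (fun i => r (UE q i)) F L chi
  A' (fun i => r' (UE q i)) F' L' chi'.
Variables (wt : M -> 'I_n -> nat) (wt' : M -> 'I_m -> nat).
Hypothesis rL : forall t i, r (UL q i) *m v t = q ^+ wt t i *: v t.
Hypothesis r'L : forall t i, r' (UL q i) *m v t = q ^+ wt' t i *: v t.
Local Notation joint_mod := (joint_mod v A A').

Lemma vacuum_neq0 t : v t != 0.
Proof.
apply/eqP=> v0; have /eqP := pair_orth rr' t t.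
by rewrite v0 dot0r eqxx eq_sym oner_eq0.
Qed.

Lemma vacuum_hw t : hw_vector (mx_act r) (wt t) (v t).
Proof. by split=> i; [exact: (side_hw (pair_l rr'))|exact: rL]. Qed.

Lemma vacuum_hw' t : hw_vector (mx_act r') (wt' t) (v t).
Proof. by split=> i; [exact: (side_hw (pair_r rr'))|exact: r'L]. Qed.

Lemma vacuum_simple t : cyclic_simple_vector r (v t).
Proof.
move=> a az; have Aa : A (r a) by exists a.
by have [_ [[b ->] bE]] := cyclic_simple rr' Aa az; exists b.
Qed.

Lemma vacuum_simple' t : cyclic_simple_vector r' (v t).
Proof.
move=> a az; have Aa : A' (r' a) by exists a.
by have [_ [[b ->] bE]] := cyclic_simple (dual_pair_sym rr') Aa az; exists b.
Qed.

Lemma vacuum_irr t : exists d (s : Uq q n -> 'M[K]_d), is_irr_hw (wt t) s.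
Proof. exact: (irr_of_vector rP (vacuum_hw t) (vacuum_neq0 t) (@vacuum_simple t)). Qed.

Lemma vacuum_irr' t : exists d (s : Uq q m -> 'M[K]_d), is_irr_hw (wt' t) s.
Proof. exact: (irr_of_vector r'P (vacuum_hw' t) (vacuum_neq0 t) (@vacuum_simple' t)). Qed.

(** The tensor product is the space of d x d' matrices. The map phi sends the
tensor of s a u and s' b u' to r a r' b (v t): T embeds the first factor by
u |-> v t, and b j carries u' to the j-th basis vector of the second. A nonzero
kernel would contain, by nilpotency of the E_i of the first factor, a nonzero
matrix all of whose columns are multiples of u, that is a tensor of u with some
vector w; as w generates u', the kernel would contain the tensor of u and u',
whose image is v t. *)
Lemma tensor_embedding t d (s : Uq q n -> 'M[K]_d) d' (s' : Uq q m -> 'M[K]_d') :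
    is_irr_hw (wt t) s -> is_irr_hw (wt' t) s' ->
  exists phi : 'M[K]_(d, d') -> 'cV[K]_D,
    [/\ linear phi, forall x, joint_mod t (phi x) /\ (phi x = 0 -> x = 0),
        forall y, joint_mod t y -> exists x, phi x = y,
        forall a x, phi (s a *m x) = r a *m phi x
      & forall b x, phi (x *m (s' b)^T) = r' b *m phi x].
Proof.
move=> sirr s'irr.
have sP : is_rep (mx_act s) by case: sirr.
have s'P : is_rep (mx_act s') by case: s'irr.
have [u [uP u0 uS ucyc]] := irr_hw_vector sirr.
have [u' [u'P u'0 u'S u'cyc]] := irr_hw_vector s'irr.
have [ann [T TE]] := irr_embedding q_neq0 q_gen rP (vacuum_hw t) (vacuum_neq0 t)
  (@vacuum_simple t) sP uP u0 uS ucyc.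
have [ann' _] := irr_embedding q_neq0 q_gen r'P (vacuum_hw' t) (vacuum_neq0 t)
  (@vacuum_simple' t) s'P u'P u'0 u'S u'cyc.
have Ts a (y : 'cV_d) : T *m (s a *m y) = r a *m (T *m y).
  have [b ->] := ucyc y; rewrite TE -(repM sP) TE; exact: (repM rP).
have Tu : T *m u = v t by rewrite -{1}(rep1 sP u) TE (rep1 rP).
have comm a b (y : 'cV_D) : r a *m (r' b *m y) = r' b *m (r a *m y).
  by rewrite !mulmxA (pair_comm rr') //; [exists a|exists b].
have T0 (y : 'cV_d) : T *m y = 0 -> y = 0.
  by have [a ->] := ucyc y; rewrite TE => /ann.
(* r' acts on the image of T through the action of s' on u' *)
have ann'T b (y : 'cV_d) : s' b *m u' = 0 -> r' b *m (T *m y) = 0.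
  by have [a ->] := ucyc y => /ann' b0; rewrite TE -comm b0 mulmx0.
have /choice [b bP] : forall j : 'I_d', exists b, delta_mx j (0 : 'I_1) = s' b *m u'.
  by move=> j; exact: u'cyc.
pose phi (x : 'M[K]_(d, d')) := \sum_j r' (b j) *m (T *m col j x).
have phiL : linear phi.
  move=> c x y; rewrite /phi scaler_sumr -big_split; apply: eq_bigr => j _.
  by rewrite linearP /= mulmxDr -scalemxAr mulmxDr -scalemxAr.
have phi_l a x : phi (s a *m x) = r a *m phi x.
  rewrite /phi mulmx_sumr; apply: eq_bigr => j _; rewrite comm; congr (_ *m _).
  rewrite -Ts; congr (_ *m _); apply/matrixP=> i k; rewrite !mxE.
  by apply: eq_bigr => l _; rewrite !mxE.
have coef c (y : 'cV_d') : s' c *m u' = y ->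
    forall w : 'cV_d, r' c *m (T *m w) = \sum_j y j 0 *: (r' (b j) *m (T *m w)).
  move=> cE w; have e : s' (c - \sum_j y j 0 *: b j) *m u' = 0.
    rewrite (repBl s'P) cE (rep_suml s'P) [X in X - _]matrix_sum_delta.
    apply/eqP; rewrite subr_eq0; apply/eqP/eq_bigr => j _.
    by rewrite big_ord1 (repZl s'P) bP.
  have /eqP := ann'T _ w e; rewrite (repBl r'P) subr_eq0 => /eqP ->.
  by rewrite (rep_suml r'P); apply: eq_bigr => j _; rewrite (repZl r'P).
have phi_r c x : phi (x *m (s' c)^T) = r' c *m phi x.
  rewrite /phi mulmx_sumr.
  have -> : \sum_j r' (b j) *m (T *m col j (x *m (s' c)^T)) =
      \sum_j \sum_k (s' c) j k *: (r' (b j) *m (T *m col k x)).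
    apply: eq_bigr => j _; have -> : col j (x *m (s' c)^T) = \sum_k s' c j k *: col k x.
      apply/matrixP=> i l; rewrite summxE !mxE; apply: eq_bigr => k _.
      by rewrite !mxE mulrC.
    by rewrite !mulmx_sumr; apply: eq_bigr => k _; rewrite -!scalemxAr.
  rewrite exchange_big; apply: eq_bigr => k _ /=.
  rewrite -[RHS](repM r'P) (@coef _ (col k (s' c))).
    by apply: eq_bigr => j _; rewrite mxE.
  by rewrite (repM s'P) -bP colE.
have phi_u : phi (u *m u'^T) = v t.
  rewrite -(rep1 r'P (v t)) -Tu (@coef 1 u') ?(rep1 s'P) //; apply: eq_bigr => j _.
  have -> : col j (u *m u'^T) = u' j 0 *: u.
    by apply/matrixP=> i k; rewrite ord1 !mxE big_ord1 !mxE mulrC.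
  by rewrite -!scalemxAr.
have phi0 : phi 0 = 0.
  by rewrite /phi big1 // => j _; rewrite col0 !mulmx0.
exists phi; split=> //.
- move=> x; split.
    refine (subspace_sum _ (joint_mod_sub rr' t) _) => j _.
    have [a ->] := ucyc (col j x); rewrite TE.
    apply: (joint_mod_r rr'); first by exists (b j).
    by apply: (joint_mod_l rr'); [exists a|exact: (joint_mod_v rr')].
  move=> px; apply/eqP; apply: contraT => x0.
  (* the kernel is moved to D x d' matrices by T, so that pair_nil_l applies;
     there the E' act by zero *)
  pose S (X : 'M[K]_(D, d')) := exists y, X = T *m y /\ phi y = 0.
  have Tx0 : T *m x != 0.
    apply: contraNneq x0 => Tx; apply/eqP/matrixP=> i j.
    have /T0/matrixP/(_ i 0) : T *m col j x = 0 by rewrite colE mulmxA Tx mul0mx.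
    by rewrite !mxE.
  have Sx : S (T *m x) by exists x.
  have [||X [[y [-> py]] Ty0 [ETy _]]] := pair_nil_l rr' (S := S) _ _ Sx Tx0.
  + move=> i _ [y [-> py]]; exists (s (UE q i) *m y); rewrite phi_l py mulmx0.
    split=> //; apply: mulmx_ext => w; rewrite -!mulmxA Ts //.
  + move=> i _ [y [-> py]]; exists 0; rewrite phi0 mulmx0; split=> //.
    apply: mulmx_ext => w; rewrite mul0mx -!mulmxA.
    apply: ann'T; exact: (hw_E u'P).
  have /choice [c cP] : forall j, exists c : K, col j y = c *: u.
    move=> j; have [a aE] := ucyc (col j y).
    have hwa : hw (fun i => r (UE q i)) (r a *m v t).
      move=> i; rewrite -TE -aE; have := ETy i; rewrite mulmxA => e.
      by rewrite colE !mulmxA e mul0mx.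
    have := hw_vacuum rr' (ex_intro _ a erefl) hwa; set c := dot _ _ => cE.
    exists c; apply/eqP; rewrite -subr_eq0; apply/eqP/T0.
    by rewrite mulmxBr -scalemxAr Tu aE TE cE subrr.
  pose w := \col_j c j.
  have yE : y = u *m w^T.
    apply/matrixP=> i j; have /matrixP/(_ i 0) := cP j.
    by rewrite !mxE big_ord1 !mxE mulrC.
  have w0 : w != 0.
    by apply: contraNneq Ty0 => w0; rewrite yE w0 trmx0 !mulmx0.
  have [e eE] := u'cyc w.
  have : r' e *m v t != 0 by apply: contraNneq w0 => /ann' e0; rewrite eE e0.
  move=> /vacuum_simple'[f fE]; have : s' (f * e) *m u' = u'.
    have /ann' : r' (f * e - 1) *m v t = 0.
      by rewrite (repBl r'P) (rep1 r'P) (repM r'P) fE subrr.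
    by rewrite (repBl s'P) (rep1 s'P) => /eqP; rewrite subr_eq0 => /eqP.
  rewrite (repM s'P) -eE => fw.
  have := phi_r f y; rewrite py mulmx0 yE -mulmxA -trmx_mul fw phi_u => /eqP.
  by rewrite (negPf (vacuum_neq0 t)).
- move=> y; elim=> [|_ _ z [a ->] [c ->] _ [x xE]]; first by exists 0.
  exists (s a *m (u *m u'^T *m (s' c)^T) + x).
  by rewrite -[s a *m _]scale1r phiL scale1r phi_l phi_r phi_u xE mulmxA.
Qed.

End TensorEmbedding.

Local Open Scope classical_set_scope.

(** * Skew Howe duality *)

Section SkewHoweDuality.
Variables (F K : fieldType) (iota : {rmorphism {poly F} -> K}).
Hypothesis iota_inj : injective iota.
Hypothesis iota_frac :
  forall x : K, exists a b : {poly F}, b != 0 /\ x * iota b = iota a.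
Local Notation q := (iota 'X).
Let q_neq0 : q != 0 := iotaX_neq0 iota_inj.
Let q_gen : forall k : int, q ^ k = 1 -> k = 0 := iotaX_gen iota_inj.
Variables n m : nat.
Local Notation N := (n * m)%N.
Variable act : Clq q N -> Ext q N -> Ext q N.
Hypothesis actP : is_fock_action act.
Variable lam : Uq q n -> Clq q N.
Hypothesis lamP : is_lambda lam.
Variable rho : Uq q m -> Clq q N.
Hypothesis rhoP : is_rho rho.
Local Notation D := #|{: {set 'I_N}}|.
Local Notation r := (@lam_mx F K iota iota_inj n m act actP lam).
Local Notation r' := (@rho_mx F K iota iota_inj n m act actP rho).
Local Notation v := (@yvec K n m).
Local Notation fvec := (@fvec K q N).
Let actL a := act (lam a).
Let actR b := act (rho b).
Let A x := exists a, x = r a.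
Let A' x := exists a, x = r' a.

Lemma fvec_l a x : fvec (r a *m x) = actL a (fvec x).
Proof. exact: fockE. Qed.

Lemma fvec_r b x : fvec (r' b *m x) = actR b (fvec x).
Proof. exact: fockE. Qed.

Let fvecI : injective fvec := fvec_inj actP.

Lemma howe_pair : dual_pair v A (fun i => r (UE q i)) (fun i => r (UF q i))
  (fun i => r (UL q i)) (fun mu i => q ^+ part mu i)
  A' (fun i => r' (UE q i)) (fun i => r' (UF q i))
  (fun i => r' (UL q i)) (fun mu i => q ^+ conj_part mu i).
Proof.
have -> : (fun i => r (UE q i)) = lamE (iotaX_neq0 iota_inj) actP.
  by apply/funext => i; exact: (lam_mxE iota_inj actP lamP).
have -> : (fun i => r' (UE q i)) = rhoE (iotaX_neq0 iota_inj) actP.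
  by apply/funext => i; exact: (rho_mxE iota_inj actP rhoP).
exact: (fock_dual_pair iota_inj iota_frac actP lamP rhoP).
Qed.

Lemma rep_lam : is_rep (fun a (x : 'cV_D) => r a *m x).
Proof.
exact: (rep_matrix (lam_mxD iota_inj actP lamP) (lam_mxZ iota_inj actP lamP)
  (lam_mx1 iota_inj actP lamP) (lam_mxM iota_inj actP lamP)).
Qed.

Lemma rep_rho : is_rep (fun a (x : 'cV_D) => r' a *m x).
Proof.
exact: (rep_matrix (rho_mxD iota_inj actP rhoP) (rho_mxZ iota_inj actP rhoP)
  (rho_mx1 iota_inj actP rhoP) (rho_mxM iota_inj actP rhoP)).
Qed.

Let rL := lamL_yvec iota_inj actP lamP.
Let r'L := rhoL_yvec iota_inj actP rhoP.

Lemma irr_exist (mu : rect n m) :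
  (exists d (s : Uq q n -> 'M[K]_d), is_irr_hw (part mu) s) /\
  (exists d (s : Uq q m -> 'M[K]_d), is_irr_hw (conj_part mu) s).
Proof.
split; first exact: (vacuum_irr rep_lam howe_pair rL).
exact: (vacuum_irr' rep_rho howe_pair r'L).
Qed.

Lemma howe_decomposition (d d' : rect n m -> nat)
    (V : forall mu, Uq q n -> 'M[K]_(d mu)) (V' : forall mu, Uq q m -> 'M[K]_(d' mu)) :
    (forall mu, is_irr_hw (part mu) (V mu)) ->
    (forall mu, is_irr_hw (conj_part mu) (V' mu)) ->
  tensor_decomposition actL actR V V'.
Proof.
move=> Virr V'irr.
pose phiP mu := cid (tensor_embedding q_neq0 q_gen rep_lam rep_rho howe_pair
  rL r'L (Virr mu) (V'irr mu)).
pose phi mu := projT1 (phiP mu).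
have phiL mu : linear (phi mu) by rewrite /phi; case: (phiP mu) => ? /= [].
have phi_mod mu x : joint_mod v A A' mu (phi mu x) /\ (phi mu x = 0 -> x = 0).
  by rewrite /phi; case: (phiP mu) => ? /= [_ h _ _ _]; exact: h.
have phi_surj mu y : joint_mod v A A' mu y -> exists x, phi mu x = y.
  by rewrite /phi; case: (phiP mu) => ? /= [_ _ h _ _]; exact: h.
have phi_l mu a x : phi mu (V mu a *m x) = r a *m phi mu x.
  by rewrite /phi; case: (phiP mu) => ? /= [_ _ _ h _]; exact: h.
have phi_r mu b x : phi mu (x *m (V' mu b)^T) = r' b *m phi mu x.
  by rewrite /phi; case: (phiP mu) => ? /= [_ _ _ _ h]; exact: h.
exists (fun mu x => fvec (phi mu x)); split.
- by move=> mu c x y; rewrite phiL linearP.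
- pose f (x : {dffun forall mu : rect n m, 'M[K]_(d mu, d' mu)}) :=
    \sum_mu fvec (phi mu (x mu)).
  have f_inj : injective f.
    move=> x y /eqP; rewrite /f -!linear_sum (inj_eq fvecI) -subr_eq0 -sumrB => /eqP xy.
    have phiB mu : phi mu (x mu) - phi mu (y mu) = phi mu (x mu - y mu).
      by rewrite addrC -scaleN1r -phiL scaleN1r addrC.
    apply/ffunP => mu; apply/eqP; rewrite -subr_eq0; apply/eqP.
    apply: (phi_mod mu _).2; rewrite -phiB.
    apply: (joint_mod_direct howe_pair (y := fun mu => phi mu (x mu) - phi mu (y mu))) => //.
    by move=> nu; rewrite phiB; exact: (phi_mod nu _).1.
  have f_surj w : exists x, f x = w.
    have [x <-] := fvec_surj q_neq0 w.
    have [y [my ->]] := joint_mod_total howe_pair x.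
    pose X mu := projT1 (cid (phi_surj mu _ (my mu))).
    exists [ffun mu => X mu]; rewrite /f linear_sum; apply: eq_bigr => mu _.
    by rewrite ffunE /X; case: cid => z /= ->.
  exists (fun w => projT1 (cid (f_surj w))) => [x|w].
    by apply: f_inj; case: cid.
  by case: cid.
- by move=> mu a x; rewrite phi_l fvec_l.
- by move=> mu b x; rewrite phi_r fvec_r.
Qed.

Definition component (mu : rect n m) : set (Ext q N) :=
  [set w | exists2 x, joint_mod v A A' mu x & w = fvec x].

Let op := biact actL actR.

Lemma op_fvec a : exists2 b, (A b \/ A' b) & forall x, op a (fvec x) = fvec (b *m x).
Proof.
case: a => a; [exists (r a)|exists (r' a)].
- by left; exists a.
- by move=> x; rewrite fvec_l.
- by right; exists a.
- by move=> x; rewrite fvec_r.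
Qed.

Lemma component_submodule mu : submodule op (component mu).
Proof.
split.
- by exists 0; [exact: JointMod0|rewrite linear0].
- move=> _ _ [x mx ->] [y my ->]; exists (x + y); last by rewrite linearD.
  exact: (joint_modD (A := A)).
- move=> c _ [x mx ->]; exists (c *: x); last by rewrite linearZ.
  exact: (joint_modZ howe_pair).
- move=> a _ [x mx ->]; have [b bA ->] := op_fvec a; exists (b *m x) => //.
  by case: bA => hb; [exact: (joint_mod_l howe_pair)|exact: (joint_mod_r howe_pair)].
Qed.

Lemma component_v mu : component mu (fvec (v mu)).
Proof. by exists (v mu) => //; exact: (joint_mod_v howe_pair). Qed.

Lemma fvec_v_neq0 mu : fvec (v mu) != 0.
Proof. by rewrite -(linear0 fvec) (inj_eq fvecI); exact: (vacuum_neq0 howe_pair). Qed.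

(** [joint_mod_simple], transported from coordinates. *)
Lemma component_simple mu : simple op (component mu).
Proof.
split; first exact: component_submodule.
  move=> h; have := component_v mu; rewrite h /= => /eqP.
  by rewrite (negPf (fvec_v_neq0 mu)).
move=> T [T0 TD TZ Top] Tsub.
have [[w [Tw w0]]|now] := pselect (exists w, T w /\ w != 0); [right|left]; last first.
  apply/seteqP; split=> w /=; last by move=> ->.
  by move=> Tw; apply/eqP; apply: contrapT => /negP w0; apply: now; exists w.
pose S x := T (fvec x).
have Ssub : subspace_of S.
  split; rewrite /S; first by rewrite linear0.
    by move=> x y Sx Sy; rewrite linearD; exact: TD.
  by move=> c x Sx; rewrite linearZ; exact: TZ.
have SA a y : A a -> S y -> S (a *m y).
  by move=> [b ->] Sy; rewrite /S fvec_l; exact: (Top (inl b)).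
have SA' a y : A' a -> S y -> S (a *m y).
  by move=> [b ->] Sy; rewrite /S fvec_r; exact: (Top (inr b)).
have [x mx wx] := Tsub _ Tw.
have x0 : x != 0 by apply: contraNneq w0 => x0; rewrite wx x0 linear0.
have Sx : S x by rewrite /S -wx.
have Sv := joint_mod_simple howe_pair Ssub SA SA' Sx mx x0.
apply/seteqP; split=> // _ [y my ->].
rewrite -/(S y); elim: my => [|a b z Aa A'b _ Sz]; first by case: Ssub.
case: Ssub => _ SD _; apply: SD => //; rewrite -mulmxA.
by apply: SA => //; exact: SA'.
Qed.

(** An isomorphism would send v mu to a joint highest weight vector of the other
component, hence to a multiple of v nu; but some L_i has different eigenvalues
on v mu and v nu. *)
Lemma component_not_isomorphic mu nu : mu != nu ->
  ~ isomorphic op (component mu) (component nu).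
Proof.
move=> ne [f [[fto finj _] fD fZ fop]].
have mv := component_v mu.
have f0 : f 0 = 0.
  by rewrite -[0 in LHS](scale0r (fvec (v mu))) fZ // scale0r.
have [y my fy] := fto _ mv.
have fv a x : a *m v mu = x -> (A a \/ A' a) -> f (fvec x) = fvec (a *m y).
  move=> <- [[b ->]|[b ->]].
    by rewrite fvec_l -[actL b _]/(op (inl b) _) fop // fy fvec_l.
  by rewrite fvec_r -[actR b _]/(op (inr b) _) fop // fy fvec_r.
have yE : y = dot (v nu) y *: v nu.
  apply: (joint_mod_hw howe_pair my) => i; apply: fvecI; rewrite linear0 -[RHS]f0.
    rewrite -(linear0 fvec); apply/esym/fv; last by left; exists (UE q i).
    exact: (side_hw (pair_l howe_pair)).
  rewrite -(linear0 fvec); apply/esym/fv; last by right; exists (UE q i).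
  exact: (side_hw (pair_r howe_pair)).
set c := dot _ _ in yE.
have c0 : c != 0.
  apply/eqP=> c0; have : fvec (v mu) = 0.
    apply: finj; rewrite ?inE //; first by case: (component_submodule mu).
    by rewrite fy yE c0 scale0r linear0 f0.
  by apply/eqP; exact: fvec_v_neq0.
have [i ci] := side_sep (pair_l howe_pair) ne.
case/eqP: ci; have := fv _ _ (rL mu i) (or_introl (ex_intro _ (UL q i) erefl)).
rewrite linearZ fZ // fy -linearZ => /fvecI.
rewrite yE -scalemxAr (rL nu i) !scalerA => /eqP.
rewrite -subr_eq0 -scalerBl scaler_eq0 (negPf (vacuum_neq0 howe_pair nu)) orbF.
by rewrite mulrC -mulrBr mulf_eq0 (negPf c0) subr_eq0 => /eqP.
Qed.

Lemma howe_multiplicity_free : multiplicity_free op.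
Proof.
exists #|{: rect n m}|, (fun i => component (enum_val i)); split.
- by move=> i; exact: component_simple.
- move=> w; have [x <-] := fvec_surj q_neq0 w.
  have [y [my xE]] := joint_mod_total howe_pair x.
  exists [ffun i => fvec (y (enum_val i))]; split.
    split=> [i|]; first by rewrite ffunE; exists (y (enum_val i)).
    rewrite xE linear_sum (reindex _ (onW_bij _ (enum_val_bij _))).
    by apply: eq_bigr => i _; rewrite ffunE.
  move=> z [zc xz].
  have /choice [t tP] : forall mu, exists t, joint_mod v A A' mu t /\
      z (enum_rank mu) = fvec t.
    by move=> mu; have := zc (enum_rank mu); rewrite enum_rankK => -[t mt ->]; exists t.
  have yt : \sum_mu (y mu - t mu) = 0.
    apply: fvecI; rewrite linear0 sumrB linearB /= -xE xz.
    rewrite (reindex (@enum_rank _)) /=; last exact: onW_bij (@enum_rank_bij _).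
    rewrite (eq_bigr (fun mu => fvec (t mu))); last by move=> mu _; case: (tP mu).
    by apply/eqP; rewrite subr_eq0 [X in _ == X]linear_sum.
  have ytm mu : joint_mod v A A' mu (y mu - t mu).
    apply: (joint_modD (A := A)) => //; rewrite -scaleN1r.
    by apply: (joint_modZ howe_pair); case: (tP mu).
  apply/ffunP => i; rewrite ffunE.
  have /eqP := joint_mod_direct howe_pair ytm yt (enum_val i).
  rewrite subr_eq0 => /eqP ->; case: (tP (enum_val i)) => _ <-.
  by rewrite enum_valK.
- move=> i j ij; apply: component_not_isomorphic.
  by rewrite (inj_eq enum_val_inj).
Qed.

Lemma commutant_l : commutant (op_image actL) = op_image actR.
Proof.
apply/seteqP; split=> [f [flin fcomm]|_ [b ->]].
  have [a aP] := fvec_op_matrix q_neq0 flin.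
  have [b aE] : A' a.
    apply: (pair_commutant howe_pair) => _ [c ->].
    apply: mulmx_ext => x; apply: fvecI; rewrite -!mulmxA fvec_l !aP fvec_l.
    have := fcomm (actL c) (ex_intro _ c erefl).
    by move=> /(congr1 (fun g => g (fvec x))).
  exists b; apply/funext => w; have [x <-] := fvec_surj q_neq0 w.
  by rewrite -aP aE fvec_r.
split; first by case: actP => -[h _ _ _] _; exact: h.
move=> _ [a ->]; apply/funext => w; have [x <-] := fvec_surj q_neq0 w.
rewrite /= -fvec_l -!fvec_r -fvec_l; congr fvec; rewrite !mulmxA; congr (_ *m _).
by apply/esym/(pair_comm howe_pair); [exists a|exists b].
Qed.

Lemma commutant_r : commutant (op_image actR) = op_image actL.
Proof.
apply/seteqP; split=> [f [flin fcomm]|_ [a ->]].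
  have [a aP] := fvec_op_matrix q_neq0 flin.
  have [b aE] : A a.
    apply: (pair_commutant (dual_pair_sym howe_pair)) => _ [c ->].
    apply: mulmx_ext => x; apply: fvecI; rewrite -!mulmxA fvec_r !aP fvec_r.
    have := fcomm (actR c) (ex_intro _ c erefl).
    by move=> /(congr1 (fun g => g (fvec x))).
  exists b; apply/funext => w; have [x <-] := fvec_surj q_neq0 w.
  by rewrite -aP aE fvec_l.
split; first by case: actP => -[h _ _ _] _; exact: h.
move=> _ [b ->]; apply/funext => w; have [x <-] := fvec_surj q_neq0 w.
rewrite /= -fvec_r -!fvec_l -fvec_r; congr fvec; rewrite !mulmxA; congr (_ *m _).
by apply/(pair_comm howe_pair); [exists a|exists b].
Qed.

End SkewHoweDuality.

Theorem mainTheorem1 (R : realType) (n m : nat) (n_gt0 : (0 < n)%N)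
    (m_gt0 : (0 < m)%N)
    (lam : Uq (qvar R) n -> Clq (qvar R) (n * m))
    (rho : Uq (qvar R) m -> Clq (qvar R) (n * m))
    (act : Clq (qvar R) (n * m) -> Ext (qvar R) (n * m) -> Ext (qvar R) (n * m))
    (lamP : is_lambda lam) (rhoP : is_rho rho) (actP : is_fock_action act) :
  let actL := fun a : Uq (qvar R) n => act (lam a) in
  let actR := fun b : Uq (qvar R) m => act (rho b) in
  [/\ (forall mu : rect n m,
         (exists d (r : Uq (qvar R) n -> 'M[Cq R]_d), is_irr_hw (part mu) r) /\
         (exists d (r : Uq (qvar R) m -> 'M[Cq R]_d), is_irr_hw (conj_part mu) r)),
      (forall (d d' : rect n m -> nat)
         (V : forall mu : rect n m, Uq (qvar R) n -> 'M[Cq R]_(d mu))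
         (V' : forall mu : rect n m, Uq (qvar R) m -> 'M[Cq R]_(d' mu)),
         (forall mu, is_irr_hw (part mu) (V mu)) ->
         (forall mu, is_irr_hw (conj_part mu) (V' mu)) ->
         tensor_decomposition actL actR V V'),
      multiplicity_free (biact actL actR),
      commutant (op_image actL) = op_image actR
    & commutant (op_image actR) = op_image actL].
Proof.
move=> actL actR.
have inj := @tofrac_inj (complex R : fieldType).
have frac := @fraction_quotient (complex R : fieldType).
split.
- exact: (irr_exist inj frac actP lamP rhoP).
- exact: (howe_decomposition inj frac actP lamP rhoP).
- exact: (howe_multiplicity_free inj frac actP lamP rhoP).
- exact: (commutant_l inj frac actP lamP rhoP).
- exact: (commutant_r inj frac actP lamP rhoP).
Qed.
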